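(* Let $M$ be a manifold with a complete Riemannian metric $g$ and a connection $\nabla$ on $TM$ compatible with $g$, and let $I=[0,1]$. Then for every integer $k\ge 0$, the polynomial-like curves are dense in $C^k(I,M)$ with respect to the compact-open $C^k$ topology.
   Context: Manifolds are finite-dimensional, smooth and without boundary. A polynomial-like curve of degree $n$ on $M$ is a (sufficiently differentiable) curve $\gamma$ whose $n$-th order covariant derivative vanishes: $\nabla^{(n)}_{\dot\gamma}\dot\gamma(t):=\nabla_{\dot\gamma}\cdots\nabla_{\dot\gamma}\dot\gamma(t)=0$ ($n$ covariant derivatives) for all $t$; e.g. a $\nabla$-geodesic is a polynomial-like curve of degree $1$. A polynomial-like curve is one of some degree $n$. The compact-open $C^k$ topology is that of uniform convergence, in local coordinates on compact sets, of derivatives up to order $k$. *)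

(* Defs.v *)
From HB Require Import structures.
From mathcomp Require Import all_boot all_order all_algebra.
From mathcomp Require Import all_classical all_reals all_analysis.
Set Implicit Arguments.
Unset Strict Implicit.
Unset Printing Implicit Defensive.
Import Order.TTheory GRing.Theory Num.Theory.
Import numFieldNormedType.Exports.
Local Open Scope classical_set_scope.
Local Open Scope ring_scope.

(* For open U: f is C^k on U.  Only the values of f on U matter. *)
Fixpoint Ck_on (R : realType) (V W : normedModType R) (k : nat)
    (U : set V) (f : V -> W) : Prop :=
  match k with
  | 0 => forall x, U x -> {for x, continuous f}
  | k'.+1 => (forall x, U x -> differentiable f x) /\
             (forall v : V, Ck_on k' U (fun x => 'D_v f x))
  end.

Definition smooth_on (R : realType) (V W : normedModType R)
    (U : set V) (f : V -> W) : Prop :=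
  forall k, Ck_on k U f.

(* A chart is a homeomorphism from an open set of M onto an open set of R^n.
   Both maps are total functions; their values outside [chart_dom], resp.
   outside [chart_img], are irrelevant. *)
Record chart (R : realType) (n : nat) (M : topologicalType) := Chart {
  chart_dom : set M;
  chart_fun :> M -> 'rV[R]_n;
  chart_inv : 'rV[R]_n -> M;
  chart_dom_open : open chart_dom;
  chart_img_open : open (chart_fun @` chart_dom);
  chart_funK : forall p, chart_dom p -> chart_inv (chart_fun p) = p;
  chart_fun_continuous : {within chart_dom, continuous chart_fun};
  chart_inv_continuous :
    {within chart_fun @` chart_dom, continuous chart_inv} }.

Definition chart_img (R : realType) (n : nat) (M : topologicalType)
    (c : chart R n M) : set 'rV[R]_n :=
  c @` chart_dom c.

Definition overlap (R : realType) (n : nat) (M : topologicalType)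
    (c c' : chart R n M) : set 'rV[R]_n :=
  c @` (chart_dom c `&` chart_dom c').

Definition transition (R : realType) (n : nat) (M : topologicalType)
    (c c' : chart R n M) : 'rV[R]_n -> 'rV[R]_n :=
  c' \o chart_inv c.

Definition compatible (R : realType) (n : nat) (M : topologicalType)
    (c c' : chart R n M) : Prop :=
  smooth_on (overlap c c') (transition c c') /\
  smooth_on (overlap c' c) (transition c' c).

Record manifold (R : realType) (n : nat) := Manifold {
  point :> topologicalType;
  point_hausdorff : hausdorff_space point;
  point_second_countable : @second_countable point;
  atlas : set (chart R n point);
  atlas_cover : forall p, exists2 c, atlas c & chart_dom c p;
  atlas_compatible : forall c c', atlas c -> atlas c' -> compatible c c';
  atlas_maximal :
    forall c, (forall c', atlas c' -> compatible c c') -> atlas c }.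

Definition chart_at (R : realType) (n : nat) (M : manifold R n) (p : M) :
    chart R n M :=
  s2val (cid2 (atlas_cover p)).

(* [rmetric g c x u v] is the inner product, at the point with coordinates x
   in the chart c, of the tangent vectors with components u and v in c. *)
Record riemannian_metric (R : realType) (n : nat) (M : manifold R n) :=
    RiemannianMetric {
  rmetric :> chart R n M -> 'rV[R]_n -> 'rV[R]_n -> 'rV[R]_n -> R;
  rmetric_linear : forall c x u, atlas c -> chart_img c x ->
    forall (a : R) v w,
      rmetric c x u (a *: v + w) = a * rmetric c x u v + rmetric c x u w;
  rmetric_sym : forall c x u v, atlas c -> chart_img c x ->
    rmetric c x u v = rmetric c x v u;
  rmetric_posdef : forall c x u, atlas c -> chart_img c x ->
    u != 0 -> 0 < rmetric c x u u;
  rmetric_smooth : forall c u v, atlas c ->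
    smooth_on (chart_img c) (fun x => rmetric c x u v : R^o);
  rmetric_transition : forall c c' x u v,
    atlas c -> atlas c' -> overlap c c' x ->
    rmetric c x u v =
    rmetric c' (transition c c' x)
      ('D_u (transition c c') x) ('D_v (transition c c') x) }.

(* A connection on TM, given by its Christoffel symbols: in the chart c,
     nabla_u Y (x) = D_u Y (x) + christoffel c x u (Y x),
   that is, [christoffel c x u v] is the vector with components
   Gamma^k_{ij}(x) u^i v^j.  No symmetry is required (torsion is allowed).
   The transition law says that nabla_u Y does not depend on the chart: it is
   obtained by differentiating Y' (tau x) = D tau (x) (Y x) along u. *)
Record connection (R : realType) (n : nat) (M : manifold R n) := Connection {
  christoffel :> chart R n M -> 'rV[R]_n -> 'rV[R]_n -> 'rV[R]_n -> 'rV[R]_n;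
  christoffel_linearl : forall c x v, atlas c -> chart_img c x ->
    linear (fun u => christoffel c x u v);
  christoffel_linearr : forall c x u, atlas c -> chart_img c x ->
    linear (christoffel c x u);
  christoffel_smooth : forall c u v, atlas c ->
    smooth_on (chart_img c) (fun x => christoffel c x u v);
  christoffel_transition : forall c c' x u v,
    atlas c -> atlas c' -> overlap c c' x ->
    let tau := transition c c' in
    'D_(christoffel c x u v) tau x =
    'D_u (fun y => 'D_v tau y) x
      + christoffel c' (tau x) ('D_u tau x) ('D_v tau x) }.

Definition covariant_derivative (R : realType) (n : nat) (M : manifold R n)
    (nabla : connection M) (c : chart R n M) (u : 'rV[R]_n)
    (Y : 'rV[R]_n -> 'rV[R]_n) (x : 'rV[R]_n) : 'rV[R]_n :=
  'D_u Y x + nabla c x u (Y x).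

(* u <Y, Z> = <nabla_u Y, Z> + <Y, nabla_u Z> for vector fields Y, Z *)
Definition metric_compatible (R : realType) (n : nat) (M : manifold R n)
    (nabla : connection M) (g : riemannian_metric M) : Prop :=
  forall c, atlas c ->
  forall Y Z : 'rV[R]_n -> 'rV[R]_n,
  smooth_on (chart_img c) Y -> smooth_on (chart_img c) Z ->
  forall x u, chart_img c x ->
  'D_u (fun y => g c y (Y y) (Z y) : R^o) x =
  g c x (covariant_derivative nabla c u Y x) (Z x)
    + g c x (Y x) (covariant_derivative nabla c u Z x).

(* Curves I -> M are represented by total functions R -> M of which only the
   restriction to I = [0, 1] is ever used; derivatives are taken relative to I,
   hence are one-sided at 0 and 1. *)
Definition unitI (R : realType) : set R := `[0, 1].

Definition diffquotI (R : realType) (V : normedModType R) (f : R -> V)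
    (t : R) : set_system V :=
  (s - t)^-1 *: (f s - f t) @[s --> within (@unitI R) t^'].

Definition derivableI (R : realType) (V : normedModType R) (f : R -> V)
    (t : R) : Prop :=
  cvg (diffquotI f t).

Definition derivI (R : realType) (V : normedModType R) (f : R -> V)
    (t : R) : V :=
  lim (diffquotI f t).

Definition derivnI (R : realType) (V : normedModType R) (j : nat)
    (f : R -> V) : R -> V :=
  iter j (@derivI R V) f.

(* The composite c \o gamma is meaningful near t, relative to I, as soon as
   gamma t lies in the domain of c, by continuity of gamma. *)
Definition is_Ck_curve (R : realType) (n : nat) (M : manifold R n) (k : nat)
    (gamma : R -> M) : Prop :=
  {within @unitI R, continuous gamma} /\
  forall c t, atlas c -> unitI t -> chart_dom c (gamma t) ->
    (forall j, (j < k)%N -> derivableI (derivnI j (c \o gamma)) t) /\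
    derivnI k (c \o gamma) s @[s --> within (@unitI R) (nbhs t)]
      --> derivnI k (c \o gamma) t.

(* The space C^k(I, M) *)
Record Ck_curve (R : realType) (n : nat) (k : nat) (M : manifold R n) :=
    CkCurve {
  curve_fun :> R -> M;
  curve_Ck : is_Ck_curve k curve_fun }.

(* The curves whose derivatives up to order k are, in the chart c, uniformly
   e-close to those of gamma on K *)
Definition Ck_neighborhood (R : realType) (n : nat) (k : nat)
    (M : manifold R n) (gamma : Ck_curve k M) (c : chart R n M)
    (K : set R) (e : R) : set (Ck_curve k M) :=
  [set sigma : Ck_curve k M |
    sigma @` K `<=` chart_dom c /\
    forall (j : nat) (t : R), (j <= k)%N -> K t ->
      `|derivnI j (c \o sigma) t - derivnI j (c \o gamma) t| < e].

Definition Ck_subbase (R : realType) (n : nat) (k : nat) (M : manifold R n) :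
    set (set (Ck_curve k M)) :=
  [set U | exists (gamma : Ck_curve k M) (c : chart R n M) (K : set R) (e : R),
    [/\ atlas c, compact K, K `<=` @unitI R, gamma @` K `<=` chart_dom c &
      0 < e /\ U = Ck_neighborhood gamma c K e]].

Section Ck_topology.
Variables (R : realType) (n k : nat) (M : manifold R n).
HB.instance Definition _ := gen_eqMixin (Ck_curve k M).
HB.instance Definition _ := gen_choiceMixin (Ck_curve k M).
HB.instance Definition _ := @isSubBaseTopological.Build (Ck_curve k M)
  (set (Ck_curve k M)) (@Ck_subbase R n k M) id.
End Ck_topology.

(* Components in the chart c of the velocity of gamma *)
Definition velocity (R : realType) (n : nat) (M : manifold R n)
    (gamma : R -> M) (c : chart R n M) (t : R) : 'rV[R]_n :=
  derivI (c \o gamma) t.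

(* The covariant derivative nabla_{gamma'} V of a vector field V along gamma,
   where V c t are the components in c of the vector at time t. *)
Definition covariant_derivative_along (R : realType) (n : nat)
    (M : manifold R n) (nabla : connection M) (gamma : R -> M)
    (V : chart R n M -> R -> 'rV[R]_n) (c : chart R n M) (t : R) :
    'rV[R]_n :=
  derivI (V c) t + nabla c (c (gamma t)) (velocity gamma c t) (V c t).

(* gamma is C^{m+1} on I, so that m covariant derivatives of its velocity make
   sense, and the m-th one vanishes on I. *)
Definition polynomial_like_of_degree (R : realType) (n : nat)
    (M : manifold R n) (nabla : connection M) (m : nat) (gamma : R -> M) :
    Prop :=
  is_Ck_curve m.+1 gamma /\
  forall c t, atlas c -> unitI t -> chart_dom c (gamma t) ->
    iter m (covariant_derivative_along nabla gamma) (velocity gamma) c t = 0.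

Definition polynomial_like (R : realType) (n : nat) (M : manifold R n)
    (nabla : connection M) (gamma : R -> M) : Prop :=
  exists m, polynomial_like_of_degree nabla m gamma.

(* By [rmetric_transition] the choice of chart is immaterial. *)
Definition speed (R : realType) (n : nat) (M : manifold R n)
    (g : riemannian_metric M) (gamma : R -> M) (t : R) : R :=
  let c := chart_at (gamma t) in
  Num.sqrt
    (g c (c (gamma t)) (velocity gamma c t) (velocity gamma c t)).

Definition curve_length (R : realType) (n : nat) (M : manifold R n)
    (g : riemannian_metric M) (gamma : R -> M) : \bar R :=
  (\int[lebesgue_measure]_(t in @unitI R) (speed g gamma t)%:E)%E.

(* The distance is +oo between points that no curve joins.  C^1 curves may
   have vanishing velocity, so they give the same infimum as piecewise C^1
   curves. *)
Definition riemannian_distance (R : realType) (n : nat) (M : manifold R n)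
    (g : riemannian_metric M) (p q : M) : \bar R :=
  ereal_inf [set l | exists gamma : R -> M,
    [/\ is_Ck_curve 1 gamma, gamma 0 = p, gamma 1 = q
      & l = curve_length g gamma]].

Definition complete_metric (R : realType) (n : nat) (M : manifold R n)
    (g : riemannian_metric M) : Prop :=
  forall u : nat -> M,
  (forall e : R, 0 < e -> exists N, forall i j, (N <= i)%N -> (N <= j)%N ->
    (riemannian_distance g (u i) (u j) < e%:E)%E) ->
  exists p : M, riemannian_distance g (u i) p @[i --> \oo] --> 0%E.

(* Main.v *)
From HB Require Import structures.
From mathcomp Require Import all_boot all_order all_algebra.
From mathcomp Require Import all_classical all_reals all_analysis.
From mathcomp Require Import finmap ring lra.
Require Import Defs.

(** Let [gamma] be a curve of class [C^k], with [k >= 1], and let [E] be a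
    parallel frame along it: [n] vector fields [E_i] along [gamma], independent
    at each time, whose covariant derivatives along [gamma] vanish
    ([parallel_frame_exists]).  Write [gamma' = sum_i u_i E_i]; the coefficients
    [u] are of class [C^(k-1)].  Conversely [gamma] and [E] are the solution,
    for [p = u], of the frame equations
      [sigma' = sum_i p_i e_i],   [nabla_(sigma') e_i = 0].
    Along any solution, covariant differentiation acts on the coefficients
    alone, so that the [m]-th covariant derivative of [sigma'] is
    [sum_i p_i^(m) e_i] ([iter_covariant_derivative]): if the [p_i] are
    polynomials, then [sigma] is a polynomial-like curve.

    It remains to approximate [u] by polynomials [p] in the [C^(k-1)] topology
    ([row_poly_approx], which integrates Bernstein polynomials) and to solve the
    frame equations for [p].  Since the solution for [u] exists on all of
    the unit interval, those for nearby [p] also do and stay near it: each chart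
    gives an ordinary differential equation with locally Lipschitz right-hand
    side, and [interval_induction] chains the local solutions ([perturbation]).
    This is convergence in [C^0] of the curves and of the frames.  The frame
    equations then express derivatives of the solutions by lower ones and by
    derivatives of [p], so that they also converge, up to order [k]
    ([jointC_frame_equation]).

    A curve that is only continuous is first replaced by a curve of class [C^1]
    made of short segments in charts, each of which is traversed with zero
    velocity at both ends ([C1_approximant]).

    Vectors are rows, and row [i] of a frame in a chart has the components of
    [e_i] there.  Everything that depends on the chart is a function of the
    chart, subject to the transformation law by the Jacobian of the
    transitions. *)

Set Implicit Arguments.
Unset Strict Implicit.
Unset Printing Implicit Defensive.
Import Order.TTheory GRing.Theory Num.Theory.
Import numFieldNormedType.Exports.
Local Open Scope classical_set_scope.
Local Open Scope ring_scope.

(** * Induction along an interval *)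

Section RealInduction.
Variable R : realType.
Implicit Types (a b t : R) (P : R -> Prop).

(** The supremum of the points where [P] holds is reached and, unless it is
    [b0], passed, by one step across it.  Only steps across the point that
    provides them are needed. *)
Lemma interval_induction (a0 b0 : R) P : a0 <= b0 -> P a0 ->
  (forall t, a0 <= t <= b0 -> exists2 d : R, 0 < d &
     forall a b, a0 <= a <= t -> t <= b <= b0 -> t - d < a -> b < t + d ->
       P a -> P b) ->
  P b0.
Proof.
move=> ab0 P0 step; pose S := [set t | a0 <= t <= b0 /\ P t].
have S0 : S a0 by rewrite /S /= lexx ab0.
have supS : has_sup S by split; [exists a0 | exists b0 => t [/andP[]]].
have a0t : a0 <= sup S by apply: ub_le_sup => //; case: supS.
have tb0 : sup S <= b0 by apply: ge_sup; [exists a0 | move=> t [/andP[]]].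
have [|d d0 stepd] := step (sup S); first by rewrite a0t tb0.
have [a [/andP[a0a ab] Pa] da] := sup_adherent d0 supS.
have aS : a <= sup S by apply: ub_le_sup; [case: supS|split=> //; apply/andP].
pose b := Num.min b0 (sup S + d / 2).
have d2 : 0 < d / 2 by rewrite divr_gt0.
have Sb : sup S <= b by rewrite /b le_min tb0 lerDl ltW.
have bb0 : b <= b0 by rewrite /b ge_min lexx.
have Pb : P b.
  apply: (stepd a) => //; rewrite ?a0a ?aS ?Sb ?bb0 //.
  rewrite (@le_lt_trans _ _ (sup S + d / 2)) ?ge_min ?lexx ?orbT //.
  by rewrite ltrD2l ltr_pdivrMr // ltr_pMr // ltr1n.
have [bE|bE] := leP b0 (sup S + d / 2).
  by rewrite /b (min_l bE) in Pb.
have : b <= sup S.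
  apply: ub_le_sup; [by case: supS|split=> //].
  by rewrite bb0 andbT (le_trans a0t).
by rewrite /b (min_r (ltW bE)) gerDl leNgt d2.
Qed.

End RealInduction.

(** * Derivatives relative to a set of reals *)

Section Derivative.
Variable R : realType.
Implicit Types (U V W : normedModType R) (A : set R) (t : R).

(** A first-order expansion rather than a limit of quotients: it needs no
    exception at [s = t], and one-sided derivatives at the ends of an interval
    are the case of a closed segment [A]. *)
Definition has_deriv V A (f : R -> V) t (l : V) :=
  forall e : R, 0 < e -> \forall s \near t, A s ->
    `|f s - f t - (s - t) *: l| <= e * `|s - t|.

Definition cont_within (T : topologicalType) A (f : R -> T) t :=
  f s @[s --> within A (nbhs t)] --> f t.

Definition bounded_linear V W (L : V -> W) :=
  [/\ forall u v, L (u - v) = L u - L v,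
      forall (a : R) u, L (a *: u) = a *: L u &
      exists2 C : R, 0 < C & forall u, `|L u| <= C * `|u|].

Definition bounded_bilinear U V W (B : U -> V -> W) :=
  [/\ forall v, {morph B ^~ v : u u' / u - u'},
      forall u, {morph B u : v v' / v - v'},
      forall (a : R) u v, B (a *: u) v = a *: B u v,
      forall (a : R) u v, B u (a *: v) = a *: B u v &
      exists2 C : R, 0 < C & forall u v, `|B u v| <= C * `|u| * `|v|].

Lemma bounded_bilinearl U V W (B : U -> V -> W) v :
  bounded_bilinear B -> bounded_linear (B ^~ v).
Proof.
move=> [Bl Br Zl Zr [C C0 BC]]; split=> [u u'|a u|]; rewrite ?Bl //.
exists (C * (`|v| + 1)); first by rewrite mulr_gt0 // ltr_wpDl.
move=> u; rewrite (le_trans (BC _ _)) // mulrAC ler_wpM2r // ler_pM2l //.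
by rewrite lerDl.
Qed.

Lemma bounded_bilinearr U V W (B : U -> V -> W) u :
  bounded_bilinear B -> bounded_linear (B u).
Proof.
move=> [Bl Br Zl Zr [C C0 BC]]; split=> [v v'|a v|]; rewrite ?Br //.
exists (C * (`|u| + 1)); first by rewrite mulr_gt0 // ltr_wpDl.
move=> v; rewrite (le_trans (BC _ _)) // ler_wpM2r // ler_pM2l //.
by rewrite lerDl.
Qed.

Lemma bounded_linear_diff V W (f : V -> W) x :
  differentiable f x -> bounded_linear ('d f x).
Proof.
move=> df; split=> [u v|a u|]; rewrite ?linearB ?linearZ //.
exact: (linear_lipschitz (diff_continuous df)).
Qed.

Lemma cont_within_subset (T : topologicalType) A B (f : R -> T) t :
  A `<=` B -> cont_within B f t -> cont_within A f t.
Proof.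
move=> AB cf P Pt; have : \forall s \near t, B s -> P (f s) := cf P Pt.
by apply: filterS => s + As; apply; exact: AB.
Qed.

Lemma cont_within_near (T : topologicalType) A (f g : R -> T) t : A t ->
  (\forall s \near t, A s -> f s = g s) -> cont_within A f t -> cont_within A g t.
Proof.
move=> At fg cf; rewrite /cont_within -(nbhs_singleton fg At).
move=> P Pt; have Q : \forall s \near t, A s -> P (f s) := cf P Pt.
by apply: filterS2 fg Q => s fgs Ps As; rewrite /= -fgs //; exact: Ps.
Qed.

Lemma cont_within_pair (T U : topologicalType) A (f : R -> T) (g : R -> U) t :
  cont_within A f t -> cont_within A g t -> cont_within A (fun s => (f s, g s)) t.
Proof. by move=> fc gc; exact: (cvg_pair fc gc). Qed.

Lemma cont_withinP V A (f : R -> V) t : cont_within A f t <->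
  forall e : R, 0 < e -> \forall s \near t, A s -> `|f s - f t| < e.
Proof.
split=> [/cvgrPdist_lt c e e0|c].
  by have := c e e0; rewrite near_withinE; apply: filterS => s + As;
    rewrite distrC; exact.
apply/cvgrPdist_lt => e e0; rewrite near_withinE.
by apply: filterS (c e e0) => s + As; rewrite distrC; exact.
Qed.

Lemma has_deriv_near V A (f g : R -> V) t l : A t ->
  (\forall s \near t, A s -> f s = g s) -> has_deriv A f t l -> has_deriv A g t l.
Proof.
move=> At fg fl e e0; apply: filterS2 (fg) (fl e e0) => s fgs fls As.
by rewrite -(nbhs_singleton fg At) -(fgs As) fls.
Qed.

Lemma has_deriv_subset V A B (f : R -> V) t l :
  A `<=` B -> has_deriv B f t l -> has_deriv A f t l.
Proof.
by move=> AB fl e /fl; apply: filterS => s + As; apply; exact: AB.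
Qed.

Lemma has_derivU V A B (f : R -> V) t l :
  has_deriv A f t l -> has_deriv B f t l -> has_deriv (A `|` B) f t l.
Proof.
move=> Al Bl e e0; have := Bl e e0; have := Al e e0.
by apply: filterS2 => s As Bs [/As|/Bs].
Qed.

Lemma cont_withinU (T : topologicalType) A B (f : R -> T) t :
  cont_within A f t -> cont_within B f t -> cont_within (A `|` B) f t.
Proof.
move=> Al Bl P Pt.
have : \forall s \near t, B s -> P (f s) := Bl P Pt.
have : \forall s \near t, A s -> P (f s) := Al P Pt.
by apply: filterS2 => s As Bs [/As|/Bs].
Qed.

Lemma has_deriv_lip V A (f : R -> V) t l : has_deriv A f t l ->
  \forall s \near t, A s -> `|f s - f t| <= (`|l| + 1) * `|s - t|.
Proof.
move=> /(_ 1 ltr01); apply: filterS => s + As => /(_ As) fs.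
rewrite -(subrK ((s - t) *: l) (f s - f t)) (le_trans (ler_normD _ _)) //.
by rewrite addrC mulrDl lerD // normrZ mulrC.
Qed.

Lemma near_dist t (e : R) : 0 < e -> \forall s \near t, `|s - t| < e.
Proof.
by move=> e0; apply/nbhs_ballP; exists e => //= s; rewrite /ball /= distrC.
Qed.

Lemma has_deriv_cont_within V A (f : R -> V) t l : has_deriv A f t l -> cont_within A f t.
Proof.
move=> fl; apply/cont_withinP => e e0; have l0 : 0 < `|l| + 1 by rewrite ltr_wpDl.
have := has_deriv_lip fl; have := @near_dist t (e / (`|l| + 1)).
rewrite divr_gt0 // => /(_ isT); apply: filterS2 => s ste + As => /(_ As).
by move=> /le_lt_trans; apply; rewrite mulrC -ltr_pdivlMr.
Qed.

Lemma has_deriv_cst V A (v : V) t : has_deriv A (fun=> v) t 0.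
Proof.
move=> e e0; near=> s => _; rewrite subrr scaler0 subr0 normr0.
by rewrite mulr_ge0 // ltW.
Unshelve. all: by end_near. Qed.

Lemma has_deriv_id A t : has_deriv A (@id R) t 1.
Proof.
move=> e e0; near=> s => _; rewrite /GRing.scale /= mulr1 subrr normr0.
by rewrite mulr_ge0 // ltW.
Unshelve. all: by end_near. Qed.

Lemma has_derivD V A (f g : R -> V) t l k : has_deriv A f t l -> has_deriv A g t k ->
  has_deriv A (fun s => f s + g s) t (l + k).
Proof.
move=> fl gk e e0; have e2 : 0 < e / 2 by rewrite divr_gt0.
apply: filterS2 (fl _ e2) (gk _ e2) => s fs gs As.
rewrite scalerDr (opprD (f t)) (addrACA (f s)) opprD (addrACA (f s - f t)).
rewrite (le_trans (ler_normD _ _)) //.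
by rewrite [e in leRHS]splitr mulrDl; apply: lerD; [exact: fs|exact: gs].
Qed.

Lemma has_deriv_lin V W A (L : V -> W) (f : R -> V) t l : bounded_linear L ->
  has_deriv A f t l -> has_deriv A (L \o f) t (L l).
Proof.
move=> [LB LZ [C C0 LC]] fl e e0; have eC : 0 < e / C by rewrite divr_gt0.
have := fl _ eC; apply: filterS => s + As => /(_ As) fs.
rewrite /= -LZ -!LB (le_trans (LC _)) // mulrC -ler_pdivlMr //.
by rewrite mulrAC.
Qed.

Lemma has_deriv_comp V W A (Phi : V -> W) (f : R -> V) t l : A t ->
  differentiable Phi (f t) -> has_deriv A f t l ->
  has_deriv A (Phi \o f) t ('d Phi (f t) l).
Proof.
move=> At dPhi fl e e0.
have := @diff_locally _ _ _ _ _ dPhi => /eqaddoP dP.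
have [LB LZ [C C0 LC]] := bounded_linear_diff dPhi.
have l0 : 0 < `|l| + 1 by rewrite ltr_wpDl.
pose e1 := e / 2 / (`|l| + 1); have e10 : 0 < e1 by rewrite !divr_gt0.
pose e2 := e / 2 / C; have e20 : 0 < e2 by rewrite !divr_gt0.
have /nbhs_ballP[r /= r0 Pr] := dP _ e10.
have := fl _ e20; have := has_deriv_lip fl.
have /cont_withinP /(_ _ r0) := has_deriv_cont_within fl.
apply: filterS3 => s fr fL fe As.
have := Pr (f s - f t); rewrite -ball_normE /= sub0r normrN => /(_ (fr As)).
rewrite !fctE /= subrK => P1.
rewrite -LZ -(subrK ('d Phi (f t) (f s - f t)) (Phi (f s) - Phi (f t))).
rewrite -addrA -LB (le_trans (ler_normD _ _)) // [e in leRHS]splitr mulrDl.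
apply: lerD.
  move: P1; rewrite opprD addrA => /le_trans; apply.
  apply: (@le_trans _ _ (e1 * ((`|l| + 1) * `|s - t|))).
    by rewrite ler_pM2l ?fL.
  by rewrite mulrA /e1 divfK ?gt_eqF.
rewrite (le_trans (LC _)) //.
apply: (@le_trans _ _ (C * (e2 * `|s - t|))); first by rewrite ler_pM2l ?fe.
by rewrite mulrA (mulrC C) /e2 divfK ?gt_eqF.
Qed.

Lemma has_deriv_bilin U V W A (B : U -> V -> W) f g t l k : bounded_bilinear B ->
  has_deriv A f t l -> has_deriv A g t k ->
  has_deriv A (fun s => B (f s) (g s)) t (B l (g t) + B (f t) k).
Proof.
move=> bB fl gk e e0; have [Bl Br Zl Zr [C C0 BC]] := bB.
have e30 : 0 < e / 3 by rewrite divr_gt0.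
have H1 := has_deriv_lin (bounded_bilinearl (g t) bB) fl e30.
have H2 := has_deriv_lin (bounded_bilinearr (f t) bB) gk e30.
have fL := has_deriv_lip fl; have gL := has_deriv_lip gk.
pose K := C * (`|l| + 1) * (`|k| + 1).
have K0 : 0 < K by rewrite !mulr_gt0 // ltr_wpDl.
have nd : \forall s \near t, `|s - t| < e / 3 / K.
  by apply: near_dist; rewrite divr_gt0.
near=> s => As.
(* Of the three terms, the product of the increments is quadratic in [s - t]. *)
have -> : B (f s) (g s) - B (f t) (g t) - (s - t) *: (B l (g t) + B (f t) k) =
  B (f s - f t) (g s - g t)
  + ((B (f s) (g t) - B (f t) (g t) - (s - t) *: B l (g t))
  + (B (f t) (g s) - B (f t) (g t) - (s - t) *: B (f t) k)).
  rewrite Bl !Br scalerDr.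
  move: (B (f s) (g s)) (B (f s) (g t)) (B (f t) (g s)) (B (f t) (g t)).
  move=> a b c d; move: (_ *: _) (_ *: _) => x y.
  rewrite [X in _ = _ + X](addrACA (b - d)) -(opprD y) [RHS]addrA; congr (_ - _).
  by rewrite (addrC (b - d)) addrA subrK addrA subrK.
rewrite (le_trans (ler_normD _ _)) //.
have -> : e * `|s - t| = e / 3 * `|s - t| + (e / 3 * `|s - t| + e / 3 * `|s - t|).
  by rewrite -!mulrDl; congr (_ * _); field.
apply: lerD; last first.
  apply: (le_trans (ler_normD _ _)); apply: lerD.
    by move: As; near: s; exact: H1.
  by move: As; near: s; exact: H2.
have fs : `|f s - f t| <= (`|l| + 1) * `|s - t| by move: As; near: s; exact: fL.
have gs : `|g s - g t| <= (`|k| + 1) * `|s - t| by move: As; near: s; exact: gL.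
apply: (le_trans (BC _ _)).
apply: (@le_trans _ _ (C * ((`|l| + 1) * `|s - t|) * ((`|k| + 1) * `|s - t|))).
  by rewrite ler_pM ?mulr_ge0 ?ler_pM2l // ltW.
rewrite mulrA ler_wpM2r //.
have -> : C * ((`|l| + 1) * `|s - t|) * (`|k| + 1) = K * `|s - t|.
  by rewrite /K; ring.
by rewrite mulrC -ler_pdivlMr //; apply: ltW; near: s.
Unshelve. all: by end_near. Qed.

End Derivative.

(** * Calculus on a segment *)

Section Segments.
Variable R : realType.
Implicit Types (U V W : normedModType R) (A : set R) (t a b c : R).

Definition seg a b : set R := [set t | a <= t <= b].

Lemma unitI_seg : @unitI R = seg 0 1.
Proof. by apply/seteqP; split=> t; rewrite /unitI /seg /= in_itv. Qed.

Lemma segU a b c : a <= b -> b <= c -> seg a c = seg a b `|` seg b c.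
Proof.
move=> ab bc; apply/seteqP; split=> t /=.
  by move=> /andP[at_ tc]; have [tb|/ltW bt] := leP t b; [left|right]; apply/andP.
by move=> [] /andP[h1 h2]; apply/andP; split=> //;
  [exact: le_trans bc|exact: le_trans h1].
Qed.

Lemma sub_seg a b c d : c <= a -> b <= d -> seg a b `<=` seg c d.
Proof.
by move=> ca bd t /andP[at_ tb]; apply/andP; split;
  [exact: le_trans at_|exact: le_trans bd].
Qed.

Lemma seg_l a b : a <= b -> seg a b a. Proof. by rewrite /seg /= lexx. Qed.
Lemma seg_r a b : a <= b -> seg a b b. Proof. by rewrite /seg /= lexx andbT. Qed.

Lemma seg_eq a t : seg a a t -> t = a.
Proof. by move=> ?; apply/eqP; rewrite eq_le andbC. Qed.

Lemma seg_dnbhs_proper a b t : a < b -> seg a b t ->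
  ProperFilter (within (seg a b) t^').
Proof.
move=> ab /andP[at_ tb]; apply: Build_ProperFilter_ex => P.
rewrite /within /= /dnbhs /within /= => /nbhs_ballP[e /= e0 eP].
have [bt|tb'] := ltP t b.
  have m0 : 0 < Num.min (e / 2) (b - t) by rewrite lt_min divr_gt0 // subr_gt0.
  exists (t + Num.min (e / 2) (b - t)); apply: eP.
  - rewrite /ball /= opprD addrA subrr sub0r normrN gtr0_norm //.
    by rewrite gt_min ltr_pdivrMr // ltr_pMr // ltr1n.
  - by rewrite /= -subr_eq0 addrAC subrr add0r gt_eqF.
  - rewrite /seg /=; apply/andP; split; first by rewrite (le_trans at_) // lerDl ltW.
    by rewrite -lerBrDl ge_min lexx orbT.
have {tb' tb}tE : t = b by apply/eqP; rewrite eq_le tb tb'.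
have m0 : 0 < Num.min (e / 2) (b - a) by rewrite lt_min divr_gt0 // subr_gt0.
exists (t - Num.min (e / 2) (b - a)); apply: eP.
- rewrite /ball /= opprB addrC subrK gtr0_norm //.
  by rewrite gt_min ltr_pdivrMr // ltr_pMr // ltr1n.
- by rewrite /= -subr_eq0 addrAC subrr add0r oppr_eq0 gt_eqF.
- rewrite /seg /=; apply/andP; split; last by rewrite tE gerBl ltW.
  by rewrite tE lerBrDl -lerBrDr ge_min lexx orbT.
Qed.

(** Solving for [l] in the first-order expansion gives the difference quotient,
    away from [s = t]. *)
Lemma has_deriv_cvg V A (f : R -> V) t l : has_deriv A f t l <->
  (s - t)^-1 *: (f s - f t) @[s --> within A t^'] --> l.
Proof.
split=> [fl|/cvgrPdist_le fl e e0].
  apply/cvgrPdist_le => e e0.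
  suff : \forall s \near t, s != t -> A s ->
      `|l - (s - t)^-1 *: (f s - f t)| <= e by [].
  apply: filterS (fl e e0) => s + st As.
  move=> /(_ As); have st0 : s - t != 0 by rewrite subr_eq0.
  rewrite -ler_pdivrMr ?normr_gt0 // => H; apply: le_trans H.
  rewrite distrC -[l in leLHS](scalerK st0) -scalerBr normrZ normfV mulrC.
  exact: lexx.
have : \forall s \near t, s != t -> A s ->
  `|l - (s - t)^-1 *: (f s - f t)| <= e := fl e e0.
apply: filterS => s + As; have [->|st /(_ isT As)] := eqVneq s t.
  by rewrite !subrr scale0r subr0 !normr0 mulr0.
have st0 : s - t != 0 by rewrite subr_eq0.
rewrite distrC -{1}[l](scalerK st0) -scalerBr normrZ normfV mulrC.
by rewrite ler_pdivrMr ?normr_gt0.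
Qed.

Lemma has_deriv_unique V a b (f : R -> V) t l k : a < b -> seg a b t ->
  has_deriv (seg a b) f t l -> has_deriv (seg a b) f t k -> l = k.
Proof.
move=> ab abt /has_deriv_cvg fl /has_deriv_cvg fk.
have := seg_dnbhs_proper ab abt => pf.
exact: cvg_unique fl fk.
Qed.

Lemma has_deriv_derivI V (f : R -> V) t l : unitI t -> has_deriv (@unitI R) f t l ->
  derivableI f t /\ derivI f t = l.
Proof.
move=> It fl; have pf : ProperFilter (within (@unitI R) t^').
  by rewrite unitI_seg in It *; apply: seg_dnbhs_proper.
have /has_deriv_cvg fl' := fl.
by split; [apply/cvg_ex; exists l|apply: cvg_lim].
Qed.

Lemma derivableI_has_deriv V (f : R -> V) t : derivableI f t ->
  has_deriv (@unitI R) f t (derivI f t).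
Proof. by move=> ft; apply/has_deriv_cvg. Qed.

Lemma has_derivN V A (f : R -> V) t l : has_deriv A f t l ->
  has_deriv A (fun s => - f s) t (- l).
Proof.
move=> /(@has_deriv_lin _ _ _ _ (fun v => - v)); apply; split=> [u v|a u|].
- by rewrite opprD.
- by rewrite scalerN.
- by exists 1 => // u; rewrite normrN mul1r.
Qed.

Lemma has_derivB V A (f g : R -> V) t l k : has_deriv A f t l -> has_deriv A g t k ->
  has_deriv A (fun s => f s - g s) t (l - k).
Proof. by move=> fl /has_derivN; apply: has_derivD. Qed.

Lemma has_deriv_sum V A (I : finType) (f : I -> R -> V) t (l : I -> V) :
  (forall i, has_deriv A (f i) t (l i)) ->
  has_deriv A (fun s => \sum_i f i s) t (\sum_i l i).
Proof.
move=> fl; pose g (r : seq I) s := \sum_(i <- r) f i s.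
suff : forall r, has_deriv A (g r) t (\sum_(i <- r) l i) by exact.
elim=> [|i r IH].
  by rewrite big_nil /g; under eq_fun do rewrite big_nil; exact: has_deriv_cst.
rewrite big_cons /g; under eq_fun do rewrite big_cons; exact: has_derivD.
Qed.

Lemma has_deriv_pair V W A (f : R -> V) (g : R -> W) t l k :
  has_deriv A f t l -> has_deriv A g t k -> has_deriv A (fun s => (f s, g s)) t (l, k).
Proof.
move=> fl gk e e0; apply: filterS2 (fl e e0) (gk e e0) => s fs gs As.
by rewrite [leLHS]/Num.norm /= ge_max fs ?gs.
Qed.

Lemma bounded_linear_fst V W : bounded_linear (@fst V W : V * W -> V).
Proof.
split=> // ; exists 1 => // u; rewrite mul1r [leRHS]/Num.norm /= le_max lexx.
by [].
Qed.

Lemma bounded_linear_snd V W : bounded_linear (@snd V W : V * W -> W).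
Proof.
split=> // ; exists 1 => // u; rewrite mul1r [leRHS]/Num.norm /= le_max lexx.
by rewrite orbT.
Qed.

Lemma mx_norm_leP m n (A : 'M[R]_(m, n)) (C : R) : 0 <= C ->
  (forall i j, `|A i j| <= C) -> `|A| <= C.
Proof.
move=> C0 AC; rewrite [leLHS]/Num.norm /= mx_normrE.
by apply: bigmax_le => // -[i j] _.
Qed.

Lemma mx_entry_le m n (A : 'M[R]_(m, n)) i j : `|A i j| <= `|A|.
Proof.
rewrite [leRHS]/Num.norm /= mx_normrE.
exact: (@le_bigmax _ _ _ 0 (fun ij => `|A ij.1 ij.2|) (i, j)).
Qed.

Lemma has_deriv_mx m n A (f : R -> 'M[R]_(m, n)) t (l : 'M[R]_(m, n)) :
  (forall i j, has_deriv A (fun s => f s i j : R) t (l i j)) -> has_deriv A f t l.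
Proof.
move=> fl e e0.
have H : \forall s \near t, forall ij : 'I_m * 'I_n, A s ->
    `|f s ij.1 ij.2 - f t ij.1 ij.2 - (s - t) *: l ij.1 ij.2| <= e * `|s - t|.
  apply: (@filter_forall R ('I_m * 'I_n)%type
    (fun ij s => A s -> `|f s ij.1 ij.2 - f t ij.1 ij.2 - (s - t) *: l ij.1 ij.2|
     <= e * `|s - t|) (nbhs t)) => -[i j].
  exact: fl.
apply: filterS H => s H As; apply: mx_norm_leP => [|i j].
  by rewrite mulr_ge0 // ltW.
by rewrite !mxE; exact: (H (i, j)).
Qed.

Lemma bounded_linear_entry m n i j :
  bounded_linear (fun A : 'M[R]_(m, n) => A i j : R).
Proof.
split=> [u v|a u|]; rewrite ?mxE //.
by exists 1 => // u; rewrite mul1r mx_entry_le.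
Qed.

Lemma bounded_bilinear_scale V :
  bounded_bilinear (fun (a : R) (v : V) => a *: v).
Proof.
split=> [v a b|a v w|a b v|a b v|].
- exact: scalerBl.
- exact: scalerBr.
- by rewrite scalerA.
- by rewrite scalerA mulrC -scalerA.
- by exists 1 => // a v; rewrite normrZ mul1r.
Qed.

Lemma bounded_bilinear_mulmx m n p : bounded_bilinear
  (fun (A : 'M[R]_(m, n)) (B : 'M[R]_(n, p)) => A *m B).
Proof.
split=> [v a b|a v w|a b v|a b v|].
- exact: mulmxBl.
- exact: mulmxBr.
- by rewrite scalemxAl.
- by rewrite scalemxAr.
- exists n.+1%:R => [|A B]; first by rewrite ltr0Sn.
  apply: mx_norm_leP => [|i j]; first by rewrite !mulr_ge0.
  rewrite mxE (le_trans (ler_norm_sum _ _ _)) //.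
  apply: (@le_trans _ _ (\sum_(k < n) `|A| * `|B|)).
    by apply: ler_sum => k _; rewrite normrM ler_pM ?mx_entry_le.
  rewrite sumr_const card_ord -[leLHS]mulr_natl -[leRHS]mulrA.
  rewrite ler_wpM2r ?mulr_ge0 //.
  by rewrite ler_nat.
Qed.

(** The increment over a short interval straddling [t] is at most [C + e]
    times its length, by the expansion at [t]; interval induction adds these
    increments up. *)
Lemma mean_value_ineq V a b (f l : R -> V) (C : R) : a <= b ->
  (forall t, seg a b t -> has_deriv (seg a b) f t (l t)) ->
  (forall t, seg a b t -> `|l t| <= C) -> `|f b - f a| <= C * (b - a).
Proof.
move=> ab fl lC; apply/ler_addgt0Pr => e e0.
pose e1 := e / (b - a + 1).
have ba1 : 0 < b - a + 1 by rewrite ltr_wpDl // subr_ge0.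
have e10 : 0 < e1 by rewrite divr_gt0.
suff : `|f b - f a| <= (C + e1) * (b - a).
  move=> /le_trans; apply; rewrite mulrDl lerD2l /e1 mulrAC ler_pdivrMr //.
  by rewrite ler_pM2l // lerDl.
pose P t := `|f t - f a| <= (C + e1) * (t - a).
apply: (@interval_induction R a b P) => //; first by rewrite /P !subrr normr0 mulr0.
move=> t abt; have /nbhs_ballP[d /= d0 dP] := fl t abt _ e10.
have stepP s : seg a b s -> `|s - t| < d -> `|f s - f t| <= (C + e1) * `|s - t|.
  move=> abs std; have := dP s; rewrite /ball /= distrC => /(_ std abs) fs.
  rewrite -(subrK ((s - t) *: l t) (f s - f t)) (le_trans (ler_normD _ _)) //.
  rewrite addrC mulrDl lerD // normrZ mulrC ler_wpM2r //; exact: lC.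
exists d => // x y /andP[ax xt] /andP[ty yb] xd yd Px.
have /andP[at_ tb] := abt.
have Sx := stepP x; have Sy := stepP y.
have {}Sx : `|f x - f t| <= (C + e1) * (t - x).
  have -> : t - x = `|x - t| by rewrite distrC ger0_norm // subr_ge0.
  apply: Sx.
    by apply/andP; rewrite (le_trans xt).
  by rewrite distrC ger0_norm ?subr_ge0 // ltrBlDr -ltrBlDl.
have {}Sy : `|f y - f t| <= (C + e1) * (y - t).
  have -> : y - t = `|y - t| by rewrite ger0_norm // subr_ge0.
  apply: Sy.
    by apply/andP; rewrite yb (le_trans at_).
  by rewrite ger0_norm ?subr_ge0 // ltrBlDr addrC.
rewrite /P; have -> : f y - f a = (f y - f t) + ((f t - f x) + (f x - f a)).
  by rewrite !addrA !subrK.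
rewrite (le_trans (ler_normD _ _)) //.
have -> : (C + e1) * (y - a) =
  (C + e1) * (y - t) + ((C + e1) * (t - x) + (C + e1) * (x - a)) by ring.
apply: lerD => //; rewrite (le_trans (ler_normD _ _)) //.
by apply: lerD => //; rewrite distrC.
Qed.

Lemma cvg_bounded_bilinear U V W (B : U -> V -> W) (T : Type)
    (F : set_system T) {FF : Filter F} (f : T -> U) (g : T -> V) u v :
  bounded_bilinear B -> f x @[x --> F] --> u -> g x @[x --> F] --> v ->
  B (f x) (g x) @[x --> F] --> B u v.
Proof.
move=> [Bl Br Zl Zr [C C0 BC]] fu gv.
apply/cvgrPdist_lt => e e0.
pose K := C * (`|u| + 1 + `|v|); have K0 : 0 < K.
  by rewrite mulr_gt0 // ltr_wpDr // ltr_wpDl.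
pose d := Num.min 1 (e / 2 / K).
have d0 : 0 < d by rewrite lt_min ltr01 !divr_gt0.
have d1 : d <= 1 by rewrite ge_min lexx.
have /cvgrPdist_lt /(_ _ d0) fd := fu.
have /cvgrPdist_lt /(_ _ d0) gd := gv.
apply: filterS2 fd gd => x fx gx.
have -> : B u v - B (f x) (g x) = B (u - f x) v + B (f x) (v - g x).
  by rewrite Bl Br addrA subrK.
apply: (le_lt_trans (ler_normD _ _)); rewrite [e]splitr.
have fxu : `|f x| <= `|u| + 1.
  rewrite -[f x](subrK u) (le_trans (ler_normD _ _)) // addrC lerD2l.
  by rewrite distrC (le_trans (ltW fx)).
have dK : K * d <= e / 2 by rewrite mulrC -ler_pdivlMr // ge_min lexx orbT.
apply: (@le_lt_trans _ _ (C * d * `|v| + C * (`|u| + 1) * `|v - g x|)).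
  apply: lerD.
    by apply: (le_trans (BC _ _)); rewrite ler_wpM2r // ler_pM2l // ltW.
  by apply: (le_trans (BC _ _)); rewrite ler_wpM2r // ler_pM2l.
apply: (@lt_le_trans _ _ (C * d * `|v| + C * (`|u| + 1) * d)).
  by rewrite ltrD2l ltr_pM2l // mulr_gt0 // ltr_wpDl.
have -> : C * d * `|v| + C * (`|u| + 1) * d = K * d by rewrite /K; ring.
by rewrite (le_trans dK) // -splitr ler_pdivrMr // ler_pMr // ler1n.
Qed.

Lemma cvg_sumr V (T : Type) (F : set_system T) {FF : Filter F} (I : finType)
    (f : I -> T -> V) (l : I -> V) :
  (forall i, f i x @[x --> F] --> l i) ->
  (\sum_i f i x) @[x --> F] --> \sum_i l i.
Proof.
move=> fl; pose g (r : seq I) x := \sum_(i <- r) f i x.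
suff : forall r, g r x @[x --> F] --> \sum_(i <- r) l i by exact.
elim=> [|i r IH].
  have -> : g [::] = fun=> 0 by apply/funext => x; rewrite /g big_nil.
  by rewrite big_nil; exact: cvg_cst.
have -> : g (i :: r) = fun x => f i x + g r x.
  by apply/funext => x; rewrite /g big_cons.
by rewrite big_cons; exact: cvgD.
Qed.

Lemma cvg_bounded_linear V W (L : V -> W) (T : Type)
    (F : set_system T) {FF : Filter F} (f : T -> V) v :
  bounded_linear L -> f x @[x --> F] --> v -> L (f x) @[x --> F] --> L v.
Proof.
move=> [LB LZ [C C0 LC]] fv; apply/cvgrPdist_lt => e e0.
have eC : 0 < e / C by rewrite divr_gt0.
have /cvgrPdist_lt /(_ _ eC) := fv; apply: filterS => x fx.
by rewrite -LB (le_lt_trans (LC _)) // mulrC -ltr_pdivlMr.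
Qed.

End Segments.

(** * Primitives *)

Section Primitives.
Variable R : realType.
Implicit Types (V W : normedModType R) (a b t : R).

(** Extending [f] by constants beyond [a] and [b] makes every point of the
    segment interior, where the fundamental theorem of calculus applies. *)
Lemma real_primitive a b (f : R -> R) : a <= b ->
  (forall t, seg a b t -> cont_within (seg a b) f t) ->
  exists2 G : R -> R, G a = 0 & forall t, seg a b t -> has_deriv (seg a b) G t (f t).
Proof.
move=> ab cf; pose clamp t := Num.max a (Num.min b t).
have clampE t : seg a b t -> clamp t = t.
  by move=> /andP[at_ tb]; rewrite /clamp (min_r tb) (max_r at_).
have clamp_seg t : seg a b (clamp t).
  by rewrite /seg /clamp /= le_max lexx ge_max ab ge_min lexx.
have clamp_cont : continuous clamp.
  move=> t; apply: (@continuous_max R R (fun=> a) (Num.min b) t).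
    exact: cst_continuous.
  apply: (@continuous_min R R (fun=> b) id t); last by move=> P; apply.
  exact: cst_continuous.
pose g := f \o clamp.
have g_cont : continuous g.
  move=> t P Pgt.
  have H : \forall u \near clamp t, seg a b u -> P (f u) := cf _ (clamp_seg t) P Pgt.
  have {}H : \forall s \near t, seg a b (clamp s) -> P (f (clamp s)) :=
    clamp_cont t _ H.
  by apply: filterS H => s; apply.
pose F x := (\int[lebesgue_measure]_(t in `[a - 1, x]) g t)%R.
have intg : lebesgue_measure.-integrable `[a - 1, b + 1] (EFin \o g).
  apply: continuous_compact_integrable; first exact: segment_compact.
  by apply: continuous_subspaceT => x; exact: g_cont.
have FD t : seg a b t -> has_deriv (seg a b) F t (f t).
  move=> abt; have /andP[at_ tb] := abt.
  have tb1 : t < b + 1 by rewrite (le_lt_trans tb) // ltrDl.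
  have at1 : a - 1 < t by rewrite (lt_le_trans _ at_) // gtrBl.
  have [dF F'] := continuous_FTC1_closed tb1 intg at1 (g_cont t).
  have := has_deriv_comp abt _ (has_deriv_id (seg a b) t) => /(_ _ F).
  move/derivable1_diffP : (dF) => dF1 /(_ dF1).
  by rewrite -deriveE // -derive1E F' /g /= clampE.
exists (fun t => F t - F a) => [|t abt]; first by rewrite subrr.
rewrite -[f t]subr0; apply: has_derivB; [exact: FD|exact: has_deriv_cst].
Qed.

(** What Picard iteration needs of the space of values. *)
Definition picard_space V :=
  (forall (u : nat -> V) (C : R),
    (forall m, `|u m.+1 - u m| <= C / 2 ^+ m) -> cvg (u @ \oo)) /\
  (forall a b (f : R -> V), a <= b ->
    (forall t, seg a b t -> cont_within (seg a b) f t) ->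
    exists2 G : R -> V, G a = 0 &
      forall t, seg a b t -> has_deriv (seg a b) G t (f t)).

Lemma geometric_dist V (u : nat -> V) (C : R) :
  (forall m, `|u m.+1 - u m| <= C / 2 ^+ m) ->
  forall m k, `|u (m + k)%N - u m| <= 2 * C / 2 ^+ m - 2 * C / 2 ^+ (m + k).
Proof.
move=> uC m; elim=> [|k IH]; first by rewrite addn0 !subrr normr0.
rewrite addnS -(subrK (u (m + k)%N) (u (m + k).+1)) -addrA.
rewrite (le_trans (ler_normD _ _)) //.
apply: le_trans (lerD (uC _) IH) _; rewrite exprS le_eqVlt; apply/orP; left.
have H : 2 ^+ (m + k) != 0 :> R by rewrite expf_neq0 // pnatr_eq0.
have H' : 2 ^+ m != 0 :> R by rewrite expf_neq0 // pnatr_eq0.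
by apply/eqP; field; rewrite H H'.
Qed.

Lemma geometric_small (C e : R) : 0 < e ->
  exists m0, forall m, (m0 <= m)%N -> C / 2 ^+ m < e.
Proof.
move=> e0; have [C0|C0] := lerP C 0.
  exists 0%N => m _; apply: le_lt_trans e0; rewrite pmulr_lle0 // invr_gt0.
exists (Num.truncn (C / e)).+1 => m m0.
rewrite ltr_pdivrMr ?exprn_gt0 // mulrC -ltr_pdivrMr //.
have /andP[_ Hl] := Num.Theory.truncn_itv (ltW (divr_gt0 C0 e0)).
apply: (lt_le_trans Hl); rewrite -natrX ler_nat.
by apply: leq_trans m0 _; apply: ltnW; apply: ltn_expl.
Qed.

Lemma picard_space_mx m n : picard_space 'M[R]_(m, n).
Proof.
split=> [u C uC|a b f ab cf].
  apply: cauchy_cvg; apply: cauchy_exP => e e0.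
  have [m0 Hm0] := @geometric_small (2 * C) e e0; exists (u m0).
  have C0 : 0 <= C by have := le_trans (normr_ge0 _) (uC 0%N); rewrite divr1.
  exists m0 => // k /= m0k; rewrite -ball_normE /ball_ /= distrC.
  rewrite -(subnKC m0k); apply: le_lt_trans (geometric_dist uC _ _) _.
  apply: le_lt_trans (Hm0 m0 _) => //; rewrite gerBl divr_ge0 ?exprn_ge0 //.
  by rewrite mulr_ge0.
have cfij i j t : seg a b t -> cont_within (seg a b) (fun s => f s i j : R) t.
  move=> abt; exact: (cvg_bounded_linear (bounded_linear_entry R i j) (cf t abt)).
have H (ij : 'I_m * 'I_n) : exists G : R -> R, G a = 0 /\
    forall t, seg a b t -> has_deriv (seg a b) G t (f t ij.1 ij.2).
  by have [G] := real_primitive ab (cfij ij.1 ij.2); exists G.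
have [G HG] := choice H.
exists (fun t => \matrix_(i, j) G (i, j) t) => [|t abt].
  by apply/matrixP => i j; rewrite !mxE (HG (i, j)).1.
apply: has_deriv_mx => i j; have := (HG (i, j)).2 t abt.
by under [in X in _ -> X]eq_fun do rewrite mxE.
Qed.

Lemma picard_space_prod V W :
  picard_space V -> picard_space W -> picard_space (V * W)%type.
Proof.
move=> [cV pV] [cW pW]; split=> [u C uC|a b f ab cf].
  have /cV cu1 : forall m, `|(fst \o u) m.+1 - (fst \o u) m| <= C / 2 ^+ m.
    move=> m; apply: le_trans (uC m); rewrite [leRHS]/Num.norm /= le_max.
    by rewrite lexx.
  have /cW cu2 : forall m, `|(snd \o u) m.+1 - (snd \o u) m| <= C / 2 ^+ m.
    move=> m; apply: le_trans (uC m); rewrite [leRHS]/Num.norm /= le_max.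
    by rewrite lexx orbT.
  have -> : u = (fun m => ((fst \o u) m, (snd \o u) m)).
    by apply/funext => m /=; case: (u m).
  by apply/cvg_ex; exists (lim ((fst \o u) @ \oo), lim ((snd \o u) @ \oo));
    apply: cvg_pair.
have [t abt|G1 G1a G1D] := pV a b (fst \o f) ab.
  exact: cvg_bounded_linear (@bounded_linear_fst _ V W) (cf t abt).
have [t abt|G2 G2a G2D] := pW a b (snd \o f) ab.
  exact: cvg_bounded_linear (@bounded_linear_snd _ V W) (cf t abt).
exists (fun t => (G1 t, G2 t)) => [|t abt]; first by rewrite G1a G2a.
have := has_deriv_pair (G1D t abt) (G2D t abt); rewrite /=.
by case: (f t).
Qed.

End Primitives.

(** * Ordinary differential equations on short intervals *)

Section ODE.
Variable R : realType.
Implicit Types (V W : normedModType R) (a b t : R).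

Section Picard.
Variables (V : normedModType R) (HV : picard_space V).
Variables (F : R -> V -> V) (a b : R) (za z0 : V) (r B L : R).
Hypotheses (ab : a <= b) (r0 : 0 <= r) (L0 : 0 <= L).
Hypothesis F_bound : forall t z, seg a b t -> `|z - z0| <= r -> `|F t z| <= B.
Hypothesis F_lip : forall t z z', seg a b t -> `|z - z0| <= r ->
  `|z' - z0| <= r -> `|F t z - F t z'| <= L * `|z - z'|.

Let good (z : R -> V) := forall t, seg a b t ->
  cont_within (seg a b) z t /\ `|z t - z0| <= r.

Hypothesis F_cont : forall z : R -> V, good z ->
  forall t, seg a b t -> cont_within (seg a b) (fun s => F s (z s)) t.
Hypotheses (rB : `|za - z0| + B * (b - a) <= r) (Lh : L * (b - a) <= 2^-1).

Let step (z z' : R -> V) := [/\ good z', z' a = za &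
  forall t, seg a b t -> has_deriv (seg a b) z' t (F t (z t))].

Let B0 : 0 <= B.
Proof.
have H : `|F a z0| <= B.
  by apply: F_bound; [exact: seg_l|rewrite subrr normr0].
exact: le_trans (normr_ge0 _) H.
Qed.

Lemma picard_step z : good z -> exists z', step z z'.
Proof.
move=> gz; have [G Ga GD] := HV.2 a b _ ab (F_cont gz).
exists (fun t => za + G t).
have zD t : seg a b t -> has_deriv (seg a b) (fun s => za + G s) t (F t (z t)).
  move=> abt; rewrite -[F _ _]add0r; apply: has_derivD; first exact: has_deriv_cst.
  exact: GD.
split=> //; last by rewrite Ga addr0.
move=> t abt; split; first exact: has_deriv_cont_within (zD t abt).
have /andP[at_ tb] := abt.
rewrite addrAC (le_trans (ler_normD _ _)) // (le_trans _ rB) // lerD2l.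
rewrite -[G t]subr0 -Ga; apply: le_trans (_ : B * (t - a) <= _).
  apply: (@mean_value_ineq _ _ _ _ _ (fun t => F t (z t))) => // s ats.
    apply: (has_deriv_subset (sub_seg (lexx a) tb)); apply: GD.
    exact: sub_seg ats.
  have abs : seg a b s by exact: sub_seg ats.
  by apply: F_bound => //; case: (gz s abs).
by rewrite ler_wpM2l // lerD2r.
Qed.

(** One iteration halves distances, since [L * (b - a) <= 1/2]. *)
Lemma picard_contract z z' y y' (C : R) : good z -> good y ->
  step z z' -> step y y' ->
  (forall t, seg a b t -> `|z t - y t| <= C) ->
  forall t, seg a b t -> `|z' t - y' t| <= C / 2.
Proof.
move=> gz gy [gz' z'a z'D] [gy' y'a y'D] zyC t abt.
have /andP[at_ tb] := abt.
have C0 : 0 <= C by apply: le_trans (zyC t abt).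
have -> : z' t - y' t = (z' t - y' t) - (z' a - y' a).
  by rewrite z'a y'a subrr subr0.
apply: le_trans (_ : L * C * (t - a) <= _).
  apply: (@mean_value_ineq _ _ _ _ (fun t => z' t - y' t)
    (fun t => F t (z t) - F t (y t))) => // s ats;
    have abs : seg a b s by exact: sub_seg ats.
    by apply: (has_deriv_subset (sub_seg (lexx a) tb)); apply: has_derivB;
      [exact: z'D|exact: y'D].
  apply: le_trans (F_lip abs (gz s abs).2 (gy s abs).2) _.
  by rewrite ler_wpM2l // zyC.
rewrite mulrAC mulrC ler_wpM2l // (le_trans _ Lh) // ler_wpM2l //.
by rewrite lerD2r.
Qed.

(** The iterates of [picard_step] converge geometrically, uniformly on the
    segment; the limit is a fixed point of the iteration. *)
Lemma picard : exists2 z : R -> V, z a = za &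
  forall t, seg a b t -> `|z t - z0| <= r /\ has_deriv (seg a b) z t (F t (z t)).
Proof.
have /choice[T TP] : forall z, exists z', good z -> step z z'.
  move=> z; have [gz|gz] := pselect (good z); last by exists z.
  by have [z' zz'] := picard_step gz; exists z'.
pose zs m := iter m T (fun=> za).
have gzs m : good (zs m).
  elim: m => [|m IH]; last by have [] := TP _ IH.
  move=> t abt; split; first exact: cvg_cst.
  by rewrite (le_trans _ rB) // lerDl mulr_ge0 // subr_ge0.
have szs m : step (zs m) (zs m.+1) by exact: TP.
have dzs m t : seg a b t -> `|zs m.+1 t - zs m t| <= 2 * r / 2 ^+ m.
  elim: m t => [|m IH] t abt.
    rewrite divr1 -(subrK z0 (zs 1%N t)) -addrA (le_trans (ler_normD _ _)) //.
    rewrite mulr_natl mulr2n lerD //; first by have [] := gzs 1%N t abt.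
    by rewrite distrC; have [] := gzs 0%N t abt.
  have := picard_contract (gzs m.+1) (gzs m) (szs m.+1) (szs m) IH abt.
  by rewrite exprS invfM (mulrC 2^-1) mulrA.
pose z t := lim (zs ^~ t @ \oo).
have zs_cvg t : seg a b t -> zs ^~ t @ \oo --> z t.
  by move=> abt; apply: HV.1 => m; exact: dzs.
have zzs m t : seg a b t -> `|zs m t - z t| <= 4 * r / 2 ^+ m.
  move=> abt; rewrite distrC; apply/ler_addgt0Pr => e e0.
  have /cvgrPdist_lt /(_ _ e0) [N _ HN] := zs_cvg t abt.
  have := HN (m + N)%N (leq_addl _ _) => /= zN.
  rewrite -(subrK (zs (m + N)%N t) (z t)) -addrA (le_trans (ler_normD _ _)) //.
  rewrite [leLHS]addrC; apply: lerD; last exact: ltW.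
  have := @geometric_dist _ _ (zs ^~ t) (2 * r) (fun m => dzs m t abt) m N.
  rewrite (_ : 2 * (2 * r) = 4 * r); last by ring.
  move=> H; apply: le_trans H _; rewrite gerBl.
  by rewrite divr_ge0 ?exprn_ge0 // mulr_ge0.
have gz : good z.
  move=> t abt; split.
    apply/cont_withinP => e e0.
    have [m Hm] := @geometric_small _ (4 * r) (e / 3) (divr_gt0 e0 (ltr0Sn _ 2)).
    have /cont_withinP /(_ (e / 3) (divr_gt0 e0 (ltr0Sn _ 2))) := (gzs m t abt).1.
    apply: filterS => s + abs => /(_ abs) Hm'.
    have H u : seg a b u -> `|zs m u - z u| < e / 3.
      by move=> abu; apply: le_lt_trans (zzs m u abu) (Hm m (leqnn m)).
    have -> : z s - z t = (z s - zs m s) + ((zs m s - zs m t) + (zs m t - z t)).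
      by rewrite !addrA !subrK.
    apply: le_lt_trans (ler_normD _ _) _.
    have -> : e = e / 3 + (e / 3 + e / 3) by field.
    apply: ltrD; first by rewrite distrC H.
    by apply: le_lt_trans (ler_normD _ _) _; apply: ltrD; [exact: Hm'|exact: H].
  apply/ler_addgt0Pr => e e0; have [m Hm] := @geometric_small _ (4 * r) e e0.
  rewrite -(subrK (zs m t) (z t)) -addrA (le_trans (ler_normD _ _)) //.
  rewrite [leLHS]addrC; apply: lerD; first exact: (gzs m t abt).2.
  by rewrite distrC (le_trans (zzs m t abt)) // ltW // Hm.
have sz := TP _ gz.
have zE t : seg a b t -> z t = T z t.
  move=> abt; apply/eqP; rewrite -subr_eq0 -normr_le0; apply/ler_addgt0Pr => e e0.
  have [m Hm] := @geometric_small _ (8 * r) e e0; rewrite add0r.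
  rewrite -(subrK (zs m.+1 t) (z t)) -addrA (le_trans (ler_normD _ _)) //.
  have H1 := picard_contract (gzs m) gz (szs m) sz (zzs m) abt.
  have H2 := zzs m.+1 t abt; rewrite distrC in H2.
  apply: le_trans (lerD H2 H1) _; apply: ltW; apply: le_lt_trans (Hm m (leqnn m)).
  have p2 : 0 < 2 ^+ m :> R by rewrite exprn_gt0.
  rewrite exprS invfM -!mulrA -mulrDr.
  rewrite [leLHS](_ : _ = 4 * r / 2 ^+ m); last by field; rewrite gt_eqF.
  by rewrite -mulrA ler_wpM2r ?ler_nat // mulr_ge0 // invr_ge0 ltW.
have [_ Tza TzD] := sz.
exists z => [|t abt]; first by rewrite zE; [|exact: seg_l].
split; first by case: (gz t abt).
apply: has_deriv_near (TzD t abt) => //; near=> s => abs; exact/esym/zE.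
Unshelve. all: by end_near. Qed.

End Picard.

(** Over an interval of length at most [1/(2L)] the maximum [M] of [|z - y|]
    satisfies [M <= |z a - y a| + (M + kappa) / 2]. *)
Lemma short_gronwall V a b (z y l k : R -> V) (L kappa : R) :
  a <= b -> 0 <= L -> 0 <= kappa -> L * (b - a) <= 2^-1 ->
  (forall t, seg a b t -> has_deriv (seg a b) z t (l t)) ->
  (forall t, seg a b t -> has_deriv (seg a b) y t (k t)) ->
  (forall t, seg a b t -> `|l t - k t| <= L * (`|z t - y t| + kappa)) ->
  forall t, seg a b t -> `|z t - y t| <= 2 * `|z a - y a| + kappa.
Proof.
move=> ab L0 k0 Lh zD yD lk.
have segE t : (t \in `[a, b]) = (seg a b t) :> Prop by rewrite in_itv.
have [|c cab cM] := @EVT_max R (fun t => `|z t - y t|) a b ab.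
  apply/subspace_continuousP => t; rewrite /= segE => abt.
  have -> : [set` `[a, b]] = seg a b.
    by apply/seteqP; split=> s; rewrite /= segE.
  by apply: cvg_norm; apply: cvgB; apply: has_deriv_cont_within; [exact: zD|exact: yD].
rewrite segE in cab; pose M := `|z c - y c|; have /andP[ac cb] := cab.
have MP t : seg a b t -> `|z t - y t| <= M by rewrite -segE; exact: cM.
suff : M <= 2 * `|z a - y a| + kappa by move=> H t /MP /le_trans; apply.
have HM : `|(z c - y c) - (z a - y a)| <= L * (M + kappa) * (c - a).
  apply: (@mean_value_ineq _ _ _ _ (fun t => z t - y t) (fun t => l t - k t))
    => // s acs; have abs : seg a b s by exact: sub_seg acs.
    by apply: (has_deriv_subset (sub_seg (lexx a) cb)); apply: has_derivB;
      [exact: zD|exact: yD].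
  by apply: le_trans (lk s abs) _; rewrite ler_wpM2l // lerD2r MP.
have {}HM : `|(z c - y c) - (z a - y a)| <= (M + kappa) / 2.
  apply: le_trans HM _; rewrite mulrAC [leRHS]mulrC.
  rewrite ler_wpM2r ?addr_ge0 ?normr_ge0 //.
  by rewrite (le_trans _ Lh) // ler_wpM2l // lerD2r.
have : M <= `|z a - y a| + (M + kappa) / 2.
  rewrite /M -{1}(subrK (z a - y a) (z c - y c)).
  by rewrite (le_trans (ler_normD _ _)) // addrC lerD2l.
by lra.
Qed.

End ODE.

(** * Locally Lipschitz maps *)

Section LocallyLipschitz.
Variable R : realType.
Implicit Types (U V W : normedModType R).

Definition loc_lipschitz V W (Phi : V -> W) (v0 : V) :=
  exists2 r : R, 0 < r & exists2 L : R, 0 < L & forall v v',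
    `|v - v0| < r -> `|v' - v0| < r -> `|Phi v - Phi v'| <= L * `|v - v'|.

Lemma loc_lipschitz_lin V W (L : V -> W) v0 :
  bounded_linear L -> loc_lipschitz L v0.
Proof.
move=> [LB LZ [C C0 LC]]; exists 1 => //; exists C => // v v' _ _.
by rewrite -LB.
Qed.

Lemma loc_lipschitz_cst V W (w : W) (v0 : V) : loc_lipschitz (fun=> w) v0.
Proof. by exists 1 => //; exists 1 => // v v' _ _; rewrite subrr normr0 mulr_ge0. Qed.

Lemma loc_lipschitz_near V W (Phi Psi : V -> W) v0 :
  (\forall v \near v0, Phi v = Psi v) ->
  loc_lipschitz Phi v0 -> loc_lipschitz Psi v0.
Proof.
move=> /nbhs_ballP[d /= d0 dP] [r r0 [L L0 PL]].
exists (Num.min r d); first by rewrite lt_min r0.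
exists L => // v v'; rewrite !lt_min => /andP[vr vd] /andP[v'r v'd].
by rewrite -!dP ?PL //= -ball_normE /ball_ /= distrC.
Qed.

Lemma loc_lipschitzD V W (Phi Psi : V -> W) v0 :
  loc_lipschitz Phi v0 -> loc_lipschitz Psi v0 ->
  loc_lipschitz (fun v => Phi v + Psi v) v0.
Proof.
move=> [r r0 [L L0 PL]] [r' r'0 [L' L'0 PL']].
exists (Num.min r r'); first by rewrite lt_min r0.
exists (L + L'); first by rewrite addr_gt0.
move=> v v'; rewrite !lt_min => /andP[vr vd] /andP[v'r v'd].
rewrite opprD addrACA (le_trans (ler_normD _ _)) // mulrDl.
by apply: lerD; [exact: PL|exact: PL'].
Qed.

Lemma loc_lipschitz_sum V W (I : finType) (Phi : I -> V -> W) v0 :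
  (forall i, loc_lipschitz (Phi i) v0) ->
  loc_lipschitz (fun v => \sum_i Phi i v) v0.
Proof.
move=> PL; suff : forall r : seq I, loc_lipschitz (fun v => \sum_(i <- r) Phi i v) v0.
  exact.
elim=> [|i r IH].
  by under eq_fun do rewrite big_nil; exact: loc_lipschitz_cst.
by under eq_fun do rewrite big_cons; exact: loc_lipschitzD.
Qed.

Lemma loc_lipschitz_dist V W (Phi : V -> W) v0 : loc_lipschitz Phi v0 ->
  forall e : R, 0 < e -> exists2 d : R, 0 < d &
    forall v, `|v - v0| < d -> `|Phi v - Phi v0| < e.
Proof.
move=> [r r0 [L L0 PL]] e e0; exists (Num.min r (e / L)).
  by rewrite lt_min r0 divr_gt0.
move=> v; rewrite lt_min => /andP[vr ve].
rewrite (le_lt_trans (PL v v0 vr _)) ?subrr ?normr0 //.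
by rewrite mulrC -ltr_pdivlMr.
Qed.

Lemma loc_lipschitz_comp U V W (Phi : U -> V) (Psi : V -> W) u0 :
  loc_lipschitz Psi (Phi u0) -> loc_lipschitz Phi u0 ->
  loc_lipschitz (Psi \o Phi) u0.
Proof.
move=> [r r0 [L L0 PL]] PhiL; have [d d0 Hd] := loc_lipschitz_dist PhiL r0.
have [r' r'0 [L' L'0 PL']] := PhiL.
exists (Num.min r' d); first by rewrite lt_min r'0.
exists (L * L'); first by rewrite mulr_gt0.
move=> v v'; rewrite !lt_min => /andP[vr vd] /andP[v'r v'd].
rewrite (le_trans (PL _ _ (Hd _ vd) (Hd _ v'd))) // -mulrA ler_pM2l //.
exact: PL'.
Qed.

Lemma loc_lipschitz_pair U V W (Phi : U -> V) (Psi : U -> W) u0 :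
  loc_lipschitz Phi u0 -> loc_lipschitz Psi u0 ->
  loc_lipschitz (fun u => (Phi u, Psi u)) u0.
Proof.
move=> [r r0 [L L0 PL]] [r' r'0 [L' L'0 PL']].
exists (Num.min r r'); first by rewrite lt_min r0.
exists (L + L'); first by rewrite addr_gt0.
move=> v v'; rewrite !lt_min => /andP[vr vd] /andP[v'r v'd].
rewrite [leLHS]/Num.norm /= ge_max; apply/andP; split.
  by rewrite (le_trans (PL _ _ vr v'r)) // ler_wpM2r // lerDl ltW.
by rewrite (le_trans (PL' _ _ vd v'd)) // ler_wpM2r // lerDr ltW.
Qed.

Lemma loc_lipschitz_bilin U V V' W (B : V -> V' -> W) (Phi : U -> V)
    (Psi : U -> V') u0 : bounded_bilinear B ->
  loc_lipschitz Phi u0 -> loc_lipschitz Psi u0 ->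
  loc_lipschitz (fun u => B (Phi u) (Psi u)) u0.
Proof.
move=> [Bl Br Zl Zr [C C0 BC]] PhiL PsiL.
have [d d0 Hd] := loc_lipschitz_dist PhiL ltr01.
have [d' d'0 Hd'] := loc_lipschitz_dist PsiL ltr01.
have [r r0 [L L0 PL]] := PhiL; have [r' r'0 [L' L'0 PL']] := PsiL.
exists (Num.min (Num.min r d) (Num.min r' d')).
  by rewrite !lt_min r0 d0 r'0 d'0.
pose M := `|Phi u0| + 1; pose M' := `|Psi u0| + 1.
have M0 : 0 < M by rewrite ltr_wpDl.
have M'0 : 0 < M' by rewrite ltr_wpDl.
exists (C * L * M' + C * M * L'); first by rewrite addr_gt0 ?mulr_gt0.
move=> v v'; rewrite !lt_min => /andP[/andP[vr vd] /andP[vr' vd']].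
move=> /andP[/andP[wr wd] /andP[wr' wd']].
have -> : B (Phi v) (Psi v) - B (Phi v') (Psi v') =
    B (Phi v - Phi v') (Psi v) + B (Phi v') (Psi v - Psi v').
  by rewrite Bl Br addrA subrK.
have HM : `|Phi v'| <= M.
  rewrite -(subrK (Phi u0) (Phi v')) (le_trans (ler_normD _ _)) // addrC lerD2l.
  exact/ltW/Hd.
have HM' : `|Psi v| <= M'.
  rewrite -(subrK (Psi u0) (Psi v)) (le_trans (ler_normD _ _)) // addrC lerD2l.
  exact/ltW/Hd'.
rewrite (le_trans (ler_normD _ _)) // mulrDl; apply: lerD.
  rewrite (le_trans (BC _ _)) // -!mulrA ler_pM2l //.
  rewrite (mulrC M') mulrA; apply: ler_pM => //; exact: PL.
rewrite (le_trans (BC _ _)) // -!mulrA ler_pM2l //.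
by apply: ler_pM => //; exact: PL'.
Qed.

Lemma rV_sum_delta n (v : 'rV[R]_n) : v = \sum_i v 0 i *: delta_mx 0 i.
Proof. exact: row_sum_delta. Qed.

Lemma Ck_on_diff V W k (A : set V) (Phi : V -> W) x :
  Ck_on k.+1 A Phi -> A x -> differentiable Phi x.
Proof. by move=> [+ _]; exact. Qed.

Lemma Ck_on_derive V W k (A : set V) (Phi : V -> W) v :
  Ck_on k.+1 A Phi -> Ck_on k A (fun x => 'D_v Phi x).
Proof. by move=> [_]; exact. Qed.

Lemma Ck_on_cont V W k (A : set V) (Phi : V -> W) x :
  Ck_on k A Phi -> A x -> {for x, continuous Phi}.
Proof.
case: k => [|k] H Ax; first exact: H.
exact/differentiable_continuous/(Ck_on_diff H Ax).
Qed.

Lemma diff_sum_coord n W (Phi : 'rV[R]_n -> W) x v : differentiable Phi x ->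
  'd Phi x v = \sum_i v 0 i *: 'D_(delta_mx 0 i) Phi x.
Proof.
move=> dPhi; rewrite {1}[v]rV_sum_delta linear_sum; apply: eq_bigr => i _.
by rewrite linearZ /= -deriveE.
Qed.

(** The partial derivatives are bounded near [x0] by continuity; apply the mean
    value inequality along segments. *)
Lemma loc_lipschitz_C1 n W (A : set 'rV[R]_n) (Phi : 'rV[R]_n -> W) x0 :
  open A -> A x0 -> Ck_on 1 A Phi -> loc_lipschitz Phi x0.
Proof.
move=> oA Ax0 PC; pose D i x := 'D_(delta_mx 0 i) Phi x.
have Dbd i : \forall x \near x0, `|D i x| <= `|D i x0| + 1.
  have /cvgrPdist_lt /(_ 1 ltr01) := (Ck_on_derive (delta_mx 0 i) PC) _ Ax0.
  apply: filterS => x /= Hx; rewrite -[D i x](subrK (D i x0)).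
  rewrite (le_trans (ler_normD _ _)) // addrC lerD2l distrC; exact: ltW.
have : \forall x \near x0, A x /\ forall i : 'I_n, `|D i x| <= `|D i x0| + 1.
  apply: filterI; first exact: open_nbhs_nbhs.
  exact: (@filter_forall _ 'I_n (fun i x => `|D i x| <= `|D i x0| + 1) _ _ Dbd).
move=> /nbhs_ballP[r /= r0 rP]; exists r => //.
have bE x : `|x - x0| < r -> ball x0 r x by rewrite -ball_normE /ball_ /= distrC.
pose M := \sum_i (`|D i x0| + 1) + 1.
have M0 : 0 < M by rewrite ltr_wpDl // sumr_ge0 // => i _; rewrite addr_ge0.
exists M => // y x yr xr.
pose f (s : R) := Phi (x + s *: (y - x)).
have fball s : seg 0 1 s -> `|x + s *: (y - x) - x0| < r.
  move=> /andP[s0 s1].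
  have -> : x + s *: (y - x) - x0 = (1 - s) *: (x - x0) + s *: (y - x0).
    rewrite scalerBl scale1r -[RHS]addrA (addrC (- _)) -scalerBr opprB addrA.
    by rewrite subrK addrAC.
  have [->|s0'] := eqVneq s 0.
    by rewrite subr0 scale1r scale0r addr0.
  rewrite (le_lt_trans (ler_normD _ _)) // !normrZ.
  have s1' : 0 <= 1 - s by rewrite subr_ge0.
  rewrite (ger0_norm s0) (ger0_norm s1').
  have -> : r = (1 - s) * r + s * r by ring.
  apply: ler_ltD; first by rewrite ler_wpM2l // ltW.
  by rewrite ltr_pM2l // lt_neqAle eq_sym s0'.
have -> : Phi y - Phi x = f 1 - f 0.
  by rewrite /f scale1r scale0r addr0 (addrC x) subrK.
have -> : M * `|y - x| = M * `|y - x| * (1 - 0) by rewrite subr0 mulr1.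
apply: (@mean_value_ineq _ _ _ _ _
  (fun s => 'd Phi (x + s *: (y - x)) (y - x))) => // s s01.
  have dPhi : differentiable Phi (x + s *: (y - x)).
    by apply: (Ck_on_diff PC); have [] := rP _ (bE _ (fball _ s01)).
  apply: (@has_deriv_comp _ _ _ _ Phi (fun s : R => x + s *: (y - x))) => //.
  rewrite -[y - x in X in has_deriv _ _ _ X]add0r.
  rewrite -[y - x in X in has_deriv _ _ _ X]scale1r.
  apply: has_derivD; first exact: has_deriv_cst.
  exact: (has_deriv_lin (bounded_bilinearl (y - x) (bounded_bilinear_scale _))
    (has_deriv_id _ _)).
have [As Ds] := rP _ (bE _ (fball _ s01)).
rewrite diff_sum_coord; last exact: (Ck_on_diff PC).
rewrite (le_trans (ler_norm_sum _ _ _)) // mulrDl mul1r mulr_suml.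
apply: ler_wpDr => //; apply: ler_sum => i _; rewrite normrZ mulrC.
by apply: ler_pM => //; [exact: Ds|exact: mx_entry_le].
Qed.

End LocallyLipschitz.

(** * Local existence and stability of solutions *)

Section LocalODE.
Variables (R : realType) (P V : normedModType R) (F : P * V -> V).
Variables (p0 : P) (z0 : V).
Hypothesis FL : loc_lipschitz F (p0, z0).

Lemma pair_dist_lt (p p' : P) (z z' : V) (r : R) :
  `|(p, z) - (p', z')| < r = (`|p - p'| < r) && (`|z - z'| < r).
Proof. by rewrite [X in X < _]/Num.norm /= gt_max. Qed.

Lemma pair_dist_le (p p' : P) (z z' : V) (r : R) :
  `|(p, z) - (p', z')| <= r = (`|p - p'| <= r) && (`|z - z'| <= r).
Proof. by rewrite [X in X <= _]/Num.norm /= ge_max. Qed.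

(** The admissible length [d] is the same for all coefficients [p] and initial
    values [za] near the given ones; this is what makes interval induction
    applicable. *)
Lemma ode_exists (e : R) : picard_space V -> 0 < e ->
  exists2 d : R, 0 < d & forall (a b : R) (p : R -> P) (za : V),
    a <= b -> b - a < d ->
    (forall t, seg a b t -> cont_within (seg a b) p t /\ `|p t - p0| < d) ->
    `|za - z0| < d ->
    exists2 z : R -> V, z a = za & forall t, seg a b t ->
      `|z t - z0| <= e /\ has_deriv (seg a b) z t (F (p t, z t)).
Proof.
move=> HV e0; have [r r0 [L L0 HL]] := FL.
pose r1 := Num.min e (r / 2); have r10 : 0 < r1 by rewrite lt_min e0 divr_gt0.
have r1r : r1 < r by rewrite gt_min ltr_pdivrMr // ltr_pMr // ltr1n // orbT.
have r1e : r1 <= e by rewrite ge_min lexx.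
pose B := `|F (p0, z0)| + L * r; have B0 : 0 < B by rewrite ltr_wpDl // mulr_gt0.
(* [B] bounds [F] on the ball of radius [r]; on an interval of length [d] the
   solution stays within [r1] of [z0], and Picard iteration contracts. *)
pose d := Num.min (Num.min r (r1 / 2)) (Num.min (r1 / 2 / B) (2^-1 / L)).
exists d => [|a b p za]; first by rewrite !lt_min r0 !divr_gt0 // invr_gt0.
rewrite /d !lt_min => ab /andP[_ /andP[hB hL]] Hp /andP[/andP[_ zar] _].
have pr t : seg a b t -> `|p t - p0| < r.
  by move=> /Hp[_]; rewrite !lt_min => /andP[/andP[]].
have inr t z : seg a b t -> `|z - z0| <= r1 -> `|(p t, z) - (p0, z0)| < r.
  by move=> abt zr; rewrite pair_dist_lt pr // (le_lt_trans zr).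
have := @picard R V HV (fun t z => F (p t, z)) a b za z0 r1 B L ab (ltW r10)
  (ltW L0); case.
- move=> t z abt zr; rewrite -(subrK (F (p0, z0)) (F _)).
  rewrite (le_trans (ler_normD _ _)) // addrC lerD2l.
  have := HL (p t, z) (p0, z0) (inr _ _ abt zr); rewrite subrr normr0.
  move=> /(_ r0) H; apply: le_trans H _; rewrite ler_pM2l //.
  by apply: ltW; exact: inr.
- move=> t z z' abt zr z'r; have := HL _ _ (inr _ _ abt zr) (inr _ _ abt z'r).
  move=> H; apply: le_trans H _; rewrite ler_pM2l // pair_dist_le subrr normr0.
  by rewrite normr_ge0 lexx.
- move=> z gz t abt; apply/cont_withinP => e' e'0.
  have eL : 0 < e' / L by rewrite divr_gt0.
  have /cont_withinP /(_ _ eL) H1 := (gz t abt).1.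
  have /cont_withinP /(_ _ eL) H2 := (Hp t abt).1.
  apply: filterS2 H1 H2 => s H1 H2 abs.
  have Hs := inr _ _ abs (gz s abs).2; have Ht := inr _ _ abt (gz t abt).2.
  apply: le_lt_trans (HL _ _ Hs Ht) _; rewrite mulrC -ltr_pdivlMr //.
  by rewrite pair_dist_lt H1 // H2.
- rewrite [leRHS]splitr; apply: lerD; first exact: ltW.
  by rewrite mulrC -ler_pdivlMr // ltW.
- by rewrite mulrC -ler_pdivlMr // ltW.
move=> z za0 zP; exists z => // t abt; have [zr zD] := zP t abt.
by split=> //; exact: le_trans r1e.
Qed.

(** All the solutions concerned stay where [F] has one Lipschitz constant, so
    that [short_gronwall] applies. *)
Lemma ode_close : exists2 d : R, 0 < d &
  forall (a b : R) (p q : R -> P) (z y : R -> V) (kappa : R),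
    a <= b -> b - a < d -> 0 <= kappa ->
    (forall t, seg a b t -> [/\ `|p t - p0| < d, `|q t - p0| < d &
      `|p t - q t| <= kappa]) ->
    (forall t, seg a b t -> `|z t - z0| < d /\
      has_deriv (seg a b) z t (F (p t, z t))) ->
    (forall t, seg a b t -> `|y t - z0| < d /\
      has_deriv (seg a b) y t (F (q t, y t))) ->
    forall t, seg a b t -> `|z t - y t| <= 2 * `|z a - y a| + kappa.
Proof.
have [r r0 [L L0 HL]] := FL.
exists (Num.min r (2^-1 / L)); first by rewrite lt_min r0 divr_gt0 // invr_gt0.
move=> a b p q z y kappa ab; rewrite lt_min => /andP[_ hL] k0 Hpq Hz Hy.
apply: (@short_gronwall R V a b z y (fun t => F (p t, z t))
  (fun t => F (q t, y t)) L) => //.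
- exact: ltW.
- by rewrite mulrC -ler_pdivlMr // ltW.
- by move=> t /Hz[].
- by move=> t /Hy[].
move=> t abt; have [] := Hpq t abt; rewrite !lt_min => /andP[pr _] /andP[qr _] pq.
have [+ _] := Hz t abt; rewrite lt_min => /andP[zr _].
have [+ _] := Hy t abt; rewrite lt_min => /andP[yr _].
have Hp : `|(p t, z t) - (p0, z0)| < r by rewrite pair_dist_lt pr.
have Hq : `|(q t, y t) - (p0, z0)| < r by rewrite pair_dist_lt qr.
apply: le_trans (HL _ _ Hp Hq) _; rewrite ler_pM2l // pair_dist_le.
by rewrite lerDl k0 andbT (le_trans pq) // lerDr.
Qed.

End LocalODE.

(** * Families of curves of class C^j *)

Section Families.
Variables (R : realType) (T : Type) (F : set_system T) (o : T).
Context {FF : Filter F}.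
Hypothesis Fo : forall P : set T, F P -> P o.
Implicit Types (U V W : normedModType R) (t : R).
Local Notation I := (@unitI R).

(** The families below tend along [F] to their member at [o].  Convergence along
    this filter is continuous convergence: locally uniform convergence to a
    continuous limit. *)
Definition joint t : set_system (T * R) := filter_prod F (within I (nbhs t)).

Global Instance joint_filter t : Filter (joint t).
Proof. exact: filter_prod_filter. Qed.

Lemma joint_point t (P : set (T * R)) : I t -> joint t P -> P (o, t).
Proof.
move=> It [[A B] /= [FA nB] AB]; apply: AB; split=> /=; first exact: Fo.
have : \forall s \near t, I s -> B s := nB.
by move=> /nbhs_singleton; exact.
Qed.

Lemma joint_snd t (P : set R) : (\forall s \near t, I s -> P s) ->
  \forall z \near joint t, P z.2.
Proof.
move=> HP; exists (setT, P); last by case=> x s [].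
by split; [exact: filterT|exact: HP].
Qed.

Lemma joint_fst t (P : set T) : F P -> \forall z \near joint t, P z.1.
Proof.
move=> FP; exists (P, setT); last by case=> x s [].
by split=> //; exact: filterT.
Qed.

Lemma joint_I t : \forall z \near joint t, I z.2.
Proof. by apply: joint_snd; near=> s. Unshelve. all: by end_near. Qed.

(** Being differentiable at nearby times concerns the germ of each member, hence
    the need for neighborhoods of the nearby points as well. *)
Lemma joint_near t (P : set (T * R)) : joint t P ->
  \forall z \near joint t, \forall s \near z.2, I s -> P (z.1, s).
Proof.
move=> [[A B] /= [FA nB] AB].
have : nbhs t (fun s => I s -> B s) := nB.
rewrite nbhsE; case=> O [oO Ot] OB.
exists (A, O) => /=.
  split=> //; apply: filterS (open_nbhs_nbhs (conj oO Ot)) => s Os _ //.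
move=> [x s] [/= Ax Os]; have : nbhs s O by exact: open_nbhs_nbhs.
by apply: filterS => s' Os' Is'; apply: AB; split=> //=; exact: OB.
Qed.

Definition jointC0 V (f : T -> R -> V) t := f z.1 z.2 @[z --> joint t] --> f o t.

(** The derivatives in time up to order [j] of the members of [f] exist near [t]
    and converge jointly.  This is regularity of class [C^j] for a family with
    one member, and convergence in [C^j] for a sequence with its limit, so that
    one calculus serves for both. *)
Fixpoint jointC j V (f : T -> R -> V) t : Prop :=
  match j with
  | 0 => jointC0 f t
  | j'.+1 => [/\ jointC0 f t, \forall z \near joint t, derivableI (f z.1) z.2 &
      jointC j' (fun x => derivI (f x)) t]
  end.

Lemma jointC_jointC0 j V (f : T -> R -> V) t : jointC j f t -> jointC0 f t.
Proof. by case: j => [|j] // []. Qed.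

Lemma jointC_S j V (f : T -> R -> V) t : jointC j.+1 f t -> jointC j f t.
Proof.
elim: j f => [|j IH] f [f0 fd f']; first exact: f0.
by split=> //; exact: IH.
Qed.

Lemma jointC_le j k V (f : T -> R -> V) t : (j <= k)%N -> jointC k f t -> jointC j f t.
Proof.
by move=> /subnKC <-; elim: (k - j)%N => [|m IH]; rewrite ?addn0 ?addnS // => /jointC_S.
Qed.

Lemma jointC0_near V (f g : T -> R -> V) t : I t ->
  (\forall z \near joint t, f z.1 z.2 = g z.1 z.2) -> jointC0 f t -> jointC0 g t.
Proof.
move=> It fg; rewrite /jointC0 -(joint_point It fg) /=; apply: cvg_trans.
by apply: near_eq_cvg; apply: filterS fg => z ->.
Qed.

Lemma jointC_near j V (f g : T -> R -> V) t : I t ->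
  (\forall z \near joint t, f z.1 z.2 = g z.1 z.2) -> jointC j f t -> jointC j g t.
Proof.
move=> It; elim: j f g => [|j IH] f g fg; first exact: jointC0_near.
move=> [f0 fd f']; split; first exact: jointC0_near f0.
  apply: filterS3 (joint_near fg) fd (joint_I t) => -[x s] /= fgs.
  move=> /derivableI_has_deriv fD Is.
  by have [] := has_deriv_derivI Is (has_deriv_near Is fgs fD).
apply: IH f'; apply: filterS3 (joint_near fg) fd (joint_I t) => -[x s] /= fgs.
move=> /derivableI_has_deriv fD Is.
by have [_ ->] := has_deriv_derivI Is (has_deriv_near Is fgs fD).
Qed.

Lemma jointC_has_deriv j V (f : T -> R -> V) t : jointC j.+1 f t ->
  \forall z \near joint t, has_deriv I (f z.1) z.2 (derivI (f z.1) z.2).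
Proof. by move=> [_ + _]; apply: filterS => z /derivableI_has_deriv. Qed.

Lemma jointC_intro j V (f g : T -> R -> V) t : I t -> jointC0 f t ->
  (\forall z \near joint t, has_deriv I (f z.1) z.2 (g z.1 z.2)) ->
  jointC j g t -> jointC j.+1 f t.
Proof.
move=> It f0 fg gC; split=> //.
  by apply: filterS2 fg (joint_I t) => z fD Iz; have [] := has_deriv_derivI Iz fD.
apply: jointC_near gC => //; apply: filterS2 fg (joint_I t) => z fD Iz.
by have [_ ->] := has_deriv_derivI Iz fD.
Qed.

Lemma jointC_cst j V (v : V) t : I t -> jointC j (fun _ _ => v) t.
Proof.
move=> It; have C0 (w : V) : jointC0 (fun _ _ => w) t by exact: cvg_cst.
elim: j v => [|j IH] v; first exact: C0.
apply: jointC_intro (C0 v) _ (IH 0) => //; near=> z; exact: has_deriv_cst.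
Unshelve. all: by end_near. Qed.

Lemma jointC_lin j V W (L : V -> W) (f : T -> R -> V) t : I t ->
  bounded_linear L -> jointC j f t -> jointC j (fun x s => L (f x s)) t.
Proof.
move=> It bL; elim: j f => [|j IH] f; first exact: cvg_bounded_linear.
move=> fC; apply: (@jointC_intro _ _ _ (fun x s => L (derivI (f x) s))) => //.
- exact: cvg_bounded_linear bL (jointC_jointC0 fC).
- by apply: filterS (jointC_has_deriv fC) => z; exact: has_deriv_lin.
- by apply: IH; case: fC.
Qed.

Lemma jointCD j V (f g : T -> R -> V) t : I t ->
  jointC j f t -> jointC j g t -> jointC j (fun x s => f x s + g x s) t.
Proof.
move=> It; elim: j f g => [|j IH] f g; first exact: cvgD.
move=> fC gC.
apply: (@jointC_intro _ _ _ (fun x s => derivI (f x) s + derivI (g x) s)) => //.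
- exact: cvgD (jointC_jointC0 fC) (jointC_jointC0 gC).
- by apply: filterS2 (jointC_has_deriv fC) (jointC_has_deriv gC) => z; exact: has_derivD.
- by apply: IH; [case: fC|case: gC].
Qed.

Lemma jointC_sum j V (J : finType) (f : J -> T -> R -> V) t : I t ->
  (forall i, jointC j (f i) t) -> jointC j (fun x s => \sum_i f i x s) t.
Proof.
move=> It fC; suff : forall r : seq J, jointC j (fun x s => \sum_(i <- r) f i x s) t.
  exact.
elim=> [|i r IH].
  under eq_fun do under eq_fun do rewrite big_nil; exact: jointC_cst.
by under eq_fun do under eq_fun do rewrite big_cons; exact: jointCD.
Qed.

Lemma jointC_bilin j U V W (B : U -> V -> W) (f : T -> R -> U) (g : T -> R -> V) t :
  I t -> bounded_bilinear B ->
  jointC j f t -> jointC j g t -> jointC j (fun x s => B (f x s) (g x s)) t.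
Proof.
move=> It bB; elim: j f g => [|j IH] f g; first exact: cvg_bounded_bilinear.
move=> fC gC; have fC' := jointC_S fC; have gC' := jointC_S gC.
apply: (@jointC_intro _ _ _ (fun x s =>
  B (derivI (f x) s) (g x s) + B (f x s) (derivI (g x) s))) => //.
- exact: cvg_bounded_bilinear bB (jointC_jointC0 fC) (jointC_jointC0 gC).
- apply: filterS2 (jointC_has_deriv fC) (jointC_has_deriv gC) => z.
  exact: has_deriv_bilin.
- by apply: jointCD => //; apply: IH => //; [case: fC|case: gC].
Qed.

(** The derivative of the composite is a combination of partial derivatives of
    [Phi] composed with [f], to which the induction hypothesis applies. *)
Lemma jointC_comp j n W (A : set 'rV[R]_n) (Phi : 'rV[R]_n -> W)
    (f : T -> R -> 'rV[R]_n) t : I t -> open A -> A (f o t) ->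
  Ck_on j A Phi -> jointC j f t -> jointC j (fun x s => Phi (f x s)) t.
Proof.
move=> It oA Aft; elim: j Phi => [|j IH] Phi PC fC.
  exact: (cvg_comp _ _ fC (PC _ Aft)).
have nA : \forall z \near joint t, A (f z.1 z.2).
  by apply: (jointC_jointC0 fC); exact: open_nbhs_nbhs.
have fC' := jointC_S fC.
apply: (@jointC_intro _ _ _ (fun x s => \sum_i
   (derivI (f x) s 0 i : R) *: 'D_(delta_mx 0 i) Phi (f x s))) => //.
- exact: (cvg_comp _ _ (jointC_jointC0 fC) (Ck_on_cont PC Aft)).
- apply: filterS3 nA (jointC_has_deriv fC) (joint_I t) => -[x s] /= Az fD Is.
  have dPhi := Ck_on_diff PC Az.
  by rewrite -diff_sum_coord //; exact: has_deriv_comp.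
apply: jointC_sum => // i; apply: jointC_bilin => //.
- exact: bounded_bilinear_scale.
- apply: (jointC_lin It (bounded_linear_entry R 0 i)); by case: fC.
- by apply: (IH ('D_(delta_mx 0 i) Phi)) => //; exact: Ck_on_derive.
Qed.

(** [A^-1 - A0^-1 = A^-1 (A0 - A) A0^-1], which bounds [A^-1] near [A0] and
    then makes it tend to [A0^-1]. *)
Lemma cvg_invmx n (X : Type) (G : set_system X) {FG : Filter G}
    (f : X -> 'M[R]_n) (A : 'M[R]_n) : A \in unitmx ->
  (\forall x \near G, f x \in unitmx) -> f x @[x --> G] --> A ->
  invmx (f x) @[x --> G] --> invmx A.
Proof.
move=> uA uf fA; have [_ _ _ _ [C C0 CB]] := bounded_bilinear_mulmx R n n n.
pose K := C * C * (`|invmx A| + 1); pose N := `|invmx A| + 1.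
have N0 : 0 < N by rewrite ltr_wpDl.
have K0 : 0 < K by rewrite !mulr_gt0.
have H0 x : f x \in unitmx ->
    `|invmx A - invmx (f x)| <= K * `|A - f x| * `|invmx (f x)|.
  move=> ux; have -> : invmx A - invmx (f x) = invmx (f x) *m ((f x - A) *m invmx A).
    by rewrite mulmxBl mulmxV // mulmxBr mulmx1 mulKmx.
  apply: le_trans (CB _ _) _.
  rewrite (_ : K * _ * _ = C * `|invmx (f x)| * (C * `|A - f x| * N)); last first.
    by rewrite /K /N; ring.
  apply: ler_wpM2l; first by rewrite mulr_ge0 // ltW.
  apply: le_trans (CB _ _) _; rewrite (distrC A); apply: ler_wpM2l.
    by rewrite mulr_ge0 // ltW.
  by rewrite lerDl.
apply/cvgrPdist_lt => e e0.
pose d := Num.min (2^-1 / K) (e / 2 / (K * N)).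
have d0 : 0 < d by rewrite lt_min !divr_gt0 ?invr_gt0 ?mulr_gt0.
have /cvgrPdist_lt /(_ _ d0) fd := fA.
apply: filterS2 fd uf => x; rewrite lt_min => /andP[d1 d2] /H0 Hx.
have Hh : `|invmx (f x)| <= 2 * N.
  have H1 : `|invmx (f x)| <= `|invmx A| + `|invmx A - invmx (f x)|.
    rewrite -{1}(subKr (invmx A) (invmx (f x))).
    by apply: le_trans (ler_normB _ _) _.
  have H2 : K * `|A - f x| * `|invmx (f x)| <= 2^-1 * `|invmx (f x)|.
    by rewrite ler_wpM2r // mulrC -ler_pdivlMr // ltW.
  have := le_trans H1 (lerD (lexx _) (le_trans Hx H2)); rewrite /N.
  have := normr_ge0 (invmx (f x)); move: (`|invmx (f x)|) (`|invmx A|).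
  by move=> p q p0 H; lra.
apply: (le_lt_trans Hx); apply: le_lt_trans (ler_wpM2l _ Hh) _.
  by rewrite mulr_ge0 // ltW.
rewrite (_ : K * `|A - f x| * (2 * N) = 2 * (`|A - f x| * (K * N))); last by ring.
rewrite ltr_pdivlMr ?mulr_gt0 // in d2.
by rewrite mulrC -ltr_pdivlMr.
Qed.

Lemma has_deriv_invmx n A (f : R -> 'M[R]_n) t l : A t ->
  (\forall s \near t, A s -> f s \in unitmx) -> has_deriv A f t l ->
  has_deriv A (fun s => invmx (f s)) t (- (invmx (f t) *m l *m invmx (f t))).
Proof.
move=> At uf fD; have ut := nbhs_singleton uf At.
pose g s := invmx (f s).
have gc : cont_within A g t by apply: cvg_invmx => //; exact: has_deriv_cont_within fD.
move=> e e0; have [_ _ _ _ [C C0 CB]] := bounded_bilinear_mulmx R n n n.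
have fL := has_deriv_lip fD.
pose N := `|g t| + 1; have N0 : 0 < N by rewrite ltr_wpDl.
pose K := `|l| + 1; have K0 : 0 < K by rewrite ltr_wpDl.
have H1 := has_deriv_lin (bounded_bilinearr (g t) (bounded_bilinear_mulmx R n n n)) fD.
have {}H1 := has_deriv_lin (bounded_bilinearl (g t) (bounded_bilinear_mulmx R n n n)) H1.
have e2 : 0 < e / 2 by rewrite divr_gt0.
have {}H1 := H1 _ e2.
have /cont_withinP H2 := gc.
have e3 : 0 < e / 2 / (C * C * N * K) by rewrite !divr_gt0 ?mulr_gt0.
have {}H2 := H2 _ e3.
near=> s => As.
have us : f s \in unitmx by move: As; near: s; exact: uf.
have -> : invmx (f s) - invmx (f t) - (s - t) *: - (invmx (f t) *m l *m invmx (f t)) =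
   - (g t *m f s *m g t - g t *m f t *m g t - (s - t) *: (g t *m l *m g t))
   - (g s - g t) *m (f s - f t) *m g t.
  have Hg : invmx (f s) - invmx (f t) = - (g s *m (f s - f t) *m g t).
    rewrite /g mulmxBr mulVmx // mulmxBl mul1mx -mulmxA mulmxV // mulmx1.
    by rewrite opprB.
  rewrite -mulmxBl -mulmxBr (mulmxBl (g s)) (mulmxBl _ _ (g t)) Hg.
  rewrite scalerN opprK -/(g t).
  move: (g s *m _ *m _) (g t *m (_ - _) *m _) (_ *: _) => x y c.
  by rewrite !opprB addrA subrK addrC.
apply: le_trans (ler_normB _ _) _; rewrite normrN [e in leRHS]splitr mulrDl.
apply: lerD; first by move: As; near: s; exact: H1.
have G2 : `|g s - g t| <= e / 2 / (C * C * N * K).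
  by apply: ltW; move: As; near: s; exact: H2.
have G1 : `|f s - f t| <= K * `|s - t| by move: As; near: s; exact: fL.
apply: le_trans (CB _ _) _.
apply: le_trans (_ : C * (C * (e / 2 / (C * C * N * K)) * (K * `|s - t|)) * N <= _).
  apply: ler_pM; rewrite ?mulr_ge0 ?(ltW C0) //; last by rewrite /N lerDl.
  rewrite ler_pM2l //; apply: le_trans (CB _ _) _.
  apply: ler_pM; rewrite ?mulr_ge0 ?(ltW C0) //.
  by rewrite ler_pM2l.
rewrite le_eqVlt; apply/orP; left; apply/eqP; field.
by rewrite !gt_eqF.
Unshelve. all: by end_near. Qed.

Lemma jointC_invmx j n (f : T -> R -> 'M[R]_n) t : I t ->
  (\forall z \near joint t, f z.1 z.2 \in unitmx) ->
  jointC j f t -> jointC j (fun x s => invmx (f x s)) t.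
Proof.
move=> It uf; elim: j => [|j IH] fC.
  by apply: cvg_invmx => //; exact: (joint_point It uf).
have fC' := jointC_S fC.
apply: (@jointC_intro _ _ _ (fun x s =>
   - (invmx (f x s) *m derivI (f x) s *m invmx (f x s)))) => //.
- by apply: cvg_invmx => //; [exact: (joint_point It uf)|exact: jointC_jointC0 fC].
- apply: filterS3 (joint_near uf) (jointC_has_deriv fC) (joint_I t) => -[x s] /= us fD Is.
  exact: has_deriv_invmx.
have -> : (fun x s => - (invmx (f x s) *m derivI (f x) s *m invmx (f x s))) =
    (fun x s => -1 *: (invmx (f x s) *m derivI (f x) s *m invmx (f x s))).
  by apply/funext => x; apply/funext => s; rewrite scaleN1r.
apply: (@jointC_lin j _ _ (fun v => -1 *: v)) => //.
  exact: bounded_bilinearr (bounded_bilinear_scale _).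
apply: jointC_bilin => //; [exact: bounded_bilinear_mulmx| |exact: IH].
apply: jointC_bilin => //; [exact: bounded_bilinear_mulmx|exact: IH|by case: fC].
Qed.

Lemma jointC_derivnI k V (f : T -> R -> V) t : jointC k f t ->
  (forall j, (j <= k)%N ->
    derivnI j (f z.1) z.2 @[z --> joint t] --> derivnI j (f o) t) /\
  (forall j, (j < k)%N ->
    \forall z \near joint t, derivableI (derivnI j (f z.1)) z.2).
Proof.
elim: k f => [|k IH] f fC; first by split=> // j; rewrite leqn0 => /eqP ->.
have [f0 fd f'] := fC; have [IH1 IH2] := IH _ f'.
split; case=> [|j] jk //.
  have := IH1 j jk; rewrite /derivnI iterSr; apply: cvg_trans.
  by apply: near_eq_cvg; near=> z; rewrite iterSr.
by apply: filterS (IH2 j jk) => z; rewrite /derivnI iterSr.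
Unshelve. all: by end_near. Qed.

(** The form in which regularity enters the definition of a [C^k] curve. *)
Lemma jointC_of_derivnI k V (f : T -> R -> V) t :
  (forall j, (j <= k)%N ->
    derivnI j (f z.1) z.2 @[z --> joint t] --> derivnI j (f o) t) ->
  (forall j, (j < k)%N ->
    \forall z \near joint t, derivableI (derivnI j (f z.1)) z.2) ->
  jointC k f t.
Proof.
elim: k f => [|k IH] f fc fd; first exact: (fc 0%N).
split; [exact: (fc 0%N)|exact: (fd 0%N)|apply: IH => j jk].
  have := fc j.+1 jk; rewrite /derivnI iterSr; apply: cvg_trans.
  by apply: near_eq_cvg; near=> z; rewrite iterSr.
by apply: filterS (fd j.+1 jk) => z; rewrite /derivnI iterSr.
Unshelve. all: by end_near. Qed.

End Families.

(** * Charts and their Jacobians *)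

Section Charts.
Variables (R : realType) (n : nat) (M : manifold R n).
Implicit Types (c : chart R n M) (p : M) (x v w : 'rV[R]_n).

Lemma cvg_within_open (T U : topologicalType) (A : set T) (f : T -> U) (x : T) :
  open A -> A x -> {within A, continuous f} -> f y @[y --> x] --> f x.
Proof.
move=> oA Ax /subspace_continuousP /(_ x Ax) fc P Pf.
have H : \forall y \near x, A y -> P (f y) := fc P Pf.
have Ay : \forall y \near x, A y by exact: open_nbhs_nbhs.
by apply: filterS2 Ay H => y + H; exact: H.
Qed.

Lemma chart_cvg c p : chart_dom c p -> c q @[q --> p] --> c p.
Proof.
move=> cp; apply: (cvg_within_open _ cp); first exact: chart_dom_open.
exact: chart_fun_continuous.
Qed.

Lemma chart_inv_cvg c x : chart_img c x ->
  chart_inv c y @[y --> x] --> chart_inv c x.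
Proof.
move=> cx; apply: (cvg_within_open _ cx); first exact: chart_img_open.
exact: chart_inv_continuous.
Qed.

Lemma chart_img_fun c p : chart_dom c p -> chart_img c (c p).
Proof. by move=> cp; exists p. Qed.

Lemma chart_dom_inv c x : chart_img c x -> chart_dom c (chart_inv c x).
Proof. by move=> [p cp <-]; rewrite chart_funK. Qed.

Lemma chart_invK c x : chart_img c x -> c (chart_inv c x) = x.
Proof. by move=> [p cp <-]; rewrite chart_funK. Qed.

Lemma overlapP c c' x :
  overlap c c' x <-> chart_img c x /\ chart_dom c' (chart_inv c x).
Proof.
split=> [[p [cp c'p] <-]|[[p cp <-]]].
  by split; [exact: chart_img_fun|rewrite chart_funK].
by rewrite chart_funK // => c'p; exists p.
Qed.

Lemma overlap_fun c c' p : chart_dom c p -> chart_dom c' p -> overlap c c' (c p).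
Proof. by move=> cp c'p; exists p. Qed.

Lemma overlap_open c c' : open (overlap c c').
Proof.
rewrite openE => x /overlapP[cx c'x]; rewrite /interior.
have H1 : \forall y \near x, chart_img c y.
  by apply: open_nbhs_nbhs; split=> //; exact: chart_img_open.
have H2 : \forall y \near x, chart_dom c' (chart_inv c y).
  apply: (chart_inv_cvg cx); apply: open_nbhs_nbhs; split=> //.
  exact: chart_dom_open.
by apply: filterS2 H1 H2 => y H1 H2; apply/overlapP.
Qed.

Lemma near_overlap c c' x : overlap c c' x -> \forall y \near x, overlap c c' y.
Proof. by move=> cx; apply: open_nbhs_nbhs; split=> //; exact: overlap_open. Qed.

Lemma transition_fun c c' p : chart_dom c p -> transition c c' (c p) = c' p.
Proof. by move=> cp; rewrite /transition /= chart_funK. Qed.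

Lemma transition_smooth c c' : atlas c -> atlas c' ->
  smooth_on (overlap c c') (transition c c').
Proof. by move=> ac ac'; have [] := atlas_compatible ac ac'. Qed.

Lemma transition_diff c c' x : atlas c -> atlas c' -> overlap c c' x ->
  differentiable (transition c c') x.
Proof. by move=> ac ac' cx; apply: (Ck_on_diff (transition_smooth ac ac' 1%N)). Qed.

(** Locked, so that it is only ever used through [mul_jac]. *)
Definition jac c c' x : 'M[R]_n := locked (@jacobian n n R) (transition c c') x.

Lemma mul_jac c c' x v : atlas c -> atlas c' -> overlap c c' x ->
  v *m jac c c' x = 'd (transition c c') x v.
Proof. by move=> ac ac' cx; rewrite /jac -lock /jacobian mul_rV_lin1. Qed.

Lemma mul_jacD c c' x v : atlas c -> atlas c' -> overlap c c' x ->
  v *m jac c c' x = 'D_v (transition c c') x.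
Proof.
by move=> ac ac' cx; rewrite mul_jac // deriveE //; exact: transition_diff.
Qed.

Lemma diff_near_eq (f g : 'rV[R]_n -> 'rV[R]_n) x v :
  differentiable f x -> differentiable g x ->
  (\forall y \near x, f y = g y) -> 'd f x v = 'd g x v.
Proof.
move=> df dg fg; apply: etrans (esym (deriveE v df)) _.
exact: etrans (near_eq_derive v fg) (deriveE v dg).
Qed.

Lemma mulmx_ext m (A B : 'M[R]_(n, m)) :
  (forall v : 'rV_n, v *m A = v *m B) -> A = B.
Proof. by move=> AB; apply/row_matrixP => i; rewrite !rowE AB. Qed.

(** The chain rule for the transitions between three charts. *)
Lemma jac_cocycle c1 c2 c3 p : atlas c1 -> atlas c2 -> atlas c3 ->
  chart_dom c1 p -> chart_dom c2 p -> chart_dom c3 p ->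
  jac c1 c3 (c1 p) = jac c1 c2 (c1 p) *m jac c2 c3 (c2 p).
Proof.
move=> a1 a2 a3 d1 d2 d3; have o12 := overlap_fun d1 d2.
have o13 := overlap_fun d1 d3; have o23 := overlap_fun d2 d3.
have t12 := transition_fun c2 d1.
apply: mulmx_ext => v.
rewrite mulmxA (mul_jac _ a1 a3 o13) (mul_jac _ a1 a2 o12).
rewrite (mul_jac _ a2 a3 o23) -t12.
have D1 := transition_diff a1 a2 o12.
have D2 : differentiable (transition c2 c3) (transition c1 c2 (c1 p)).
  by rewrite t12; exact: transition_diff.
apply: etrans _ (congr1 (fun f : _ -> _ => f v) (diff_comp D1 D2)).
apply: diff_near_eq; [exact: transition_diff|exact: differentiable_comp|].
apply: filterS2 (near_overlap o12) (near_overlap o13).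
move=> y /overlapP[c1y c2y] _; rewrite /transition /=.
by rewrite chart_funK.
Qed.

Lemma jac_id c p : atlas c -> chart_dom c p -> jac c c (c p) = 1%:M.
Proof.
move=> ac cp; have oc := overlap_fun cp cp.
apply: mulmx_ext => v; rewrite mulmx1 mul_jac //.
rewrite (@diff_near_eq _ id) ?diff_val //; first exact: transition_diff.
by apply: filterS (near_overlap oc) => y /overlapP[cy _]; exact: chart_invK.
Qed.

(** Matrices with prescribed rows are written as sums of linear images of the
    rows, so that calculus on the rows carries over. *)
Lemma row_stack_rows m (r : 'I_n -> 'rV[R]_m) i :
  row i (\sum_j (delta_mx j 0 : 'cV[R]_n) *m r j) = r i.
Proof.
rewrite linear_sum (bigD1 i) //= big1 ?addr0 => [|j ji].
  apply/rowP => k; rewrite !mxE big_ord1 !mxE !eqxx.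
  by rewrite mul1r.
apply/rowP => k; rewrite !mxE big_ord1 !mxE eq_sym (negbTE ji).
by rewrite mul0r.
Qed.

Lemma jac_sumE c c' x : atlas c -> atlas c' -> overlap c c' x ->
  jac c c' x = \sum_i (delta_mx i 0 : 'cV[R]_n) *m
                 'D_(delta_mx 0 i) (transition c c') x.
Proof.
move=> ac ac' cx; apply/row_matrixP => i; rewrite row_stack_rows rowE.
exact: mul_jacD.
Qed.

Lemma jac_cvg c c' x : atlas c -> atlas c' -> overlap c c' x ->
  jac c c' y @[y --> x] --> jac c c' x.
Proof.
move=> ac ac' cx; rewrite [jac c c' x]jac_sumE //.
pose f y := \sum_i (delta_mx i 0 : 'cV[R]_n) *m
   'D_(delta_mx 0 i) (transition c c') y.
suff H : f y @[y --> x] --> f x.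
  move=> P HP; have {}HP : \forall y \near x, P (f y) := H P HP.
  have HP' : \forall y \near x, P (jac c c' y).
    by apply: filterS2 (near_overlap cx) HP => y cy; rewrite jac_sumE.
  exact: HP'.
have FF := nbhs_filter (x : 'rV[R]_n).
apply: (@cvg_sumr _ _ _ _ FF) => i.
apply: (@cvg_bounded_linear _ _ _ _ _ _ FF _ _
  (bounded_bilinearr _ (bounded_bilinear_mulmx R n 1 n))).
exact: (Ck_on_derive (delta_mx 0 i) (transition_smooth ac ac' 1%N)).
Qed.

End Charts.

(** * Frames along curves *)

Section Frames.
Variables (R : realType) (n : nat) (M : manifold R n) (nabla : connection M).
Implicit Types (c : chart R n M) (p : M) (x v w : 'rV[R]_n) (A B : set R).

(** The connection form evaluated on [w]: [v *m Omega c x w] is the Christoffel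
    term of the derivative of [v] along [w], so that a frame [e] is parallel
    when [e' = - e *m Omega]. *)
Definition Omega c x w : 'M[R]_n := \matrix_i nabla c x w (delta_mx 0 i).

Lemma mul_Omega c x w v : atlas c -> chart_img c x ->
  v *m Omega c x w = nabla c x w v.
Proof.
move=> ac cx; have lin := christoffel_linearr nabla w ac cx.
pose f := HB.pack_for {linear 'rV[R]_n -> 'rV[R]_n} (christoffel nabla c x w)
  (GRing.isLinear.Build _ _ _ _ _ lin).
rewrite mulmx_sum_row -[RHS]/(f v) {2}[v]rV_sum_delta linear_sum.
by apply: eq_bigr => i _; rewrite linearZ rowK.
Qed.

Definition Gamma_row c k i x : 'M[R]_n := (delta_mx i 0 : 'cV[R]_n) *m
  nabla c x (delta_mx 0 k) (delta_mx 0 i).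

Lemma Omega_sum c x w : atlas c -> chart_img c x ->
  Omega c x w = \sum_k w 0 k *: (\sum_i Gamma_row c k i x).
Proof.
move=> ac cx; apply/row_matrixP => i; rewrite rowK linear_sum /=.
have lin := christoffel_linearl nabla (delta_mx 0 i) ac cx.
pose f := HB.pack_for {linear 'rV[R]_n -> 'rV[R]_n}
  (fun u => christoffel nabla c x u (delta_mx 0 i))
  (GRing.isLinear.Build _ _ _ _ _ lin).
rewrite -[LHS]/(f w) {1}[w]rV_sum_delta linear_sum; apply: eq_bigr => k _.
by rewrite !linearZ /= row_stack_rows.
Qed.

Section OmegaFamilies.
Variables (T : Type) (F : set_system T) (o : T).
Context {FF : Filter F}.
Hypothesis Fo : forall P : set T, F P -> P o.

Lemma jointC_Omega j c (x w : T -> R -> 'rV[R]_n) t : unitI t -> atlas c ->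
  chart_img c (x o t) -> jointC F o j x t -> jointC F o j w t ->
  jointC F o j (fun l s => Omega c (x l s) (w l s)) t.
Proof.
move=> It ac cx xC wC.
apply: (jointC_near Fo It (f := fun l s =>
    \sum_k (w l s 0 k : R) *: (\sum_i Gamma_row c k i (x l s)))).
  have nA : \forall z \near joint F t, chart_img c (x z.1 z.2).
    apply: (jointC_jointC0 xC); apply: open_nbhs_nbhs; split=> //.
    exact: chart_img_open.
  by apply: filterS nA => z cz; rewrite Omega_sum.
apply: jointC_sum => // k; apply: jointC_bilin => //.
- exact: bounded_bilinear_scale.
- exact: (jointC_lin Fo It (bounded_linear_entry R 0 k)).
apply: jointC_sum => // i.
pose Phi y := nabla c y (delta_mx 0 k) (delta_mx 0 i).
apply: (jointC_lin Fo It (bounded_bilinearr _ (bounded_bilinear_mulmx R n 1 n))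
  (f := fun l s => Phi (x l s))).
have PhiS : Ck_on j (chart_img c) Phi by exact: christoffel_smooth.
exact: (jointC_comp Fo It (@chart_img_open _ _ _ c) cx PhiS xC).
Qed.

End OmegaFamilies.

Lemma loc_lipschitz_Omega c x w : atlas c -> chart_img c x ->
  loc_lipschitz (fun q : 'rV[R]_n * 'rV[R]_n => Omega c q.1 q.2) (x, w).
Proof.
move=> ac cx; apply: (@loc_lipschitz_near _ _ _ (fun q : 'rV[R]_n * 'rV[R]_n =>
    \sum_k (q.2 0 k : R) *: (\sum_i Gamma_row c k i q.1))).
  have nA : \forall q \near (x, w), chart_img c q.1.
    apply: (@cvg_fst _ _ (nbhs x) (nbhs w)); apply: open_nbhs_nbhs; split=> //.
    exact: chart_img_open.
  by apply: filterS nA => q cq; rewrite Omega_sum.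
apply: loc_lipschitz_sum => k; apply: loc_lipschitz_bilin.
- exact: bounded_bilinear_scale.
- apply: (@loc_lipschitz_comp _ _ _ _ snd (fun v : 'rV[R]_n => v 0 k)).
    exact/loc_lipschitz_lin/bounded_linear_entry.
  exact/loc_lipschitz_lin/bounded_linear_snd.
apply: loc_lipschitz_sum => i.
apply: (@loc_lipschitz_comp _ _ _ _ fst (Gamma_row c k i)); last first.
  exact/loc_lipschitz_lin/bounded_linear_fst.
apply: (@loc_lipschitz_comp _ _ _ _
  (fun y => nabla c y (delta_mx 0 k) (delta_mx 0 i))).
  apply: loc_lipschitz_lin.
  exact: (bounded_bilinearr _ (bounded_bilinear_mulmx R n 1 n)).
apply: loc_lipschitz_C1 (@chart_img_open _ _ _ c) cx _.
exact: christoffel_smooth.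
Qed.

(** A curve [s] with velocity [w] and a frame [e] along it: the rows of [e c t]
    are the components in [c] of [n] vector fields that are parallel along
    [s]. *)
Definition framed A (s : R -> M) (w : chart R n M -> R -> 'rV[R]_n)
    (e : chart R n M -> R -> 'M[R]_n) : Prop :=
  forall t, A t -> cont_within A s t /\ forall c, atlas c -> chart_dom c (s t) ->
    [/\ has_deriv A (c \o s) t (w c t),
        has_deriv A (e c) t (- (e c t *m Omega c (c (s t)) (w c t))) &
        forall c', atlas c' -> chart_dom c' (s t) ->
          e c' t = e c t *m jac c c' (c (s t))].

Lemma near_chart A (s : R -> M) c t : cont_within A s t -> chart_dom c (s t) ->
  \forall r \near t, A r -> chart_dom c (s r).
Proof.
move=> sc cs; have : \forall p \near s t, chart_dom c p.
  by apply: open_nbhs_nbhs; split=> //; exact: chart_dom_open.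
exact: sc.
Qed.

Lemma has_deriv_jac A c c' (x : R -> 'rV[R]_n) w t : A t -> atlas c -> atlas c' ->
  overlap c c' (x t) -> has_deriv A x t w ->
  has_deriv A (fun r => jac c c' (x r)) t
    (\sum_i (delta_mx i 0 : 'cV[R]_n) *m
       'D_w (fun y => 'D_(delta_mx 0 i) (transition c c') y) (x t)).
Proof.
move=> At ac ac' cx xD.
have tS := transition_smooth ac ac'.
have xc := has_deriv_cont_within xD.
have nx : \forall r \near t, A r -> overlap c c' (x r).
  exact: xc (near_overlap cx).
apply: (@has_deriv_near _ _ _ (fun r => \sum_i (delta_mx i 0 : 'cV[R]_n) *m
   'D_(delta_mx 0 i) (transition c c') (x r))) => //.
  by apply: filterS nx => r + Ar => /(_ Ar) cxr; rewrite jac_sumE.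
apply: has_deriv_sum => i.
apply: (has_deriv_lin (bounded_bilinearr _ (bounded_bilinear_mulmx R n 1 n))).
have dT := Ck_on_diff (Ck_on_derive (delta_mx 0 i) (tS 2%N)) cx.
by rewrite deriveE //; exact: has_deriv_comp.
Qed.

(** The frame equation does not depend on the chart: this is the
    transformation law of the Christoffel symbols. *)
Lemma jac_Omega c c' x w : atlas c -> atlas c' -> overlap c c' x ->
  Omega c x w *m jac c c' x =
  (\sum_i (delta_mx i 0 : 'cV[R]_n) *m
     'D_w (fun y => 'D_(delta_mx 0 i) (transition c c') y) x)
  + jac c c' x *m Omega c' (transition c c' x) (w *m jac c c' x).
Proof.
move=> ac ac' cx; have /overlapP[cx1 c'x] := cx.
have c'tx : chart_img c' (transition c c' x) by exact: chart_img_fun.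
apply/row_matrixP => i; rewrite linearD /= row_stack_rows !row_mul rowK.
have -> : row i (jac c c' x) = 'D_(delta_mx 0 i) (transition c c') x.
  by rewrite rowE (mul_jacD _ ac ac' cx).
rewrite (mul_jacD _ ac ac' cx) (mul_jacD _ ac ac' cx) (mul_Omega _ _ ac' c'tx).
exact: christoffel_transition.
Qed.

Lemma frame_transfer A (s : R -> M) c c' w (e e' : R -> 'M[R]_n) t :
  A t -> atlas c -> atlas c' -> chart_dom c (s t) -> chart_dom c' (s t) ->
  cont_within A s t -> has_deriv A (c \o s) t w ->
  has_deriv A e t (- (e t *m Omega c (c (s t)) w)) ->
  (\forall r \near t, A r -> e' r = e r *m jac c c' (c (s r))) ->
  has_deriv A (c' \o s) t (w *m jac c c' (c (s t))) /\
  has_deriv A e' t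
    (- (e' t *m Omega c' (c' (s t)) (w *m jac c c' (c (s t))))).
Proof.
move=> At ac ac' cs c's sc xD eD ee'; have cx := overlap_fun cs c's.
have ncs := near_chart sc cs; split.
  apply: (@has_deriv_near _ _ _ (transition c c' \o (c \o s))) => //.
    by apply: filterS ncs => r + Ar => /(_ Ar) cr /=; rewrite transition_fun.
  rewrite mul_jac //; apply: has_deriv_comp => //; exact: transition_diff.
apply: (@has_deriv_near _ _ _ (fun r => e r *m jac c c' (c (s r)))) => //.
  by apply: filterS ee' => r + Ar => /(_ Ar).
have := has_deriv_bilin (bounded_bilinear_mulmx R n n n) eD
  (has_deriv_jac At ac ac' cx xD).
rewrite (nbhs_singleton ee' At) -(transition_fun c' cs).
set S := \sum_i _; rewrite -!mulmxA.
suff -> : - (e t *m Omega c (c (s t)) w) *m jac c c' (c (s t)) + e t *m S =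
  - (e t *m (jac c c' (c (s t)) *m
       Omega c' (transition c c' (c (s t))) (w *m jac c c' (c (s t))))) by [].
rewrite mulNmx -mulmxA jac_Omega // -/S mulmxDr opprD addrAC addNr add0r.
by [].
Qed.

(** By [jac_cocycle], a solution in one chart prescribes consistent components in
    all the others, and these are solutions by [frame_transfer]. *)
Lemma framed_of_chart A c (x w : R -> 'rV[R]_n) (e : R -> 'M[R]_n) : atlas c ->
  (forall t, A t -> [/\ chart_img c (x t), has_deriv A x t (w t) &
     has_deriv A e t (- (e t *m Omega c (x t) (w t)))]) ->
  framed A (chart_inv c \o x) (fun c' t => w t *m jac c c' (x t))
    (fun c' t => e t *m jac c c' (x t)).
Proof.
move=> ac xP t At; have [cx xD eD] := xP t At.
have ci r : A r -> c (chart_inv c (x r)) = x r.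
  by move=> Ar; apply: chart_invK; have [] := xP r Ar.
have cd r : A r -> chart_dom c (chart_inv c (x r)).
  by move=> Ar; apply: chart_dom_inv; have [] := xP r Ar.
have sc : cont_within A (chart_inv c \o x) t.
  exact: cvg_comp (has_deriv_cont_within xD) (chart_inv_cvg cx).
split=> // c' ac' /= c's.
have xD' : has_deriv A (c \o (chart_inv c \o x)) t (w t).
  by apply: has_deriv_near xD => //; near=> r => Ar /=; rewrite ci.
have eD' : has_deriv A e t
    (- (e t *m Omega c (c ((chart_inv c \o x) t)) (w t))) by rewrite /= ci.
have [|H1 H2] := @frame_transfer A (chart_inv c \o x) c c' (w t) e
    (fun r => e r *m jac c c' (x r)) t At ac ac' (cd t At) c's sc xD' eD'.
  by near=> r => Ar /=; rewrite ci.
rewrite /= ci // in H1 H2; split=> // c'' ac'' c''s.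
rewrite -mulmxA; congr (_ *m _).
rewrite -[in LHS](ci t At) -[in X in X *m _](ci t At).
by apply: jac_cocycle => //; exact: cd.
Unshelve. all: by end_near. Qed.

Lemma framed_eq A (s s' : R -> M) (w w' : chart R n M -> R -> 'rV[R]_n)
    (e e' : chart R n M -> R -> 'M[R]_n) :
  (forall t, A t -> s t = s' t) ->
  (forall t c, A t -> atlas c -> chart_dom c (s t) ->
     w c t = w' c t /\ e c t = e' c t) ->
  framed A s w e -> framed A s' w' e'.
Proof.
move=> ss' ww' fs t At; have [sc fst] := fs t At.
have nss : \forall r \near t, A r -> s r = s' r by near=> r; exact: ss'.
split=> [|c ac]; first exact: cont_within_near nss sc.
rewrite -ss' // => cs; have [wt et] := ww' t c At ac cs.
have [H1 H2 H3] := fst c ac cs; split.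
- rewrite -wt; apply: has_deriv_near H1 => //.
  by apply: filterS nss => r + Ar => /(_ Ar) /= ->.
- rewrite -wt -et; apply: has_deriv_near H2 => //.
  apply: filterS (near_chart sc cs) => r + Ar => /(_ Ar) cr.
  by have [] := ww' r c Ar ac cr.
- move=> c' ac' c's; have [_ et'] := ww' t c' At ac' c's.
  by rewrite -et -et'; exact: H3.
Unshelve. all: by end_near. Qed.

Lemma not_in_closed_near B (t : R) : closed B -> ~ B t ->
  \forall r \near t, ~ B r.
Proof.
move=> cB nBt; have : open (~` B) by exact: closed_openC.
by move=> oB; apply: (@open_nbhs_nbhs _ t (~` B)); split.
Qed.

Lemma cont_within_union (T : topologicalType) A B (f : R -> T) t :
  closed A -> closed B -> (A t -> cont_within A f t) -> (B t -> cont_within B f t) ->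
  cont_within (A `|` B) f t.
Proof.
move=> cA cB fA fB; apply: cont_withinU.
  have [/fA //|nAt] := pselect (A t).
  move=> P Pt; have : \forall r \near t, A r -> P (f r) by
    apply: filterS (not_in_closed_near cA nAt).
  exact.
have [/fB //|nBt] := pselect (B t).
move=> P Pt; have : \forall r \near t, B r -> P (f r) by
  apply: filterS (not_in_closed_near cB nBt).
exact.
Qed.

Lemma has_deriv_union (V : normedModType R) A B (f : R -> V) t l :
  closed A -> closed B -> (A t -> has_deriv A f t l) -> (B t -> has_deriv B f t l) ->
  has_deriv (A `|` B) f t l.
Proof.
move=> cA cB fA fB; apply: has_derivU.
  have [/fA //|nAt] := pselect (A t); move=> e e0.
  by apply: filterS (not_in_closed_near cA nAt).
have [/fB //|nBt] := pselect (B t); move=> e e0.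
by apply: filterS (not_in_closed_near cB nBt).
Qed.

(** Closedness makes the conditions relative to a segment void at the points
    outside of it. *)
Lemma framed_union A B (s : R -> M) (w : chart R n M -> R -> 'rV[R]_n) e :
  closed A -> closed B ->
  framed A s w e -> framed B s w e -> framed (A `|` B) s w e.
Proof.
move=> cA cB fA fB t ABt; split.
  by apply: cont_within_union => // Ct; [have [] := fA t Ct|have [] := fB t Ct].
move=> c ac cs; split.
- apply: has_deriv_union => // Ct; [have [_ /(_ c ac cs)[]] := fA t Ct|
    have [_ /(_ c ac cs)[]] := fB t Ct]; by [].
- apply: has_deriv_union => // Ct; [have [_ /(_ c ac cs)[]] := fA t Ct|
    have [_ /(_ c ac cs)[]] := fB t Ct]; by [].
- by case: ABt => Ct; [have [_ /(_ c ac cs)[]] := fA t Ct|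
    have [_ /(_ c ac cs)[]] := fB t Ct].
Qed.

Lemma seg_closed (a b : R) : closed (seg a b).
Proof.
have -> : seg a b = [set` `[a, b]] by apply/seteqP; split=> t; rewrite /seg /= in_itv.
exact: interval_closed.
Qed.

Definition glue (S : Type) (a : R) (f g : R -> S) (t : R) : S :=
  if t <= a then f t else g t.

Lemma glue_l S (a b : R) (f g : R -> S) t : seg b a t -> glue a f g t = f t.
Proof. by move=> /andP[_ ta]; rewrite /glue ta. Qed.

Lemma glue_r S (a b : R) (f g : R -> S) t : f a = g a -> seg a b t ->
  glue a f g t = g t.
Proof.
move=> fg /andP[at_ tb]; rewrite /glue; case: leP => // ta.
by have -> : t = a by apply/eqP; rewrite eq_le ta at_.
Qed.

Lemma framed_glue (a b : R) (s1 s2 : R -> M)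
    (w1 w2 : chart R n M -> R -> 'rV[R]_n) e1 e2 : 0 <= a -> a <= b ->
  framed (seg 0 a) s1 w1 e1 -> framed (seg a b) s2 w2 e2 -> s1 a = s2 a ->
  (forall c, atlas c -> chart_dom c (s1 a) -> w1 c a = w2 c a /\ e1 c a = e2 c a) ->
  framed (seg 0 b) (glue a s1 s2) (fun c => glue a (w1 c) (w2 c))
    (fun c => glue a (e1 c) (e2 c)).
Proof.
move=> a0 ab f1 f2 ss we; rewrite (segU a0 ab).
apply: framed_union; [exact: seg_closed|exact: seg_closed| |].
  apply: framed_eq f1 => [t At|t c At ac cs]; rewrite ?(glue_l _ _ At) //.
apply: framed_eq f2 => [t At|t c At ac cs]; first by rewrite (glue_r ss At).
have /andP[at_ tb] := At.
have [ta|ta] := leP t a; last by rewrite /glue leNgt ta.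
have tE : t = a by apply/eqP; rewrite eq_le ta at_.
rewrite /glue tE lexx in cs *; rewrite -ss in cs.
by have [-> ->] := we c ac cs.
Qed.

End Frames.

(** * A parallel frame along a curve of class C^1 *)

Section ParallelFrame.
Variables (R : realType) (n : nat) (M : manifold R n) (nabla : connection M).
Implicit Types (c : chart R n M) (p : M) (A B : set R).
Local Notation I := (@unitI R).

Lemma chart_at_atlas p : atlas (chart_at p).
Proof. by rewrite /chart_at; case: cid2. Qed.

Lemma chart_at_dom p : chart_dom (chart_at p) p.
Proof. by rewrite /chart_at; case: cid2. Qed.

Lemma jac_unit c c' p : atlas c -> atlas c' -> chart_dom c p ->
  chart_dom c' p -> jac c c' (c p) \in unitmx.
Proof.
move=> ac ac' cp c'p; have := jac_cocycle ac ac' ac cp c'p cp.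
by rewrite jac_id // => /esym /mulmx1_unit[].
Qed.

(** A row vector [v] in the kernel of [A] satisfies [v = - v *m (A - 1)], whose
    norm is at most half of that of [v]. *)
Lemma unitmx_near1 : exists2 e : R, 0 < e &
  forall A : 'M[R]_n, `|A - 1%:M| <= e -> A \in unitmx.
Proof.
have [_ _ _ _ [C C0 CB]] := bounded_bilinear_mulmx R 1 n n.
exists (2^-1 / C) => [|A Ae]; first by rewrite divr_gt0 // invr_gt0.
rewrite -row_free_unit -kermx_eq0; apply/eqP/row_matrixP => i; rewrite row0.
set v := row i _; have vA : v *m A = 0 by rewrite -row_mul mulmx_ker row0.
apply/eqP; rewrite -normr_le0.
have : `|v| <= C * `|v| * (2^-1 / C).
  have {1}-> : v = - (v *m (A - 1%:M)) by rewrite mulmxBr vA mulmx1 sub0r opprK.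
  rewrite normrN; apply: le_trans (CB _ _) _; apply: ler_wpM2l => //.
  by rewrite mulr_ge0 // ltW.
rewrite (_ : C * `|v| * (2^-1 / C) = `|v| / 2); last by field; rewrite gt_eqF.
by have := normr_ge0 v; move: (`|v|) => r; lra.
Qed.

(** This is [frame_transfer] with the zero frame. *)
Lemma velocity_transfer A (s : R -> M) c c' (w : 'rV[R]_n) t :
  A t -> atlas c -> atlas c' -> chart_dom c (s t) -> chart_dom c' (s t) ->
  cont_within A s t -> has_deriv A (c \o s) t w ->
  has_deriv A (c' \o s) t (w *m jac c c' (c (s t))).
Proof.
move=> At ac ac' cs c's sc xD.
have z0 : has_deriv A (fun=> 0 : 'M[R]_n) t (- (0 *m Omega nabla c (c (s t)) w)).
  by rewrite mul0mx oppr0; exact: has_deriv_cst.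
have [|//] := @frame_transfer _ _ _ nabla A s c c' w _ (fun=> 0) t
  At ac ac' cs c's sc xD z0.
by near=> r => _; rewrite mul0mx.
Unshelve. all: by end_near. Qed.

Definition C1_curve (s : R -> M) : Prop := forall t, I t ->
  cont_within I s t /\ forall c, atlas c -> chart_dom c (s t) ->
    has_deriv I (c \o s) t (velocity s c t) /\ cont_within I (velocity s c) t.

Lemma velocity_jac (s : R -> M) c c' t : C1_curve s -> I t ->
  atlas c -> atlas c' -> chart_dom c (s t) -> chart_dom c' (s t) ->
  velocity s c' t = velocity s c t *m jac c c' (c (s t)).
Proof.
move=> sC It ac ac' cs c's; have [sc sD] := sC t It.
have H := velocity_transfer It ac ac' cs c's sc (sD c ac cs).1.
have H' := (sD c' ac' c's).1; rewrite unitI_seg in It H H'.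
exact: has_deriv_unique ltr01 It H' H.
Qed.

Lemma has_deriv_singleton (V : normedModType R) (f : R -> V) (a t : R) l :
  seg a a t -> has_deriv (seg a a) f t l.
Proof.
move=> at_ e e0; near=> s => as_.
by rewrite (seg_eq at_) (seg_eq as_) !subrr scale0r subr0 !normr0 mulr0.
Unshelve. all: by end_near. Qed.

Lemma loc_lipschitz_frame c (x w : 'rV[R]_n) (e : 'M[R]_n) :
  atlas c -> chart_img c x ->
  loc_lipschitz (fun q : ('rV[R]_n * 'rV[R]_n) * 'M[R]_n =>
    - (q.2 *m Omega nabla c q.1.1 q.1.2)) ((x, w), e).
Proof.
move=> ac cx.
apply: (@loc_lipschitz_comp _ _ _ _
  (fun q : ('rV[R]_n * 'rV[R]_n) * 'M[R]_n => q.2 *m Omega nabla c q.1.1 q.1.2)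
  (fun v => - v)).
  apply: loc_lipschitz_lin; split=> [u v|a u|].
  - by rewrite opprD.
  - by rewrite scalerN.
  - by exists 1 => // u; rewrite normrN mul1r.
apply: loc_lipschitz_bilin; first exact: bounded_bilinear_mulmx.
  exact/loc_lipschitz_lin/bounded_linear_snd.
apply: (@loc_lipschitz_comp _ _ _ _ fst
  (fun q : 'rV[R]_n * 'rV[R]_n => Omega nabla c q.1 q.2)).
  exact: loc_lipschitz_Omega.
exact/loc_lipschitz_lin/bounded_linear_fst.
Qed.

Section Along.
Variables (s : R -> M).
Hypothesis sC : C1_curve s.

Let frame_upto a := exists E : chart R n M -> R -> 'M[R]_n,
  framed nabla (seg 0 a) s (velocity s) E /\
  forall t c, seg 0 a t -> atlas c -> chart_dom c (s t) -> E c t \in unitmx.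

Lemma frame_upto0 : frame_upto 0.
Proof.
pose c0 := chart_at (s 0); have ac0 := chart_at_atlas (s 0).
have cd0 := chart_at_dom (s 0).
exists (fun c _ => jac c0 c (c0 (s 0))).
split=> [t t0|t c /seg_eq -> ac cs]; last exact: jac_unit.
have sI : seg 0 0 `<=` I by rewrite unitI_seg; exact: sub_seg.
have It : I t by exact: sI.
have [sc sD] := sC It; split=> [|c ac cs]; first exact: cont_within_subset sc.
have [H _] := sD c ac cs.
split; [exact: has_deriv_subset sI _|exact: has_deriv_singleton|move=> c' ac' c's].
by rewrite (seg_eq t0) in cs c's *; exact: jac_cocycle.
Qed.

(** The frame equation is linear in the frame.  Solving it from the identity
    matrix and multiplying by the frame already obtained at [a] makes the length
    of the step independent of the latter. *)
Lemma frame_upto_step t : I t -> exists2 d : R, 0 < d &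
  forall a b, 0 <= a <= t -> t <= b <= 1 -> t - d < a -> b < t + d ->
    frame_upto a -> frame_upto b.
Proof.
move=> It; pose c0 := chart_at (s t); have ac0 := chart_at_atlas (s t).
have cd0 := chart_at_dom (s t); have [sc sD] := sC It.
have [xD wc] := sD c0 ac0 cd0.
pose x0 := c0 (s t); pose w0 := velocity s c0 t.
have [eta eta0 Hunit] := unitmx_near1.
have [d d0 Hode] := ode_exists (loc_lipschitz_frame w0 1%:M ac0
  (chart_img_fun cd0)) (picard_space_mx R n n) eta0.
have Hnear : \forall r \near t, I r -> [/\ chart_dom c0 (s r),
    `|c0 (s r) - x0| < d & `|velocity s c0 r - w0| < d].
  have H1 := near_chart sc cd0.
  have /cont_withinP /(_ _ d0) H2 := has_deriv_cont_within xD.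
  have /cont_withinP /(_ _ d0) H3 := wc.
  apply: filterS3 H1 H2 H3 => r + + + Ir.
  by move=> /(_ Ir) ? /(_ Ir) ? /(_ Ir) ?.
have /nbhs_ballP[del /= del0 Hdel] := Hnear.
exists (Num.min del (d / 2)); first by rewrite lt_min del0 divr_gt0.
move=> a b /andP[a0 at_] /andP[tb b1] Ha Hb [E [Ef Eu]].
have ab : a <= b by exact: le_trans tb.
have IE r : seg a b r -> I r.
  by rewrite unitI_seg; apply: sub_seg.
have Hab r : seg a b r -> [/\ chart_dom c0 (s r),
    `|c0 (s r) - x0| < d & `|velocity s c0 r - w0| < d].
  move=> abr; have /andP[ar rb] := abr; apply: Hdel; last exact: IE.
  rewrite -ball_normE /ball_ /= ltr_distlC; apply/andP; split.
    apply: le_lt_trans (lt_le_trans Ha ar).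
    by rewrite lerD2l lerN2 ge_min lexx.
  apply: le_lt_trans rb (lt_le_trans Hb _).
  by rewrite lerD2l ge_min lexx.
have bad : b - a < d.
  have : Num.min del (d / 2) <= d / 2 by rewrite ge_min lexx orbT.
  by move: Ha Hb; move: (Num.min _ _) => m; lra.
have [||ehat ehata ehatP] :=
    Hode a b (fun r => (c0 (s r), velocity s c0 r)) 1%:M ab bad.
- move=> r abr; have [cr xr wr] := Hab r abr; split; last first.
    by rewrite pair_dist_lt xr wr.
  have [src srD] := sC (IE r abr); have [xrD wrc] := srD c0 ac0 cr.
  have sub : seg a b `<=` I by move=> ?; exact: IE.
  apply: cont_within_pair; first exact: cont_within_subset sub (has_deriv_cont_within xrD).
  exact: cont_within_subset sub wrc.
- by rewrite subrr normr0.
have sub : seg a b `<=` I by move=> ?; exact: IE.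
have fr2 := @framed_of_chart _ _ _ nabla (seg a b) c0 (c0 \o s)
  (velocity s c0) (fun r => E c0 a *m ehat r) ac0.
have {}fr2 : framed nabla (seg a b) s (velocity s)
    (fun c r => E c0 a *m ehat r *m jac c0 c (c0 (s r))).
  apply: framed_eq (fr2 _) => [r abr|r c abr ac|r abr] /=.
  - by have [cr _ _] := Hab r abr; rewrite chart_funK.
  - have [cr _ _] := Hab r abr; rewrite chart_funK // => cs; split=> //.
    by apply/esym/velocity_jac => //; exact: IE.
  have [cr _ _] := Hab r abr; have [src srD] := sC (IE r abr).
  have [xrD wrc] := srD c0 ac0 cr; split.
  - exact: chart_img_fun.
  - exact: has_deriv_subset sub xrD.
  - have [_ eD] := ehatP r abr.
    have := has_deriv_lin (bounded_bilinearr (E c0 a) (bounded_bilinear_mulmx R n n n)) eD.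
    by rewrite /= mulmxN mulmxA.
have saa : seg 0 a a by rewrite /seg /= a0 lexx.
have aba : seg a b a by exact: seg_l.
have [ca _ _] := Hab a aba.
have Ea c : atlas c -> chart_dom c (s a) ->
    E c a = E c0 a *m ehat a *m jac c0 c (c0 (s a)).
  move=> ac cs; rewrite ehata mulmx1.
  by have [_ /(_ c0 ac0 ca)[_ _ /(_ c ac cs)]] := Ef a saa.
have glueE S (f : R -> S) : glue a f f = f.
  by apply/funext => r; rewrite /glue if_same.
pose E' c := glue a (E c) (fun r => E c0 a *m ehat r *m jac c0 c (c0 (s r))).
exists E'; split.
  have := framed_glue a0 ab Ef fr2 erefl; rewrite glueE.
  have -> : (fun c => glue a (velocity s c) (velocity s c)) = velocity s.
    by apply/funext => c; rewrite glueE.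
  by apply=> c ac cs; split=> //; exact: Ea.
move=> r c /andP[r0 rb] ac cs; rewrite /E' /glue; case: leP => ra.
  by apply: Eu => //; apply/andP.
have abr : seg a b r by apply/andP; split=> //; exact: ltW.
have [cr _ _] := Hab r abr; have [ehr _] := ehatP r abr.
rewrite !unitmx_mul jac_unit // (Hunit (ehat r) ehr) !andbT.
exact: Eu.
Qed.

Lemma parallel_frame_exists : exists E : chart R n M -> R -> 'M[R]_n,
  framed nabla I s (velocity s) E /\
  forall t c, I t -> atlas c -> chart_dom c (s t) -> E c t \in unitmx.
Proof.
rewrite unitI_seg; apply: (@interval_induction R 0 1 frame_upto ler01).
  exact: frame_upto0.
by move=> t t01; apply: frame_upto_step; rewrite unitI_seg.
Qed.

End Along.
End ParallelFrame.

(** * Perturbing the coefficients of the velocity *)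

Section JointConvergence.
Variables (R : realType) (T : Type) (F : set_system T).
Context {FF : Filter F}.
Implicit Types (A B : set R) (t : R) (X Y : topologicalType).

(** Unlike in [joint], the limit is not a member of the family, and the set of
    times varies with the progress of the construction. *)
Definition joint_cvg A X (f : T -> R -> X) (l : X) t :=
  f z.1 z.2 @[z --> filter_prod F (within A (nbhs t))] --> l.

Lemma prod_within_point A t (P : set (T * R)) : A t ->
  filter_prod F (within A (nbhs t)) P -> F (fun m => P (m, t)).
Proof.
move=> At [[X B] /= [FX nB] XB]; apply: filterS FX => m Xm; apply: XB.
split=> //=; have : \forall s \near t, A s -> B s := nB.
by move=> /nbhs_singleton; exact.
Qed.

Lemma joint_cvg_point A X (f : T -> R -> X) l t : A t -> joint_cvg A f l t ->
  f m t @[m --> F] --> l.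
Proof. by move=> At fl P Pl; exact: (prod_within_point At (fl P Pl)). Qed.

Lemma prod_withinU A B t (P : set (T * R)) :
  filter_prod F (within A (nbhs t)) P -> filter_prod F (within B (nbhs t)) P ->
  filter_prod F (within (A `|` B) (nbhs t)) P.
Proof.
move=> [[X A'] /= [FX nA] XA] [[Y B'] /= [FY nB] YB].
exists (X `&` Y, A' `|` B') => /=; last first.
  by move=> [m s] /= [[Xm Ym] [A's|B's]]; [apply: XA|apply: YB].
split; first exact: filterI.
have HA : \forall s \near t, A s -> A' s := nA.
have HB : \forall s \near t, B s -> B' s := nB.
have : \forall s \near t, A s \/ B s -> A' s \/ B' s.
  by apply: filterS2 HA HB => s HA HB [/HA|/HB]; [left|right].
exact.
Qed.

Lemma prod_within_vacuous A t (P : set (T * R)) : closed A -> ~ A t ->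
  filter_prod F (within A (nbhs t)) P.
Proof.
move=> cA nAt; exists (setT, set0); last by case=> m s [].
split=> /=; first exact: filterT.
have : \forall s \near t, A s -> False by exact: not_in_closed_near.
exact.
Qed.

Lemma joint_cvg_union A B X (f : T -> R -> X) l t : closed A -> closed B ->
  (A t -> joint_cvg A f l t) -> (B t -> joint_cvg B f l t) -> joint_cvg (A `|` B) f l t.
Proof.
move=> cA cB fA fB P Pl; apply: prod_withinU.
  have [/fA H|nAt] := pselect (A t); [exact: H|exact: prod_within_vacuous].
have [/fB H|nBt] := pselect (B t); [exact: H|exact: prod_within_vacuous].
Qed.

Lemma prod_within_all A t (P : T -> R -> Prop) :
  (\forall m \near F, forall s, A s -> P m s) ->
  \forall z \near filter_prod F (within A (nbhs t)), P z.1 z.2.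
Proof.
move=> HP; exists ([set m | forall s, A s -> P m s], A).
  split=> //=; have : \forall s \near t, A s -> A s by near=> s.
  exact.
by move=> [m s] [/= Pm As]; exact: Pm.
Unshelve. all: by end_near. Qed.

Lemma joint_cvg_eq A X (f g : T -> R -> X) l t :
  (\forall z \near filter_prod F (within A (nbhs t)), f z.1 z.2 = g z.1 z.2) ->
  joint_cvg A f l t -> joint_cvg A g l t.
Proof.
move=> fg fl P Pl; apply: filterS2 (fg) (fl P Pl) => -[m s] /= <-.
exact.
Qed.

Lemma joint_cvg_eq_all A X (f g : T -> R -> X) l t :
  (\forall m \near F, forall s, A s -> f m s = g m s) ->
  joint_cvg A f l t -> joint_cvg A g l t.
Proof. by move=> /(@prod_within_all A t) fg; exact: joint_cvg_eq. Qed.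

Lemma prod_within_snd A t (P : set R) : (\forall s \near t, A s -> P s) ->
  \forall z \near filter_prod F (within A (nbhs t)), P z.2.
Proof.
move=> HP; exists (setT, P); last by case=> x s [].
by split; [exact: filterT|exact: HP].
Qed.

Lemma joint_cvg_uniform A (V : normedModType R) (f : T -> R -> V) (g : R -> V) t :
  cont_within A g t ->
  (forall e : R, 0 < e -> \forall m \near F, forall s, A s -> `|f m s - g s| <= e) ->
  joint_cvg A f (g t) t.
Proof.
move=> gc fg; apply/cvgrPdist_lt => e e0.
have e2 : 0 < e / 2 by rewrite divr_gt0.
have /cont_withinP /(_ _ e2) H1 := gc.
have H2 := prod_within_all t (fg _ e2).
apply: filterS2 (prod_within_snd H1) H2 => -[m s] /= H3 H4.
rewrite distrC -(subrK (g s) (f m s)) -addrA [e]splitr.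
by apply: le_lt_trans (ler_normD _ _) _; apply: ler_ltD.
Qed.

End JointConvergence.

Section Perturbation.
Variables (R : realType) (n : nat) (M : manifold R n) (nabla : connection M).
Variables (T : Type) (F : set_system T).
Context {FF : Filter F}.
Implicit Types (c : chart R n M) (A B : set R).
Local Notation I := (@unitI R).

Variables (s : R -> M) (E : chart R n M -> R -> 'M[R]_n) (u : R -> 'rV[R]_n).
Variable p : T -> R -> 'rV[R]_n.
Hypothesis Ef : framed nabla I s (velocity s) E.
Hypothesis uE : forall t c, I t -> atlas c -> chart_dom c (s t) ->
  u t *m E c t = velocity s c t.
Hypothesis uc : forall t, I t -> cont_within I u t.
Hypothesis pc : forall m t, I t -> cont_within I (p m) t.
Hypothesis pu : forall e : R, 0 < e ->
  \forall m \near F, forall t, I t -> `|p m t - u t| <= e.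

(** The right-hand side of the frame equations, as a function of the coefficients,
    the position and the frame. *)
Let frame_rhs c (q : 'rV[R]_n * ('rV[R]_n * 'M[R]_n)) : 'rV[R]_n * 'M[R]_n :=
  (q.1 *m q.2.2, - (q.2.2 *m Omega nabla c q.2.1 (q.1 *m q.2.2))).

Lemma loc_lipschitz_frame_rhs c q : atlas c -> chart_img c q.2.1 ->
  loc_lipschitz (frame_rhs c) q.
Proof.
move=> ac cx; case: q cx => q1 [x e] /= cx.
pose pe (q : 'rV[R]_n * ('rV[R]_n * 'M[R]_n)) : 'rV[R]_n := q.1 *m q.2.2.
have L21 : loc_lipschitz (fun q : 'rV[R]_n * ('rV[R]_n * 'M[R]_n) => q.2.1)
    (q1, (x, e)).
  by apply: (@loc_lipschitz_comp _ _ _ _ snd fst);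
    exact/loc_lipschitz_lin/bounded_linear_fst ||
    exact/loc_lipschitz_lin/bounded_linear_snd.
have L22 : loc_lipschitz (fun q : 'rV[R]_n * ('rV[R]_n * 'M[R]_n) => q.2.2)
    (q1, (x, e)).
  by apply: (@loc_lipschitz_comp _ _ _ _ snd snd);
    exact/loc_lipschitz_lin/bounded_linear_snd.
have Lpe : loc_lipschitz pe (q1, (x, e)).
  apply: loc_lipschitz_bilin; first exact: bounded_bilinear_mulmx.
    exact/loc_lipschitz_lin/bounded_linear_fst.
  exact: L22.
apply: loc_lipschitz_pair; first exact: Lpe.
apply: (@loc_lipschitz_comp _ _ _ _
  (fun q : 'rV[R]_n * ('rV[R]_n * 'M[R]_n) => ((q.2.1, pe q), q.2.2))
  (fun q : ('rV[R]_n * 'rV[R]_n) * 'M[R]_n =>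
     - (q.2 *m Omega nabla c q.1.1 q.1.2))).
  exact: loc_lipschitz_frame.
by apply: loc_lipschitz_pair => //; apply: loc_lipschitz_pair.
Qed.

Let solved_upto a := exists (sig : T -> R -> M)
    (e : T -> chart R n M -> R -> 'M[R]_n),
  (\forall m \near F,
    framed nabla (seg 0 a) (sig m) (fun c t => p m t *m e m c t) (e m)) /\
  forall t, seg 0 a t -> joint_cvg F (seg 0 a) sig (s t) t /\
    forall c, atlas c -> chart_dom c (s t) ->
      joint_cvg F (seg 0 a) (fun m => e m c) (E c t) t.

Lemma solved_upto0 : solved_upto 0.
Proof.
exists (fun _ _ => s 0), (fun _ c _ => E c 0).
have I0 : I 0 by rewrite unitI_seg /seg /= lexx ler01.
split.
  near=> m => t t00; split=> [|c ac cs]; first exact: cvg_cst.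
  split; [exact: has_deriv_singleton|exact: has_deriv_singleton|move=> c' ac' c's].
  by have [_ /(_ c ac cs)[_ _ /(_ c' ac' c's)]] := Ef I0.
by move=> t /seg_eq ->; split=> [|c _ _]; exact: cvg_cst.
Unshelve. all: by end_near. Qed.

(** In a chart around [s t], solve the frame equations from the values reached
    at [a].  These converge to the values of [s] and [E] at [a], hence the
    solutions stay in the chart and converge by [ode_close]. *)
Lemma solved_upto_step t : I t -> exists2 d : R, 0 < d &
  forall a b, 0 <= a <= t -> t <= b <= 1 -> t - d < a -> b < t + d ->
    solved_upto a -> solved_upto b.
Proof.
move=> It; pose c0 := chart_at (s t); have ac0 := chart_at_atlas (s t).
have cd0 := chart_at_dom (s t).
pose z r := (c0 (s r), E c0 r).
have zD r : I r -> chart_dom c0 (s r) -> has_deriv I z r (frame_rhs c0 (u r, z r)).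
  move=> Ir cr; have [_ /(_ c0 ac0 cr)[H1 H2 _]] := Ef Ir.
  by rewrite /frame_rhs /= uE //; exact: has_deriv_pair.
have cx0 : chart_img c0 (c0 (s t)) by exact: chart_img_fun.
have Fl : loc_lipschitz (frame_rhs c0) (u t, z t) by exact: loc_lipschitz_frame_rhs.
have [eta0 eta0_gt0 Himg] : exists2 r : R, 0 < r &
    forall x : 'rV[R]_n, `|x - c0 (s t)| < r -> chart_img c0 x.
  have : nbhs (c0 (s t)) (chart_img c0).
    by apply: open_nbhs_nbhs; split=> //; exact: chart_img_open.
  move=> /nbhs_ballP[r /= r0 rP]; exists r => // x xr; apply: rP.
  by rewrite -ball_normE /ball_ /= distrC.
have [d2 d20 Hclose] := ode_close Fl.
pose eta := Num.min (eta0 / 2) (d2 / 2).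
have eta_gt0 : 0 < eta by rewrite lt_min !divr_gt0.
have eta_lt0 : eta < eta0.
  rewrite (@le_lt_trans _ _ (eta0 / 2)) ?ge_min ?lexx //.
  by rewrite ltr_pdivrMr // ltr_pMr // ltr1n.
have eta_lt2 : eta < d2.
  rewrite (@le_lt_trans _ _ (d2 / 2)) ?ge_min ?lexx ?orbT //.
  by rewrite ltr_pdivrMr // ltr_pMr // ltr1n.
have HV := picard_space_prod (picard_space_mx R 1 n) (picard_space_mx R n n).
have [d1 d10 Hode] := ode_exists Fl HV eta_gt0.
pose d := Num.min d1 d2; have d0 : 0 < d by rewrite lt_min d10.
have dd1 : d <= d1 by rewrite ge_min lexx.
have dd2 : d <= d2 by rewrite ge_min lexx orbT.
have dh0 : 0 < d / 2 by rewrite divr_gt0.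
have [sc _] := Ef It.
have Hnear : \forall r \near t, I r -> [/\ chart_dom c0 (s r),
    `|z r - z t| < d / 2 & `|u r - u t| < d / 2].
  have H1 := near_chart sc cd0.
  have /cont_withinP /(_ _ dh0) H2 := has_deriv_cont_within (zD t It cd0).
  have /cont_withinP /(_ _ dh0) H3 := uc It.
  apply: filterS3 H1 H2 H3 => r + + + Ir.
  by move=> /(_ Ir) ? /(_ Ir) ? /(_ Ir) ?.
have /nbhs_ballP[del /= del0 Hdel] := Hnear.
exists (Num.min del (d / 2)); first by rewrite lt_min del0.
move=> a b /andP[a0 at_] /andP[tb b1] Ha Hb [sig [e [sol conv]]].
have ab : a <= b by exact: le_trans tb.
have sub : seg a b `<=` I by rewrite unitI_seg; apply: sub_seg.
have Hab r : seg a b r -> [/\ chart_dom c0 (s r),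
    `|z r - z t| < d / 2 & `|u r - u t| < d / 2].
  move=> abr; have /andP[ar rb] := abr; apply: Hdel; last exact: sub.
  rewrite -ball_normE /ball_ /= ltr_distlC; apply/andP; split.
    apply: le_lt_trans (lt_le_trans Ha ar).
    by rewrite lerD2l lerN2 ge_min lexx.
  apply: le_lt_trans rb (lt_le_trans Hb _).
  by rewrite lerD2l ge_min lexx.
have bad : b - a < d.
  have : Num.min del (d / 2) <= d / 2 by rewrite ge_min lexx orbT.
  by move: Ha Hb; move: (Num.min _ _) => m; lra.
have saa : seg 0 a a by rewrite /seg /= a0 lexx.
have aba : seg a b a by exact: seg_l.
have [ca za ua] := Hab a aba.
have [sig_a e_a] := conv a saa.
pose za_ m := (c0 (sig m a), e m c0 a).
have za_cvg : za_ m @[m --> F] --> z a.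
  have H1 : c0 (sig m a) @[m --> F] --> c0 (s a).
    exact: cvg_comp (joint_cvg_point saa sig_a) (chart_cvg ca).
  exact: (cvg_pair H1 (joint_cvg_point saa (e_a c0 ac0 ca))).
have dom_a : \forall m \near F, chart_dom c0 (sig m a).
  have oc : \forall q \near s a, chart_dom c0 q.
    by apply: open_nbhs_nbhs; split=> //; exact: chart_dom_open.
  exact: (joint_cvg_point saa sig_a) oc.
have za_near : \forall m \near F, `|za_ m - z t| < d.
  have /cvgrPdist_lt /(_ _ dh0) := za_cvg; apply: filterS => m Hm.
  rewrite -(subrK (z a) (za_ m)) -addrA (le_lt_trans (ler_normD _ _)) //.
  by rewrite [d]splitr distrC; apply: ltrD.
have p_near : \forall m \near F, forall r, seg a b r -> `|p m r - u t| < d.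
  apply: filterS (pu dh0) => m Hm r abr; have [_ _ ur] := Hab r abr.
  rewrite -(subrK (u r) (p m r)) -addrA (le_lt_trans (ler_normD _ _)) //.
  by rewrite [d]splitr; apply: ler_ltD => //; exact: Hm (sub _ abr).
pose good m := [/\ chart_dom c0 (sig m a), `|za_ m - z t| < d &
  forall r, seg a b r -> `|p m r - u t| < d].
have goodn : \forall m \near F, good m.
  by apply: filterS3 dom_a za_near p_near => m.
have /choice[zs zsP] : forall m, exists zm : R -> 'rV[R]_n * 'M[R]_n, good m ->
    zm a = za_ m /\ forall r, seg a b r -> `|zm r - z t| <= eta /\
      has_deriv (seg a b) zm r (frame_rhs c0 (p m r, zm r)).
  move=> m; have [[gm1 gm2 gm3]|] := pselect (good m); last by exists (fun=> z t).
  have [||zm zma zmP] := Hode a b (p m) (za_ m) ab (lt_le_trans bad dd1).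
  - move=> r abr; split; first exact: cont_within_subset sub (@pc m _ (sub _ abr)).
    exact: lt_le_trans (gm3 r abr) dd1.
  - exact: lt_le_trans gm2 dd1.
  by exists zm.
have zs_close (k : R) : 0 < k -> \forall m \near F, forall r, seg a b r ->
    `|zs m r - z r| <= k.
  move=> k0; have k3 : 0 < k / 3 by rewrite divr_gt0.
  have /cvgrPdist_lt /(_ _ k3) za_k := za_cvg.
  apply: filterS3 goodn za_k (pu k3) => m gm zak puk r abr.
  have [zsa zsD] := zsP m gm; have [gm1 gm2 gm3] := gm.
  have := Hclose a b (p m) u (zs m) z (k / 3) ab (lt_le_trans bad dd2) (ltW k3).
  move=> /(_ _ _ _ r abr) => H.
  apply: le_trans (H _ _ _) _.
  - move=> q abq; have [_ _ uq] := Hab q abq; split.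
    + exact: lt_le_trans (gm3 q abq) dd2.
    + apply: lt_le_trans uq (le_trans _ dd2).
      by rewrite ler_pdivrMr // ler_pMr // ler1n.
    + exact: puk (sub _ abq).
  - move=> q abq; have [zq qD] := zsD q abq; split=> //.
    exact: le_lt_trans zq eta_lt2.
  - move=> q abq; have [cq zq _] := Hab q abq; split.
      apply: lt_le_trans zq (le_trans _ dd2).
      by rewrite ler_pdivrMr // ler_pMr // ler1n.
    exact: has_deriv_subset sub (zD q (sub _ abq) cq).
  rewrite zsa distrC; move: zak; move: (`|z a - za_ m|) => q Hq.
  by move: k0; lra.
have zs_cvg r : seg a b r -> joint_cvg F (seg a b) zs (z r) r.
  move=> abr; have [cr _ _] := Hab r abr.
  apply: joint_cvg_uniform zs_close.
  exact: cont_within_subset sub (has_deriv_cont_within (zD r (sub _ abr) cr)).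
have zs_img m r : good m -> seg a b r -> chart_img c0 (zs m r).1.
  move=> gm abr; have [_ /(_ r abr)[zr _]] := zsP m gm.
  apply: Himg; apply: le_lt_trans eta_lt0; apply: le_trans zr.
  by rewrite [leRHS]/Num.norm /= le_max lexx.
pose sig2 m r := chart_inv c0 (zs m r).1.
pose e2 m c r := (zs m r).2 *m jac c0 c (zs m r).1.
have fr2 m : good m ->
    framed nabla (seg a b) (sig2 m) (fun c r => p m r *m e2 m c r) (e2 m).
  move=> gm; have [zsa zsD] := zsP m gm.
  have := @framed_of_chart _ _ _ nabla (seg a b) c0 (fst \o zs m)
    (fun r => p m r *m (zs m r).2) (snd \o zs m) ac0.
  have H : forall q, seg a b q -> [/\ chart_img c0 ((fst \o zs m) q),
      has_deriv (seg a b) (fst \o zs m) q (p m q *m (zs m q).2) &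
      has_deriv (seg a b) (snd \o zs m) q (- ((snd \o zs m) q *m
        Omega nabla c0 ((fst \o zs m) q) (p m q *m (zs m q).2)))].
    move=> q abq; have [_ qD] := zsD q abq; split; first exact: zs_img.
      exact: (has_deriv_lin (@bounded_linear_fst _ _ _) qD).
    exact: (has_deriv_lin (@bounded_linear_snd _ _ _) qD).
  move=> /(_ H); apply: framed_eq => // q c abq ac _; split=> //.
  by rewrite /e2 mulmxA.
have agree_s m : good m -> sig m a = sig2 m a.
  move=> gm; have [zsa _] := zsP m gm; have [gm1 _ _] := gm.
  by rewrite /sig2 zsa /za_ /= chart_funK.
have agree_e m c : good m -> framed nabla (seg 0 a) (sig m)
    (fun c t => p m t *m e m c t) (e m) -> atlas c -> chart_dom c (sig m a) ->
    e m c a = e2 m c a.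
  move=> gm fm ac cs; have [zsa _] := zsP m gm; have [gm1 _ _] := gm.
  rewrite /e2 zsa /za_ /=.
  by have [_ /(_ c0 ac0 gm1)[_ _ /(_ c ac cs)]] := fm a saa.
exists (fun m => glue a (sig m) (sig2 m)), (fun m c => glue a (e m c) (e2 m c)).
split.
  apply: filterS2 goodn sol => m gm fm.
  have agr c : atlas c -> chart_dom c (sig m a) ->
      p m a *m e m c a = p m a *m e2 m c a /\ e m c a = e2 m c a.
    by move=> ac cs; rewrite (agree_e m c).
  apply: framed_eq (framed_glue a0 ab fm (fr2 m gm) (agree_s m gm) agr) => //.
  by move=> r c br ac _; split=> //; rewrite /glue; case: ifP.
move=> r r0b; rewrite (segU a0 ab); split.
  apply: joint_cvg_union; [exact: seg_closed|exact: seg_closed| |] => Hr.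
    have [H _] := conv r Hr; apply: joint_cvg_eq_all H.
    by near=> m => q Hq; rewrite (glue_l _ _ Hq).
  apply: (@joint_cvg_eq_all _ _ _ _ _ _ sig2).
    apply: filterS goodn => m gm q Hq.
    by rewrite (glue_r (agree_s m gm) Hq).
  have [cr _ _] := Hab r Hr; rewrite -(chart_funK cr).
  apply: cvg_comp (chart_inv_cvg (chart_img_fun cr)).
  exact: (cvg_bounded_linear (@bounded_linear_fst _ _ _) (zs_cvg r Hr)).
move=> c ac cs; apply: joint_cvg_union; [exact: seg_closed|exact: seg_closed| |] => Hr.
  have [_ /(_ c ac cs) H] := conv r Hr; apply: joint_cvg_eq_all H.
  by near=> m => q Hq; rewrite (glue_l _ _ Hq).
have [cr _ _] := Hab r Hr.
have e2_cvg : joint_cvg F (seg a b) (fun m => e2 m c) (E c r) r.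
  have -> : E c r = (z r).2 *m jac c0 c (z r).1.
    by have [_ /(_ c0 ac0 cr)[_ _ /(_ c ac cs)]] := Ef (sub _ Hr).
  apply: cvg_bounded_bilinear; first exact: bounded_bilinear_mulmx.
    exact: (cvg_bounded_linear (@bounded_linear_snd _ _ _) (zs_cvg r Hr)).
  apply: cvg_comp (jac_cvg ac0 ac (overlap_fun cr cs)).
  exact: (cvg_bounded_linear (@bounded_linear_fst _ _ _) (zs_cvg r Hr)).
(* The two frames agree in [c] at [a] only for those [m] whose curve lies in the
   domain of [c] at that time: for large [m] when [r = a], while for [r > a] the
   time [a] does not matter. *)
have [/eqP ra|ra] := boolP (r == a); last first.
  have ar : a < r by rewrite lt_neqAle eq_sym ra; case/andP: Hr.
  apply: joint_cvg_eq e2_cvg.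
  have : \forall q \near r, seg a b q -> a < q.
    by near=> q => _; near: q; exact: lt_nbhsr.
  move=> /(@prod_within_snd _ _ F _ (seg a b) r (fun q => a < q)).
  by apply: filterS => -[m q] /= aq; rewrite /glue leNgt aq.
apply: joint_cvg_eq_all e2_cvg.
have csa : \forall m \near F, chart_dom c (sig m a).
  have oc : \forall q \near s a, chart_dom c q.
    by rewrite -ra; apply: open_nbhs_nbhs; split=> //; exact: chart_dom_open.
  exact: (joint_cvg_point saa sig_a) oc.
apply: filterS3 goodn sol csa => m gm fm cm q Hq.
by rewrite (glue_r (agree_e m c gm fm ac cm) Hq).
Unshelve. all: by end_near. Qed.

(** [u] are the coefficients of the velocity of [s] in the parallel frame [E],
    and the coefficients [p] tend to [u] uniformly: the solutions for [p] with
    the initial values of [s] and [E] exist on the whole interval and converge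
    to [s] and [E]. *)
Lemma perturbation : exists (sig : T -> R -> M)
    (e : T -> chart R n M -> R -> 'M[R]_n),
  (\forall m \near F,
    framed nabla I (sig m) (fun c t => p m t *m e m c t) (e m)) /\
  forall t, I t -> joint_cvg F I sig (s t) t /\
    forall c, atlas c -> chart_dom c (s t) ->
      joint_cvg F I (fun m => e m c) (E c t) t.
Proof.
rewrite unitI_seg; apply: (@interval_induction R 0 1 solved_upto ler01).
  exact: solved_upto0.
by move=> t t01; apply: solved_upto_step; rewrite unitI_seg.
Qed.

End Perturbation.

(** * Polynomial coefficients *)

Section RowPolynomials.
Variables (R : realType) (n : nat).
Implicit Types (P : 'I_n -> {poly R}) (A : set R) (t : R).

Definition row_poly P t : 'rV[R]_n := \row_i (P i).[t].

Definition row_deriv P : 'I_n -> {poly R} := fun i => (P i)^`().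

Lemma has_deriv_poly A (q : {poly R}) t : has_deriv A (horner q) t q^`().[t].
Proof.
elim/poly_ind: q => [|q c IH].
  have -> : horner (0 : {poly R}) = fun=> 0 by apply/funext => s; rewrite horner0.
  by rewrite deriv0 horner0; exact: has_deriv_cst.
have -> : horner (q * 'X + c%:P) = fun s => q.[s] *: (s : R^o) + c.
  by apply/funext => s; rewrite hornerD hornerMX hornerC.
rewrite derivD derivM derivX derivC addr0 mulr1 hornerD hornerMX.
rewrite -[_ + _]addr0; apply: has_derivD; last exact: has_deriv_cst.
have := has_deriv_bilin (bounded_bilinear_scale R^o) IH (has_deriv_id A t).
by rewrite /GRing.scale /= mulr1.
Qed.

Lemma has_deriv_row_poly A P t :
  has_deriv A (row_poly P) t (row_poly (row_deriv P) t).
Proof.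
apply: has_deriv_mx => i j; rewrite mxE.
have -> : (fun s => row_poly P s i j) = horner (P j).
  by apply/funext => s; rewrite mxE.
exact: has_deriv_poly.
Qed.

Lemma jointC_row_poly (T : Type) (F : set_system T) (o : T) {FF : Filter F}
    (Fo : forall X : set T, F X -> X o) j P t : unitI t ->
  jointC F o j (fun _ => row_poly P) t.
Proof.
move=> It; have C0 Q : jointC0 F o (fun _ => row_poly Q) t.
  move=> X HX; have HX' : \forall s \near t, (@unitI R) s -> X (row_poly Q s).
    exact: (has_deriv_cont_within (has_deriv_row_poly (@unitI R) Q t)).
  exact: joint_snd HX'.
elim: j P => [|j IH] P; first exact: C0.
apply: (jointC_intro Fo It (C0 P)) (IH (row_deriv P)).
by near=> z; exact: has_deriv_row_poly.
Unshelve. all: by end_near. Qed.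

End RowPolynomials.

Section SolutionRegularity.
Variables (R : realType) (n : nat) (M : manifold R n) (nabla : connection M).
Implicit Types (c : chart R n M) (t : R).
Local Notation I := (@unitI R).

(** The equation expresses the derivative of the frame by the frame itself, so
    that each class of regularity gives the next one. *)
Lemma jointC_parallel (T : Type) (F : set_system T) (o : T) {FF : Filter F}
    (Fo : forall X : set T, F X -> X o) j c (x w : T -> R -> 'rV[R]_n)
    (e : T -> R -> 'M[R]_n) t : I t -> atlas c -> chart_img c (x o t) ->
  jointC F o j x t -> jointC F o j w t -> jointC0 F o e t ->
  (\forall z \near joint F t, has_deriv I (e z.1) z.2
     (- (e z.1 z.2 *m Omega nabla c (x z.1 z.2) (w z.1 z.2)))) ->
  jointC F o j.+1 e t.
Proof.
move=> It ac cx + + e0 eD.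
have base i : jointC F o i x t -> jointC F o i w t -> jointC F o i e t ->
    jointC F o i.+1 e t.
  move=> xi wi ei.
  apply: (jointC_intro Fo It e0 (g := fun l s =>
    - (e l s *m Omega nabla c (x l s) (w l s)))) => //.
  have -> : (fun l s => - (e l s *m Omega nabla c (x l s) (w l s))) =
      (fun l s => -1 *: (e l s *m Omega nabla c (x l s) (w l s))).
    by apply/funext => l; apply/funext => s; rewrite scaleN1r.
  apply: (@jointC_lin _ _ _ _ _ Fo i _ _ (fun v => -1 *: v)) => //.
    exact: bounded_bilinearr (bounded_bilinear_scale _).
  apply: jointC_bilin => //; first exact: bounded_bilinear_mulmx.
  exact: jointC_Omega.
elim: j => [|j IH] xC wC; first exact: base.
by apply: base => //; apply: IH; exact: jointC_S.
Qed.

(** Each differentiation of the frame equations trades one derivative of the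
    coefficients [p] for one derivative of the solution. *)
Lemma jointC_frame_equation (T : Type) (F : set_system T) (o : T) {FF : Filter F}
    (Fo : forall X : set T, F X -> X o) j c (x p : T -> R -> 'rV[R]_n)
    (e : T -> R -> 'M[R]_n) t : I t -> atlas c -> chart_img c (x o t) ->
  jointC F o j p t -> jointC0 F o x t -> jointC0 F o e t ->
  (\forall z \near joint F t,
     has_deriv I (x z.1) z.2 (p z.1 z.2 *m e z.1 z.2) /\
     has_deriv I (e z.1) z.2
       (- (e z.1 z.2 *m Omega nabla c (x z.1 z.2) (p z.1 z.2 *m e z.1 z.2)))) ->
  jointC F o j.+1 x t /\ jointC F o j.+1 e t.
Proof.
move=> It ac cx pC x0 e0 xe.
have base i : jointC F o i p t -> jointC F o i x t -> jointC F o i e t ->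
    jointC F o i.+1 x t /\ jointC F o i.+1 e t.
  move=> pi xi ei.
  have wi : jointC F o i (fun l s => p l s *m e l s) t.
    by apply: jointC_bilin => //; exact: bounded_bilinear_mulmx.
  split.
    by apply: (jointC_intro Fo It x0) wi; apply: filterS xe => z [].
  apply: (jointC_parallel Fo It ac cx xi wi e0); by apply: filterS xe => z [].
elim: j pC => [|j IH] pC; first exact: base.
by have [] := IH (jointC_S pC); exact: base.
Qed.

(** The one-element family: [jointC] then is the regularity of a single curve. *)
Definition one_filter : set_system unit := globally [set tt].

Global Instance one_filter_filter : Filter one_filter.
Proof. exact: globally_filter. Qed.

Lemma one_filterP (X : set unit) : one_filter X -> X tt.
Proof. by apply. Qed.

Lemma joint_one t (P : set (unit * R)) : joint one_filter t P ->
  \forall s \near t, I s -> P (tt, s).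
Proof.
move=> [[A B] /= [FA nB] AB].
have : \forall s \near t, I s -> B s := nB.
by apply: filterS => s Bs Is; apply: AB; split=> /=; [exact: FA|exact: Bs].
Qed.

Definition regular k (V : normedModType R) (f : R -> V) t :=
  jointC one_filter tt k (fun _ => f) t.

Lemma regular_cont_within k (V : normedModType R) (f : R -> V) t :
  regular k f t -> cont_within I f t.
Proof.
move=> fr X Xt; have H := jointC_jointC0 fr; exact: (joint_one (H X Xt)).
Qed.

Lemma cont_within_joint (T : Type) (F : set_system T) {FF : Filter F}
    (X : topologicalType) (f : R -> X) t : cont_within I f t ->
  f z.2 @[z --> joint F t] --> f t.
Proof.
move=> fc Y Yt; have HY : \forall s \near t, I s -> Y (f s) := fc Y Yt.
exact: joint_snd HY.
Qed.

Lemma is_Ck_curve_cont_within k (s : R -> M) t : is_Ck_curve k s -> I t -> cont_within I s t.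
Proof. by move=> [/subspace_continuousP sc _] It; exact: sc. Qed.

Lemma is_Ck_curve_cont_derivnI k (s : R -> M) c t j : is_Ck_curve k s ->
  atlas c -> I t -> chart_dom c (s t) -> (j <= k)%N ->
  cont_within I (derivnI j (c \o s)) t.
Proof.
move=> [sc sC] ac It cs; have [sD sk] := sC c t ac It cs.
rewrite leq_eqVlt => /orP[/eqP -> //|jk].
exact: has_deriv_cont_within (derivableI_has_deriv (sD j jk)).
Qed.

Lemma is_Ck_curve_regular k (s : R -> M) c t : is_Ck_curve k s ->
  atlas c -> I t -> chart_dom c (s t) -> regular k (c \o s) t.
Proof.
move=> sC ac It cs; apply: jointC_of_derivnI => j jk.
  exact: (cont_within_joint (is_Ck_curve_cont_derivnI sC ac It cs jk)).
have nc := near_chart (is_Ck_curve_cont_within sC It) cs.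
have H1 := joint_snd (FF := one_filter_filter) nc.
have H2 := joint_I (FF := one_filter_filter) t; move: H1 H2.
apply: filterS2 => -[_ r] /= cr Ir.
by have [_ /(_ c r ac Ir cr)[H _]] := sC; exact: H.
Qed.

Lemma regular_is_Ck_curve k (s : R -> M) :
  (forall t, I t -> cont_within I s t) ->
  (forall c t, atlas c -> I t -> chart_dom c (s t) -> regular k (c \o s) t) ->
  is_Ck_curve k s.
Proof.
move=> sc sr; split; first exact/subspace_continuousP.
move=> c t ac It cs; have [H1 H2] := jointC_derivnI (sr c t ac It cs); split.
  by move=> j jk; have /(joint_point (@one_filterP) It) := H2 j jk.
by move=> X Xt; have := joint_one (H1 k (leqnn k) X Xt).
Qed.

Lemma is_Ck_curve_C1 k (s : R -> M) : is_Ck_curve k.+1 s -> C1_curve s.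
Proof.
move=> sC t It; split=> [|c ac cs]; first exact: is_Ck_curve_cont_within sC It.
have [H H1 H2] := is_Ck_curve_regular sC ac It cs; split.
  exact: derivableI_has_deriv (joint_point (@one_filterP) It H1).
exact: regular_cont_within H2.
Qed.

Section PolynomialSolution.
Variables (s : R -> M) (P : 'I_n -> {poly R}) (e : chart R n M -> R -> 'M[R]_n).
Hypothesis sf : framed nabla I s (fun c t => row_poly P t *m e c t) e.

Lemma solution_near c t : I t -> atlas c -> chart_dom c (s t) ->
  \forall r \near t, I r -> [/\ chart_dom c (s r),
    has_deriv I (c \o s) r (row_poly P r *m e c r) &
    has_deriv I (e c) r (- (e c r *m Omega nabla c (c (s r)) (row_poly P r *m e c r)))].
Proof.
move=> It ac cs; have [sc _] := sf It.
apply: filterS (near_chart sc cs) => r + Ir => /(_ Ir) cr.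
by have [_ /(_ c ac cr)[]] := sf Ir.
Qed.

Lemma solution_regular k : is_Ck_curve k s.
Proof.
apply: regular_is_Ck_curve => [t It|c t ac It cs]; first by have [] := sf It.
have [sc /(_ c ac cs)[xD eD _]] := sf It.
have [] // := @jointC_frame_equation _ one_filter tt _ (@one_filterP) k c
  (fun _ => c \o s) (fun _ => row_poly P) (fun _ => e c) t It ac.
- exact: chart_img_fun.
- apply: jointC_row_poly => //; exact: one_filterP.
- exact: (cont_within_joint (has_deriv_cont_within xD)).
- exact: (cont_within_joint (has_deriv_cont_within eD)).
- have := joint_snd (FF := one_filter_filter) (solution_near It ac cs).
  by apply: filterS => -[_ r] /= [].
by move=> xr _; exact: jointC_S xr.
Qed.

(** The frame is parallel, so that covariant differentiation along the curve
    acts on the coefficients alone. *)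
Lemma iter_covariant_derivative m c t : atlas c -> I t -> chart_dom c (s t) ->
  iter m (covariant_derivative_along nabla s) (velocity s) c t =
  row_poly (iter m (@row_deriv R n) P) t *m e c t.
Proof.
elim: m c t => [|m IH] c t ac It cs.
  have [_ /(_ c ac cs)[xD _ _]] := sf It; exact: (has_deriv_derivI It xD).2.
rewrite iterS /covariant_derivative_along.
have [_ /(_ c ac cs)[xD eD _]] := sf It.
set Q := iter m _ P in IH *.
have VD : has_deriv I (iter m (covariant_derivative_along nabla s) (velocity s) c) t
    (row_poly (row_deriv Q) t *m e c t + row_poly Q t *m
      - (e c t *m Omega nabla c (c (s t)) (row_poly P t *m e c t))).
  apply: (@has_deriv_near _ _ _ (fun r => row_poly Q r *m e c r)) => //.
    apply: filterS (solution_near It ac cs) => r + Ir => /(_ Ir)[cr _ _].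
    by rewrite IH.
  apply: has_deriv_bilin eD; first exact: bounded_bilinear_mulmx.
  exact: has_deriv_row_poly.
have [_ ->] := has_deriv_derivI It VD.
have [_ vE] := has_deriv_derivI It xD; rewrite /velocity vE IH //.
rewrite -mul_Omega //; last exact: chart_img_fun.
by rewrite mulmxN mulmxA subrK.
Qed.

Lemma iter_row_deriv m : iter m (@row_deriv R n) P = fun i => (P i)^`(m).
Proof.
elim: m => [|m IH]; first by apply/funext => i; rewrite derivn0.
by rewrite iterS IH; apply/funext => i; rewrite /row_deriv derivnS.
Qed.

Lemma solution_polynomial_like : polynomial_like nabla s.
Proof.
pose m := (\max_(i < n) size (P i))%N; exists m; split.
  exact: solution_regular.
move=> c t ac It cs; rewrite iter_covariant_derivative // iter_row_deriv.
have -> : row_poly (fun i => (P i)^`(m)) t = 0; last by rewrite mul0mx.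
apply/rowP => i; rewrite !mxE derivn_poly0 ?horner0 //.
rewrite /m; exact: (@leq_bigmax _ (fun j => size (P j)) i).
Qed.

End PolynomialSolution.
End SolutionRegularity.

(** * Polynomial approximation of functions and their derivatives *)

Section Weierstrass.
Variable R : realType.
Implicit Types (t a b c e : R) (N : nat) (g h : nat -> R).
Local Notation I := (@unitI R).

(** The Bernstein polynomial with values [g 0, ..., g N], by Pascal's rule. *)
Fixpoint bernstein N g : {poly R} :=
  match N with
  | 0 => (g 0%N)%:P
  | N'.+1 => 'X * bernstein N' (g \o succn) + (1 - 'X) * bernstein N' g
  end.

Lemma bernsteinS N g t : (bernstein N.+1 g).[t] =
  t * (bernstein N (g \o succn)).[t] + (1 - t) * (bernstein N g).[t].
Proof. by rewrite /= !hornerE. Qed.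

Lemma bernstein_le N g h t : I t -> (forall k, (k <= N)%N -> g k <= h k) ->
  (bernstein N g).[t] <= (bernstein N h).[t].
Proof.
rewrite unitI_seg => /andP[t0 t1].
elim: N g h => [|N IH] g h gh; first by rewrite /= !hornerC gh.
rewrite !bernsteinS; apply: lerD; apply: ler_wpM2l => //.
- by apply: IH => k kN; exact: gh.
- by rewrite subr_ge0.
- by apply: IH => k kN; apply: gh; exact: leqW.
Qed.

Lemma bernsteinD N g h t : (bernstein N (fun k => g k + h k)).[t] =
  (bernstein N g).[t] + (bernstein N h).[t].
Proof.
elim: N g h => [|N IH] g h; first by rewrite /= !hornerC.
by rewrite !bernsteinS (IH (g \o succn) (h \o succn)) IH; ring.
Qed.

Lemma bernsteinZ N a g t : (bernstein N (fun k => a * g k)).[t] =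
  a * (bernstein N g).[t].
Proof.
elim: N g => [|N IH] g; first by rewrite /= !hornerC.
by rewrite !bernsteinS (IH (g \o succn)) IH; ring.
Qed.

Lemma bernstein_cst N c t : (bernstein N (fun=> c)).[t] = c.
Proof.
elim: N => [|N IH]; first by rewrite /= hornerC.
by rewrite bernsteinS (_ : (fun=> c) \o succn = fun=> c) // IH; ring.
Qed.

(** The second moment of the binomial distribution. *)
Lemma bernstein_sqr N c t : (bernstein N (fun k => (k%:R + c) ^+ 2)).[t] =
  (N%:R * t + c) ^+ 2 + N%:R * t * (1 - t).
Proof.
elim: N c => [|N IH] c; first by rewrite /= hornerC; ring.
rewrite bernsteinS IH.
have -> : (fun k => (k%:R + c) ^+ 2) \o succn = fun k => (k%:R + (c + 1)) ^+ 2.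
  by apply/funext => k /=; rewrite -natr1; ring.
by rewrite IH -natr1; ring.
Qed.

Lemma uniformly_continuous (f : R -> R) e : (forall t, I t -> cont_within I f t) ->
  0 < e -> exists2 d : R, 0 < d &
    forall s r, I s -> I r -> `|s - r| < d -> `|f s - f r| < e.
Proof.
move=> fc e0; rewrite unitI_seg in fc *.
pose P x := exists2 d : R, 0 < d &
  forall s r, seg 0 x s -> seg 0 x r -> `|s - r| < d -> `|f s - f r| < e.
suff : P 1 by [].
apply: (@interval_induction R 0 1 P ler01).
  exists 1 => // s r s0 r0 _.
  by rewrite (seg_eq s0) (seg_eq r0) subrr normr0.
move=> t t01; have /cont_withinP /(_ (e / 2)) := fc t t01.
rewrite divr_gt0 // => /(_ isT) /nbhs_ballP[d /= d0 dP].
have {}dP q : seg 0 1 q -> `|q - t| < d -> `|f q - f t| < e / 2.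
  by move=> q01 qt; apply: dP; rewrite // -ball_normE /ball_ /= distrC.
have d2 : 0 < d / 2 by rewrite divr_gt0.
exists (d / 2) => // a b /andP[a0 at_] /andP[tb b1] ta bt [d' d'0 Pa].
exists (Num.min d' (d / 2)); first by rewrite lt_min d'0.
suff H s r : seg 0 b s -> seg 0 b r -> s <= r ->
    `|s - r| < Num.min d' (d / 2) -> `|f s - f r| < e.
  move=> s r sb rb; have [sr|/ltW rs] := leP s r; first exact: H.
  by rewrite distrC (distrC (f s)); exact: H.
move=> /andP[s0 sb] /andP[r0 rb] sr; rewrite lt_min => /andP[sr1 sr2].
have [ra|ra] := leP r a.
  by apply: Pa => //; apply/andP; split=> //; exact: le_trans ra.
rewrite ler0_norm ?subr_le0 // in sr2.
have -> : f s - f r = (f s - f t) - (f r - f t) by rewrite opprB addrA subrK.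
apply: le_lt_trans (ler_normB _ _) _; rewrite [e]splitr; apply: ltrD; apply: dP.
- by apply/andP; split=> //; exact: le_trans b1.
- by rewrite ltr_distlC; apply/andP; split; lra.
- by apply/andP; split=> //; exact: le_trans b1.
- by rewrite ltr_distlC; apply/andP; split; lra.
Qed.

Lemma bounded_on_unitI (f : R -> R) : (forall t, I t -> cont_within I f t) ->
  exists2 C : R, 0 < C & forall t, I t -> `|f t| <= C.
Proof.
move=> fc; have [|c c01 cM] := @EVT_max R (fun t => `|f t|) 0 1 ler01.
  by apply/subspace_continuousP => t t01; apply: cvg_norm; exact: fc.
exists (`|f c| + 1) => [|t t01]; first by rewrite ltr_wpDl.
by apply: le_trans (cM t t01) _; rewrite lerDl.
Qed.

(** Chebyshev's argument: [q] bounds the distance of the values [g k] to [f t]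
    by the modulus of continuity of [f] when [k / N] is near [t], and by a
    multiple of [(k / N - t) ^+ 2] otherwise. *)
Lemma weierstrass (f : R -> R) e : (forall t, I t -> cont_within I f t) -> 0 < e ->
  exists P : {poly R}, forall t, I t -> `|P.[t] - f t| <= e.
Proof.
move=> fc e0; have e2 : 0 < e / 2 by rewrite divr_gt0.
have [d d0 fd] := uniformly_continuous fc e2.
have [C C0 fC] := bounded_on_unitI fc.
pose K := 2 * C / d ^+ 2; have K0 : 0 < K by rewrite !divr_gt0 ?mulr_gt0 ?exprn_gt0.
pose N := (Num.truncn (K / (e / 2))).+1.
have N0 : 0 < N%:R :> R by rewrite ltr0n.
have KN : K / N%:R <= e / 2.
  rewrite ler_pdivrMr // mulrC -ler_pdivrMr //.
  have /andP[_ /ltW //] := Num.Theory.truncn_itv (ltW (divr_gt0 K0 e2)).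
pose g (k : nat) := f (k%:R / N%:R).
exists (bernstein N g) => t It; have := It; rewrite unitI_seg => /andP[t0 t1].
pose q (k : nat) : R := e / 2 + K / N%:R ^+ 2 * (k%:R + - (N%:R * t)) ^+ 2.
have gq k : (k <= N)%N -> `|g k - f t| <= q k.
  move=> kN; have Ik : I (k%:R / N%:R).
    rewrite unitI_seg; apply/andP; rewrite divr_ge0 //; split=> //.
    by rewrite ler_pdivrMr // mul1r ler_nat.
  have sqE : K / N%:R ^+ 2 * (k%:R + - (N%:R * t)) ^+ 2 = K * (k%:R / N%:R - t) ^+ 2.
    by field; rewrite gt_eqF.
  rewrite /q sqE; have [kd|kd] := ltP `|k%:R / N%:R - t| d.
    apply: le_trans (ltW (fd _ _ Ik It kd)) _.
    by rewrite lerDl mulr_ge0 ?sqr_ge0 // ltW.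
  have H : `|g k - f t| <= 2 * C.
    apply: le_trans (ler_normB _ _) _; rewrite mulr_natl mulr2n.
    by apply: lerD; exact: fC.
  apply: le_trans H _; apply: le_trans (_ : K * (k%:R / N%:R - t) ^+ 2 <= _).
    rewrite -[leLHS](@divfK _ (d ^+ 2)) ?gt_eqF ?exprn_gt0 // ler_pM2l //.
    by rewrite -[leRHS]real_normK ?num_real // lerXn2r // ?nnegrE // ltW.
  by rewrite lerDr ltW.
have qt : (bernstein N q).[t] <= e.
  rewrite /q bernsteinD bernstein_cst bernsteinZ bernstein_sqr addrN expr0n add0r.
  rewrite [leRHS]splitr lerD2l; apply: le_trans KN.
  have -> : K / N%:R ^+ 2 * (N%:R * t * (1 - t)) = K / N%:R * (t * (1 - t)).
    by field; rewrite gt_eqF.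
  have KN0 : 0 <= K / N%:R by rewrite divr_ge0 // ltW.
  have tt : t * (1 - t) <= 1 by nra.
  by rewrite -[leRHS]mulr1 ler_wpM2l.
rewrite -[f t](bernstein_cst N _ t) -mulN1r -bernsteinZ -bernsteinD.
have lo k : (k <= N)%N -> -1 * q k <= g k + -1 * f t.
  by move=> /gq; rewrite ler_norml !mulN1r => /andP[].
have hi k : (k <= N)%N -> g k + -1 * f t <= q k.
  by move=> /gq; rewrite ler_norml !mulN1r => /andP[].
rewrite ler_norml; apply/andP; split; last exact: le_trans (bernstein_le It hi) qt.
apply: le_trans (bernstein_le It lo).
by rewrite bernsteinZ mulN1r lerN2.
Qed.

Lemma poly_primitive (Q : {poly R}) : exists2 P : {poly R}, P^`() = Q & P.[0] = 0.
Proof.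
exists (\poly_(i < (size Q).+1) (Q`_i.-1 / i%:R)); last first.
  by rewrite horner_coef0 coef_poly /= invr0 mulr0.
apply/polyP => i; rewrite coef_deriv coef_poly /= ltnS.
case: ltnP => [_|iQ]; last by rewrite mul0rn nth_default.
by rewrite -[_ *+ _]mulr_natr divfK // pnatr_eq0.
Qed.

(** Approximate the highest derivative and integrate. *)
Lemma poly_approx_derivatives K (f : nat -> R -> R) e :
  (forall j t, (j < K)%N -> I t -> has_deriv I (f j) t (f j.+1 t)) ->
  (forall t, I t -> cont_within I (f K) t) -> 0 < e ->
  exists P : {poly R}, forall j t, (j <= K)%N -> I t ->
    `|(P^`(j)).[t] - f j t| <= e.
Proof.
move=> + + e0; elim: K f => [|K IH] f fD fc.
  have [P HP] := weierstrass fc e0.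
  by exists P => j t; rewrite leqn0 => /eqP -> It; rewrite derivn0; exact: HP.
have [|Q HQ] := IH (fun j => f j.+1) _ fc; first by move=> j t jK; exact: fD.
have [P PQ P0] := poly_primitive Q; exists (P + (f 0%N 0)%:P) => -[|j] t jK It.
  rewrite derivn0; have := It; rewrite unitI_seg => /andP[t0 t1].
  pose G s := (P + (f 0%N 0)%:P).[s] - f 0%N s.
  have G0 : G 0 = 0 by rewrite /G hornerD P0 hornerC add0r subrr.
  have sub : seg 0 t `<=` I by rewrite unitI_seg; exact: sub_seg.
  rewrite -/(G t) -[G t]subr0 -G0; apply: le_trans (_ : e * (t - 0) <= _).
    apply: (@mean_value_ineq _ _ _ _ _ (fun s => Q.[s] - f 1%N s)) => // s st.
      apply: has_derivB; last by apply: (has_deriv_subset sub); apply: fD => //; exact: sub.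
      have := has_deriv_poly (seg 0 t) (P + (f 0%N 0)%:P) s.
      by rewrite derivD derivC addr0 PQ.
    by have := HQ 0%N s isT (sub s st); rewrite derivn0.
  by rewrite subr0 -[leRHS]mulr1 ler_pM2l.
by rewrite derivSn derivD derivC addr0 PQ; exact: HQ.
Qed.

End Weierstrass.

Section RowApproximation.
Variables (R : realType) (n : nat).
Local Notation I := (@unitI R).

Lemma derivnI_row_poly j (P : 'I_n -> {poly R}) t : I t ->
  derivnI j (row_poly P) t = row_poly (iter j (@row_deriv R n) P) t.
Proof.
elim: j t => [|j IH] t It //; rewrite /derivnI !iterS.
have H := has_deriv_row_poly I (iter j (@row_deriv R n) P) t.
suff /(has_deriv_derivI It)[_ //] : has_deriv I (derivnI j (row_poly P)) t
    (row_poly (row_deriv (iter j (@row_deriv R n) P)) t).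
by apply: has_deriv_near H => //; near=> s => Is; rewrite IH.
Unshelve. all: by end_near. Qed.

Lemma regular_derivnI k (V : normedModType R) (f : R -> V) j t :
  (forall t, I t -> regular k f t) -> I t ->
  ((j < k)%N -> has_deriv I (derivnI j f) t (derivnI j.+1 f t)) /\
  ((j <= k)%N -> cont_within I (derivnI j f) t).
Proof.
move=> fk It; have [H1 H2] := jointC_derivnI (fk t It); split=> jk.
  have := joint_point (@one_filterP) It (H2 j jk); exact: derivableI_has_deriv.
by move=> X Xt; have := joint_one (H1 j jk X Xt).
Qed.

Lemma row_poly_approx k (u : R -> 'rV[R]_n) (e : R) :
  (forall t, I t -> regular k u t) -> 0 < e ->
  exists P : 'I_n -> {poly R}, forall j t, (j <= k)%N -> I t ->
    `|derivnI j (row_poly P) t - derivnI j u t| <= e.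
Proof.
move=> uk e0.
have /choice[P HP] : forall i : 'I_n, exists Q : {poly R}, forall j t,
    (j <= k)%N -> I t -> `|(Q^`(j)).[t] - derivnI j u t 0 i| <= e.
  move=> i; apply: (@poly_approx_derivatives R k (fun j t => derivnI j u t 0 i)) => //.
    move=> j t jk It; have [/(_ jk) H _] := regular_derivnI j uk It.
    exact: (has_deriv_lin (bounded_linear_entry R 0 i) H).
  move=> t It; have [_ /(_ (leqnn k)) H] := regular_derivnI k uk It.
  exact: (cvg_bounded_linear (bounded_linear_entry R 0 i) H).
exists P => j t jk It; rewrite derivnI_row_poly //.
apply: mx_norm_leP => [|a i]; first exact: ltW.
rewrite ord1 !mxE iter_row_deriv; exact: HP.
Qed.

End RowApproximation.

(** * Approximation of curves of class C^k, k at least 1 *)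

Section SequenceFamilies.
Variable R : realType.
Local Notation I := (@unitI R).

(** A sequence and its limit as one family: the limit has index [0] and the
    sequence is shifted by one. *)
Definition limit_at0 : set_system nat :=
  [set P | P 0%N /\ \forall m \near \oo, P m.+1].

Global Instance limit_at0_filter : Filter limit_at0.
Proof.
split=> [|P Q [P0 Pm] [Q0 Qm]|P Q PQ [P0 Pm]].
- by split=> //; near=> m.
- by split; [split|apply: filterS2 Pm Qm].
- by split; [exact: PQ|apply: filterS Pm => m; exact: PQ].
Unshelve. all: by end_near. Qed.

Lemma limit_at0P (P : set nat) : limit_at0 P -> P 0%N.
Proof. by case. Qed.

Definition with_limit (X : Type) (f : nat -> X) (l : X) (m : nat) : X :=
  if m is m'.+1 then f m' else l.

Lemma joint_limit_at0 (t : R) (P : set (nat * R)) :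
  (\forall z \near filter_prod (\oo : set_system nat) (within I (nbhs t)),
     P (z.1.+1, z.2)) ->
  (\forall r \near t, I r -> P (0%N, r)) -> joint limit_at0 t P.
Proof.
move=> [[A B] /= [oA nB] AB] P0.
exists ([set m | if m is m'.+1 then A m' else True],
        B `&` [set r | P (0%N, r)]); last first.
  move=> [[|m] r] /= [Hm [Br Pr]] //.
  exact: (AB (m, r)).
split=> /=; first by split.
have HB : \forall r \near t, I r -> B r := nB.
have : \forall r \near t, I r -> B r /\ P (0%N, r).
  by apply: filterS2 HB P0 => r H1 H2 Ir; split; [exact: H1|exact: H2].
exact.
Qed.

Lemma with_limit_cvg (X : topologicalType) (f : nat -> R -> X) (g : R -> X) t :
  joint_cvg \oo I f (g t) t -> cont_within I g t ->
  with_limit f g z.1 z.2 @[z --> joint limit_at0 t] --> g t.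
Proof.
move=> fg gc P Pt; apply: joint_limit_at0; first exact: fg.
have : \forall r \near t, I r -> P (g r) := gc P Pt.
exact.
Qed.

End SequenceFamilies.

Section Approximation.
Variables (R : realType) (n : nat) (M : manifold R n) (nabla : connection M).
Implicit Types (c : chart R n M) (t : R).
Local Notation I := (@unitI R).

Section Neighborhoods.
Variables (T : Type) (F : set_system T) (o : T).
Context {FF : Filter F}.
Hypothesis Fo : forall P : set T, F P -> P o.

Definition Ck_family k (sig : T -> R -> M) := forall t, I t ->
  sig z.1 z.2 @[z --> joint F t] --> sig o t /\
  forall c, atlas c -> chart_dom c (sig o t) ->
    jointC F o k (fun m => c \o sig m) t.

(** Pointwise joint convergence becomes uniform on the compact set [K]. *)
Lemma Ck_family_near k (sig : T -> R -> M) (s : R -> M) c (K : set R) (e : R) :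
  Ck_family k sig -> is_Ck_curve k s -> atlas c -> compact K -> K `<=` I ->
  s @` K `<=` chart_dom c -> sig o @` K `<=` chart_dom c ->
  (forall j t, (j <= k)%N -> K t ->
     `|derivnI j (c \o sig o) t - derivnI j (c \o s) t| < e) ->
  \forall m \near F, sig m @` K `<=` chart_dom c /\
    forall j t, (j <= k)%N -> K t ->
      `|derivnI j (c \o sig m) t - derivnI j (c \o s) t| < e.
Proof.
move=> sigC sC ac /compact_near_coveringP cK KI sK oK close.
pose P m t := I t -> chart_dom c (sig m t) /\ forall j : 'I_k.+1,
  `|derivnI j (c \o sig m) t - derivnI j (c \o s) t| < e.
have : \forall m \near F, K `<=` P m; last first.
  apply: filterS => m KP; split.
    by move=> _ [t Kt <-]; have [] := KP t Kt (KI t Kt).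
  move=> j t jk Kt; have [_ H] := KP t Kt (KI t Kt).
  exact: (H (Ordinal (jk : (j < k.+1)%N))).
apply: cK => t Kt; have It := KI t Kt.
have ct : chart_dom c (s t) by apply: sK; exists t.
have co : chart_dom c (sig o t) by apply: oK; exists t.
have [sigc /(_ c ac co) jointCt] := sigC t It.
have dom : \forall z \near joint F t, chart_dom c (sig z.1 z.2).
  have oc : \forall q \near sig o t, chart_dom c q.
    by apply: open_nbhs_nbhs; split=> //; exact: chart_dom_open.
  exact: sigc oc.
have dist (j : 'I_k.+1) : \forall z \near joint F t,
    `|derivnI j (c \o sig z.1) z.2 - derivnI j (c \o s) z.2| < e.
  have jk : (j <= k)%N by rewrite -ltnS.
  have H1 := (jointC_derivnI (FF := FF) jointCt).1 j jk.
  have H2 := cont_within_joint (FF := FF) (is_Ck_curve_cont_derivnI sC ac It ct jk).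
  exact: cvgr_lt (cvg_norm (cvgB H1 H2)) _ (close j t jk Kt).
have all : \forall z \near joint F t, forall j : 'I_k.+1,
    `|derivnI j (c \o sig z.1) z.2 - derivnI j (c \o s) z.2| < e.
  exact: (@filter_forall _ 'I_k.+1 (fun j z =>
    `|derivnI j (c \o sig z.1) z.2 - derivnI j (c \o s) z.2| < e)).
have [[A B] /= [FA nB] AB] : joint F t (fun z => chart_dom c (sig z.1 z.2) /\
    forall j : 'I_k.+1,
    `|derivnI j (c \o sig z.1) z.2 - derivnI j (c \o s) z.2| < e).
  exact: filterI.
exists ([set r | I r -> B r], A) => /=; first by split.
by move=> [r m] /= [Br Am] Ir; apply: (AB (m, r)); split=> //; exact: Br.
Qed.

End Neighborhoods.


(** The coefficients [u] of the velocity in a parallel frame are of class [C^k];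
    take the solutions for polynomials tending to [u] in [C^k]. *)
Lemma Ck_approximation k (s : R -> M) : is_Ck_curve k.+1 s ->
  exists sig : nat -> R -> M,
    (\forall m \near \oo, (forall j, is_Ck_curve j (sig m)) /\
       polynomial_like nabla (sig m)) /\
    Ck_family limit_at0 0%N k.+1 (with_limit sig s).
Proof.
move=> sC; have sC1 := is_Ck_curve_C1 sC.
have [E [Ef Eu]] := parallel_frame_exists nabla sC1.
pose u t := velocity s (chart_at (s t)) t *m invmx (E (chart_at (s t)) t).
have uE t c : I t -> atlas c -> chart_dom c (s t) -> u t *m E c t = velocity s c t.
  move=> It ac cs; pose c0 := chart_at (s t).
  have ac0 : atlas c0 by exact: chart_at_atlas.
  have c0s : chart_dom c0 (s t) by exact: chart_at_dom.
  have [_ /(_ c0 ac0 c0s)[_ _ /(_ c ac cs) ->]] := Ef t It.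
  rewrite mulmxA /u -/c0 mulmxKV; last exact: Eu.
  by apply/esym; exact: velocity_jac.
have ur t : I t -> regular k u t.
  move=> It; pose c := chart_at (s t).
  have ac : atlas c by exact: chart_at_atlas.
  have cs : chart_dom c (s t) by exact: chart_at_dom.
  have [sct /(_ c ac cs)[xD eD _]] := Ef t It.
  have nc := near_chart sct cs.
  have xr := is_Ck_curve_regular sC ac It cs.
  have [_ _ wr] := xr.
  have er : regular k (E c) t.
    apply: jointC_S; apply: (@jointC_parallel _ _ _ nabla _ one_filter tt _
      (@one_filterP) k c (fun _ => c \o s) (fun _ => velocity s c)) => //.
    - exact: chart_img_fun.
    - exact: jointC_S.
    - exact: (cont_within_joint (has_deriv_cont_within eD)).
    - have : \forall r \near t, I r -> has_deriv I (E c) r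
          (- (E c r *m Omega nabla c (c (s r)) (velocity s c r))).
        apply: filterS nc => r + Ir => /(_ Ir) cr.
        by have [_ /(_ c ac cr)[]] := Ef r Ir.
      by move=> /(joint_snd (FF := one_filter_filter)).
  have H : \forall r \near t, I r ->
      velocity s c r *m invmx (E c r) = u r /\ E c r \in unitmx.
    apply: filterS nc => r + Ir => /(_ Ir) cr.
    by rewrite -uE // mulmxK; [split=> //|]; exact: Eu.
  have {}H := joint_snd (FF := one_filter_filter) H.
  apply: (jointC_near (@one_filterP) It
    (f := fun _ r => velocity s c r *m invmx (E c r))).
    by apply: filterS H => z [].
  apply: jointC_bilin => //; [exact: one_filterP|exact: bounded_bilinear_mulmx|].
  apply: jointC_invmx => //; first exact: one_filterP.
  by apply: filterS H => z [].
have /choice[P HP] : forall m : nat, exists P : 'I_n -> {poly R},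
    forall j t, (j <= k)%N -> I t ->
    `|derivnI j (row_poly P) t - derivnI j u t| <= m.+1%:R^-1.
  by move=> m; apply: row_poly_approx => //; rewrite invr_gt0 ltr0Sn.
have Pu j (e : R) : (j <= k)%N -> 0 < e -> \forall m \near \oo, forall t, I t ->
    `|derivnI j (row_poly (P m)) t - derivnI j u t| <= e.
  move=> jk e0; near=> m => t It; apply: le_trans (HP m j t jk It) _.
  rewrite invf_ple ?posrE ?ltr0Sn //.
  apply: le_trans (_ : m%:R <= _); last by rewrite ler_nat.
  by near: m; exact: nbhs_infty_ger.
have [|||sig [e [sol conv]]] := @perturbation _ _ _ nabla nat \oo _ s E u
   (fun m => row_poly (P m)) Ef uE.
- by move=> t It; exact: regular_cont_within (ur t It).
- by move=> m t It; exact: has_deriv_cont_within (has_deriv_row_poly _ _ _).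
- by move=> d; exact: (Pu 0%N).
exists sig; split.
  apply: filterS sol => m fm; split; last exact: solution_polynomial_like fm.
  by move=> j; exact: (@solution_regular _ _ _ _ _ (P m) _ fm j).
move=> t It; have [sct sD] := Ef t It; have [sigc ec] := conv t It.
have famc := with_limit_cvg sigc sct.
split=> // c ac cs; have [xD eD _] := sD c ac cs.
have eC := with_limit_cvg (ec c ac cs) (has_deriv_cont_within eD).
have [] // := @jointC_frame_equation _ _ _ nabla _ limit_at0 0%N _ (@limit_at0P) k c
  (fun m => c \o with_limit sig s m)
  (with_limit (fun m => row_poly (P m)) u)
  (with_limit (fun m => e m c) (E c)) t It ac.
- exact: chart_img_fun.
- apply: jointC_of_derivnI => j jk.
    have [_ /(_ jk) ujc] := regular_derivnI j ur It.
    have Pj : joint_cvg \oo I (fun m => derivnI j (row_poly (P m))) (derivnI j u t) t.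
      by apply: joint_cvg_uniform => // d d0; exact: Pu.
    have := with_limit_cvg Pj ujc.
    apply: cvg_trans; apply: near_eq_cvg.
    by apply: filterE => -[[|m] r].
  apply: filterS (joint_I (F := limit_at0) t) => -[[|m] r] /= Ir.
    have [/(_ jk) H _] := regular_derivnI j ur Ir.
    by have [] := has_deriv_derivI Ir H.
  have [|/(_ jk) H _] := @regular_derivnI _ k _ (row_poly (P m)) j r _ Ir.
    by move=> q Iq; apply: jointC_row_poly => //; exact: one_filterP.
  by have [] := has_deriv_derivI Ir H.
- exact: cvg_comp famc (chart_cvg cs).
- have dom : \forall z \near joint limit_at0 t, chart_dom c (with_limit sig s z.1 z.2).
    have oc : \forall q \near s t, chart_dom c q.
      by apply: open_nbhs_nbhs; split=> //; exact: chart_dom_open.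
    exact: famc oc.
  pose good m := forall r, I r -> chart_dom c (with_limit sig s m r) ->
     has_deriv I (c \o with_limit sig s m) r
       (with_limit (fun m => row_poly (P m)) u m r *m
        with_limit (fun m => e m c) (E c) m r) /\
     has_deriv I (with_limit (fun m => e m c) (E c) m) r
       (- (with_limit (fun m => e m c) (E c) m r *m
         Omega nabla c (c (with_limit sig s m r))
           (with_limit (fun m => row_poly (P m)) u m r *m
            with_limit (fun m => e m c) (E c) m r))).
  have goodn : limit_at0 good.
    split=> [r Ir cr|].
      by rewrite /= uE //; have [_ /(_ c ac cr)[]] := Ef r Ir.
    apply: filterS sol => m fm r Ir cr.
    by have [_ /(_ c ac cr)[]] := fm r Ir.
  have H1 := joint_I (FF := limit_at0_filter) t.
  have H2 := @joint_fst _ _ limit_at0 t _ goodn.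
  apply: filterS3 dom H1 H2 => -[m r] /= cr Ir; exact.
Unshelve. all: by end_near. Qed.

End Approximation.

(** * Continuous curves *)

Section Smoothing.
Variables (R : realType) (n : nat) (M : manifold R n) (nabla : connection M).
Implicit Types (c : chart R n M) (t : R) (A B : set R).
Local Notation I := (@unitI R).

Definition C1_on A (s : R -> M) (v : chart R n M -> R -> 'rV[R]_n) :=
  forall t, A t -> cont_within A s t /\ forall c, atlas c -> chart_dom c (s t) ->
    has_deriv A (c \o s) t (v c t) /\ cont_within A (v c) t.

Lemma C1_on_eq A (s s' : R -> M) (v v' : chart R n M -> R -> 'rV[R]_n) :
  (forall t, A t -> s t = s' t) ->
  (forall t c, A t -> atlas c -> chart_dom c (s t) -> v c t = v' c t) ->
  C1_on A s v -> C1_on A s' v'.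
Proof.
move=> ss' vv' sC t At; have [sc sD] := sC t At.
have nss : \forall r \near t, A r -> s r = s' r by near=> r; exact: ss'.
split=> [|c ac]; first exact: cont_within_near nss sc.
rewrite -ss' // => cs; have [H1 H2] := sD c ac cs; split.
  rewrite -(vv' t c) //; apply: has_deriv_near H1 => //.
  by apply: filterS nss => r + Ar => /(_ Ar) /= ->.
apply: cont_within_near H2 => //.
by apply: filterS (near_chart sc cs) => r + Ar => /(_ Ar) cr; exact: vv'.
Unshelve. all: by end_near. Qed.

Lemma C1_on_union A B (s : R -> M) (v : chart R n M -> R -> 'rV[R]_n) :
  closed A -> closed B -> C1_on A s v -> C1_on B s v -> C1_on (A `|` B) s v.
Proof.
move=> cA cB sA sB t ABt; split.
  by apply: cont_within_union => // Ct; [have [] := sA t Ct|have [] := sB t Ct].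
move=> c ac cs; split.
  by apply: has_deriv_union => // Ct; [have [_ /(_ c ac cs)[]] := sA t Ct|
    have [_ /(_ c ac cs)[]] := sB t Ct].
by apply: cont_within_union => // Ct; [have [_ /(_ c ac cs)[]] := sA t Ct|
  have [_ /(_ c ac cs)[]] := sB t Ct].
Qed.

Lemma C1_on_is_Ck (s : R -> M) (v : chart R n M -> R -> 'rV[R]_n) :
  C1_on I s v -> is_Ck_curve 1 s.
Proof.
move=> sC; split.
  by apply/subspace_continuousP => t It; have [] := sC t It.
move=> c t ac It cs; have [sc /(_ c ac cs)[xD vc]] := sC t It; split.
  by move=> [|] // _; have [] := has_deriv_derivI It xD.
apply: cont_within_near vc => //.
apply: filterS (near_chart sc cs) => r + Ir => /(_ Ir) cr.
have [_ /(_ c ac cr)[H _]] := sC r Ir.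
by have [_] := has_deriv_derivI Ir H.
Qed.

Lemma C1_on_of_chart A c (x w : R -> 'rV[R]_n) : atlas c ->
  (forall t, A t -> [/\ chart_img c (x t), has_deriv A x t (w t) & cont_within A w t]) ->
  C1_on A (chart_inv c \o x) (fun c' t => w t *m jac c c' (x t)).
Proof.
move=> ac xP t At; have [cx xD wc] := xP t At.
have ci r : A r -> c (chart_inv c (x r)) = x r.
  by move=> Ar; apply: chart_invK; have [] := xP r Ar.
have cd : chart_dom c (chart_inv c (x t)) by exact: chart_dom_inv.
have sc : cont_within A (chart_inv c \o x) t.
  exact: cvg_comp (has_deriv_cont_within xD) (chart_inv_cvg cx).
split=> // c' ac' /= c's; split.
  rewrite -[in X in has_deriv _ _ _ X](ci t At).
  apply: (@velocity_transfer _ _ _ nabla A (chart_inv c \o x)) => //.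
  by apply: has_deriv_near xD => //; near=> r => Ar /=; rewrite ci.
apply: cvg_bounded_bilinear wc _; first exact: bounded_bilinear_mulmx.
have cx' : overlap c c' (x t) by apply/overlapP.
exact: cvg_comp (has_deriv_cont_within xD) (jac_cvg ac ac' cx').
Unshelve. all: by end_near. Qed.

(** A cubic rising from [0] at [a] to [1] at [b] with vanishing derivative at
    both ends. *)
Definition smoothstep (a b : R) : {poly R} :=
  ((b - a) ^- 3) *: (('X - a%:P) ^+ 2 * ((3 * (b - a))%:P - 2%:P * ('X - a%:P))).

Lemma smoothstepE a b t : (smoothstep a b).[t] =
  (b - a) ^- 3 * ((t - a) ^+ 2 * (3 * (b - a) - 2 * (t - a))).
Proof. by rewrite /smoothstep !hornerE. Qed.

Lemma smoothstep_deriv a b t : (smoothstep a b)^`().[t] =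
  (b - a) ^- 3 * (6 * (t - a) * (b - t)).
Proof.
set rhs := RHS.
rewrite /smoothstep expr2 derivZ !(derivM, derivB, derivC, derivX) !hornerE.
by rewrite /rhs; set k := _ ^- 3; ring.
Qed.

Lemma smoothstep_itv a b t : a < b -> a <= t <= b ->
  0 <= (smoothstep a b).[t] <= 1.
Proof.
move=> ab /andP[at_ tb]; rewrite smoothstepE.
have L0 : 0 < (b - a) ^+ 3 by rewrite exprn_gt0 // subr_gt0.
apply/andP; split.
  rewrite mulr_ge0 ?invr_ge0 ?(ltW L0) // mulr_ge0 ?sqr_ge0 //; lra.
rewrite mulrC ler_pdivrMr // mul1r -subr_ge0.
have -> : (b - a) ^+ 3 - (t - a) ^+ 2 * (3 * (b - a) - 2 * (t - a)) =
  (b - t) ^+ 2 * ((b - a) + 2 * (t - a)) by ring.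
rewrite mulr_ge0 ?sqr_ge0 //; lra.
Qed.

Section Approximant.
Variables (s : R -> M) (good : R -> M -> Prop).
Hypothesis sc : forall t, I t -> cont_within I s t.
Hypothesis s_good : forall t, I t ->
  \forall q \near s t & r \near within I (nbhs t), good r q.

Let smooth_upto a := exists (sig : R -> M) (v : chart R n M -> R -> 'rV[R]_n),
  [/\ sig a = s a, forall c, v c a = 0, C1_on (seg 0 a) sig v &
      forall t, seg 0 a t -> good t (sig t)].

Lemma good_curve t : I t -> good t (s t).
Proof.
move=> It; have [[A B] /= [nA nB] AB] := s_good It.
apply: (AB (s t, t)); split=> /=; first exact: nbhs_singleton.
have : \forall r \near t, I r -> B r := nB.
by move=> /nbhs_singleton; exact.
Qed.

Lemma smooth_upto0 : smooth_upto 0.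
Proof.
have I0 : I 0 by rewrite unitI_seg /seg /= lexx ler01.
exists (fun=> s 0), (fun _ _ => 0); split=> //.
  move=> t _; split=> [|c _ _]; first exact: cvg_cst.
  by split; [exact: has_deriv_cst|exact: cvg_cst].
by move=> t /seg_eq ->; exact: good_curve.
Qed.

(** Replace [s] between [a] and [b] by the segment from [s a] to [s b] in a chart
    around [s t].  It stays in a small ball, hence among the good values, and
    its vanishing velocity at both ends makes the pieces fit in [C^1]. *)
Lemma smooth_upto_step t : I t -> exists2 d : R, 0 < d &
  forall a b, 0 <= a <= t -> t <= b <= 1 -> t - d < a -> b < t + d ->
    smooth_upto a -> smooth_upto b.
Proof.
move=> It; pose c0 := chart_at (s t).
have ac0 : atlas c0 by exact: chart_at_atlas.
have cd0 : chart_dom c0 (s t) by exact: chart_at_dom.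
have [[A B] /= [nA nB] AB] := s_good It.
pose x0 := c0 (s t); have cx0 : chart_img c0 x0 by exact: chart_img_fun.
have [rho rho0 Hrho] : exists2 r : R, 0 < r & forall x : 'rV[R]_n,
    `|x - x0| < r -> chart_img c0 x /\ A (chart_inv c0 x).
  have H1 : \forall x \near x0, chart_img c0 x.
    by apply: open_nbhs_nbhs; split=> //; exact: chart_img_open.
  have H2 : \forall x \near x0, A (chart_inv c0 x).
    by apply: (chart_inv_cvg cx0); rewrite /x0 chart_funK.
  have : nbhs x0 (fun x => chart_img c0 x /\ A (chart_inv c0 x)).
    exact: filterI.
  move=> /nbhs_ballP[r /= r0 rP]; exists r => // x xr; apply: rP.
  by rewrite -ball_normE /ball_ /= distrC.
have Hnear : \forall r \near t, I r -> [/\ chart_dom c0 (s r),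
    `|c0 (s r) - x0| < rho & B r].
  have H1 := near_chart (sc It) cd0.
  have xc : cont_within I (c0 \o s) t by exact: cvg_comp (sc It) (chart_cvg cd0).
  have /cont_withinP /(_ _ rho0) H2 := xc.
  have H3 : \forall r \near t, I r -> B r := nB.
  apply: filterS3 H1 H2 H3 => r + + + Ir.
  by move=> /(_ Ir) ? /(_ Ir) ? /(_ Ir) ?.
have /nbhs_ballP[d /= d0 Hd] := Hnear.
exists d => // a b /andP[a0 at_] /andP[tb b1] Ha Hb.
have [<-|neab] := eqVneq a b; first by [].
have ab : a < b by rewrite lt_neqAle neab (le_trans at_).
have sub : seg a b `<=` I by rewrite unitI_seg; apply: sub_seg.
have Hab r : seg a b r -> [/\ chart_dom c0 (s r), `|c0 (s r) - x0| < rho & B r].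
  move=> abr; have /andP[ar rb] := abr; apply: Hd; last exact: sub.
  rewrite -ball_normE /ball_ /= ltr_distlC; apply/andP; split.
    exact: lt_le_trans Ha ar.
  exact: le_lt_trans rb Hb.
have aba : seg a b a by exact/seg_l/ltW.
have abb : seg a b b by exact/seg_r/ltW.
have [ca xa _] := Hab a aba; have [cb xb _] := Hab b abb.
move=> [sig [v [siga va sigC sigG]]].
pose xx := c0 (s b) - c0 (s a).
pose x r := c0 (s a) + (smoothstep a b).[r] *: xx.
pose w r := (smoothstep a b)^`().[r] *: xx.
have bs := bounded_bilinearl xx (bounded_bilinear_scale 'rV[R]_n).
have xD r : has_deriv (seg a b) x r (w r).
  rewrite -[w r]add0r; apply: has_derivD; first exact: has_deriv_cst.
  exact: (has_deriv_lin bs (has_deriv_poly _ _ _)).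
have wc r : cont_within (seg a b) w r.
  exact: has_deriv_cont_within (has_deriv_lin bs (has_deriv_poly _ _ _)).
have xr r : seg a b r -> `|x r - x0| < rho.
  move=> abr; have /andP[p0 p1] := smoothstep_itv ab abr.
  set y := (smoothstep a b).[r] in p0 p1 *.
  have -> : x r - x0 = (1 - y) *: (c0 (s a) - x0) + y *: (c0 (s b) - x0).
    rewrite scalerBl scale1r -[RHS]addrA (addrC (- _)) -scalerBr opprB addrA.
    by rewrite subrK addrAC.
  apply: le_lt_trans (ler_normD _ _) _; rewrite !normrZ.
  have y1 : 0 <= 1 - y by rewrite subr_ge0.
  rewrite (ger0_norm p0) (ger0_norm y1).
  have [->|y0] := eqVneq y 0; first by rewrite subr0 mul1r mul0r addr0.
  have -> : rho = (1 - y) * rho + y * rho by ring.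
  apply: ler_ltD; first by rewrite ler_wpM2l // ltW.
  by rewrite ltr_pM2l // lt_neqAle eq_sym y0.
have xaE : x a = c0 (s a).
  by rewrite /x smoothstepE subrr expr0n mul0r mulr0 scale0r addr0.
have ba3 : (b - a) ^+ 3 != 0 by rewrite expf_neq0 // subr_eq0 eq_sym.
have xbE : x b = c0 (s b).
  rewrite /x smoothstepE (_ : _ * _ = 1); first by rewrite scale1r addrC subrK.
  by field; rewrite subr_eq0 eq_sym.
have wE r : r = a \/ r = b -> w r = 0.
  by move=> [->|->]; rewrite /w smoothstep_deriv subrr ?mulr0 ?mul0r ?mulr0 scale0r.
pose sig2 := chart_inv c0 \o x.
pose v2 c r := w r *m jac c0 c (x r).
have sigC2 : C1_on (seg a b) sig2 v2.
  apply: C1_on_of_chart => // r abr; split=> //.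
  by have [] := Hrho _ (xr r abr).
have sig2a : sig a = sig2 a by rewrite /sig2 /= xaE chart_funK.
exists (glue a sig sig2), (fun c => glue a (v c) (v2 c)); split.
- by rewrite (glue_r sig2a abb) /sig2 /= xbE chart_funK.
- by move=> c; rewrite /glue leNgt ab /= /v2 wE ?mul0mx //; right.
- rewrite (segU a0 (ltW ab)); apply: C1_on_union; try exact: seg_closed.
    by apply: C1_on_eq sigC => [r Hr|r c Hr _ _]; rewrite ?(glue_l _ _ Hr).
  apply: C1_on_eq sigC2 => [r Hr|r c Hr _ _]; first by rewrite (glue_r sig2a Hr).
  by rewrite (glue_r _ Hr) // va /v2 wE ?mul0mx //; left.
- move=> r; rewrite (segU a0 (ltW ab)) => -[Hr|Hr].
    by rewrite (glue_l _ _ Hr); exact: sigG.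
  rewrite (glue_r sig2a Hr); have [_ _ Br] := Hab r Hr.
  by apply: (AB (sig2 r, r)); split=> //=; have [] := Hrho _ (xr r Hr).
Qed.

(** [good t q] says that [q] is close enough to [s t]; [s_good] makes this an
    open condition around the graph of [s]. *)
Lemma C1_approximant : exists2 sig : R -> M, is_Ck_curve 1 sig &
  forall t, I t -> good t (sig t).
Proof.
have [sig [v [_ _ sigC sigG]]] : smooth_upto 1.
  apply: (@interval_induction R 0 1 smooth_upto ler01).
    exact: smooth_upto0.
  by move=> t t01; apply: smooth_upto_step; rewrite unitI_seg.
exists sig; last by rewrite unitI_seg.
by apply: (@C1_on_is_Ck _ v); rewrite unitI_seg.
Qed.

End Approximant.
End Smoothing.

(** * The compact-open topology *)

Section CkTopology.
Variables (R : realType) (n : nat) (M : manifold R n).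
Implicit Types (c : chart R n M) (t : R).
Local Notation I := (@unitI R).

Lemma open_subbase k (O : set (Ck_curve k M)) (s : Ck_curve k M) :
  open O -> O s -> exists D : {fset set (Ck_curve k M)},
    (forall U, U \in D -> Ck_subbase U /\ U s) /\
    forall s', (forall U, U \in D -> U s') -> O s'.
Proof.
move=> [A AO <-] [U AU Us]; have [D DS DU] := AO U AU.
have {}DU : \bigcap_(V in [set` D]) V = U := DU.
have {}Us : U s := Us.
exists D; split=> [V VD|s' Hs'].
  split; first by move: (DS V VD); rewrite in_setE.
  by rewrite -DU in Us; exact: Us.
exists U => //; suff : U s' by [].
by rewrite -DU => V VD; exact: Hs'.
Qed.

Lemma open_near_family k (T : Type) (F : set_system T) (o : T) {FF : Filter F}
    (Fo : forall P : set T, F P -> P o) (sig : T -> R -> M)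
    (O : set (Ck_curve k M)) (s : Ck_curve k M) :
  Ck_family F o k sig -> sig o = s -> open O -> O s ->
  \forall m \near F, forall s' : Ck_curve k M, curve_fun s' = sig m -> O s'.
Proof.
move=> sigC sigo oO Os; have [D [DS DO]] := open_subbase oO Os.
have : F (\bigcap_(U in [set` D])
    [set m | forall s' : Ck_curve k M, curve_fun s' = sig m -> U s']).
  apply: filter_bigI => U UD.
  have [[s0 [c [K [e [ac cK KI sK [e0 UE]]]]]] Us] := DS U UD.
  rewrite UE in Us *; have [sKc sclose] := Us.
  have := @Ck_family_near _ _ _ _ _ o FF k sig s0 c K e sigC (curve_Ck s0)
    ac cK KI sK; rewrite sigo => /(_ sKc sclose).
  apply: filterS => m [H1 H2] s' s'm; split; first by rewrite s'm.
  by move=> j t jk Kt; rewrite s'm; exact: H2.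
apply: filterS => m Hm s' s'm; apply: DO => U UD.
exact: Hm.
Qed.

Lemma is_Ck_curve_S k (s : R -> M) : is_Ck_curve k.+1 s -> is_Ck_curve k s.
Proof.
move=> sC; apply: regular_is_Ck_curve => [t It|c t ac It cs].
  exact: is_Ck_curve_cont_within sC It.
exact: jointC_S (is_Ck_curve_regular sC ac It cs).
Qed.

(** A subbasic neighborhood asks, at order [0], for the value at each time of a
    compact set to lie in an open set: this is the condition [good]. *)
Lemma C1_dense_C0 (nabla : connection M) (O : set (Ck_curve 0 M))
    (s : Ck_curve 0 M) : open O -> O s ->
  exists2 s' : Ck_curve 0 M, O s' & is_Ck_curve 1 s'.
Proof.
move=> oO Os; have [D [DS DO]] := open_subbase oO Os.
have sC := curve_Ck s.
pose data := (Ck_curve 0 M * chart R n M * (set R) * R)%type.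
(* One presentation of each of the finitely many subbasic sets, so that [good]
   is a finite conjunction of open conditions. *)
have /choice[f Hf] : forall U : set (Ck_curve 0 M), exists d : data,
    U \in D -> let: (s0, c, K, e) := d in
      [/\ atlas c, compact K, K `<=` I, s0 @` K `<=` chart_dom c &
       0 < e /\ U = Ck_neighborhood s0 c K e].
  move=> U; have [UD|] := boolP (U \in D); last first.
    by move=> _; exists (s, chart_at (s 0), set0, 1).
  have [[s0 [c [K [e H]]]] _] := DS U UD.
  by exists (s0, c, K, e).
pose good t (q : M) := forall U, U \in D -> let: (s0, c, K, e) := f U in
  K t -> chart_dom c q /\ `|c q - c (s0 t)| < e.
have [|t It|sig sigC sigG] := @C1_approximant _ _ _ nabla s good.
- by move=> t It; exact: is_Ck_curve_cont_within sC It.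
- pose P U (z : M * R) := let: (s0, c, K, e) := f U in
    K z.2 -> chart_dom c z.1 /\ `|c z.1 - c (s0 z.2)| < e.
  have : filter_prod (nbhs (s t)) (within I (nbhs t))
      (\bigcap_(U in [set` D]) P U).
    apply: filter_bigI => U UD; have := Hf U UD; rewrite /P.
    case: (f U) => [[[s0 c] K] e] [ac cK KI sK [e0 UE]].
    have [Kt|nKt] := pselect (K t); last first.
      have cl : closed K by apply: compact_closed cK; exact: norm_hausdorff.
      have nK := not_in_closed_near cl nKt.
      exists (setT, ~` K); last by move=> [q r] [_ /= nKr].
      split=> /=; first exact: filterT.
      have : \forall r \near t, I r -> ~ K r by apply: filterS nK.
      exact.
    have [_ Us] := DS U UD; rewrite UE in Us; have [sKc sclose] := Us.
    have cst : chart_dom c (s t) by apply: sKc; exists t.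
    have cs0 : chart_dom c (s0 t) by apply: sK; exists t.
    have H1 : c z.1 @[z --> filter_prod (nbhs (s t)) (within I (nbhs t))] --> c (s t).
      apply: cvg_comp (chart_cvg cst); exact: cvg_fst.
    have H2 : c (s0 z.2) @[z --> filter_prod (nbhs (s t)) (within I (nbhs t))]
        --> c (s0 t).
      have s0c : cont_within I (c \o s0) t.
        exact: (is_Ck_curve_cont_derivnI (curve_Ck s0) ac It cs0 (leqnn 0)).
      have sndc : z.2 @[z --> filter_prod (nbhs (s t)) (within I (nbhs t))]
          --> within I (nbhs t) by exact: cvg_snd.
      exact: (cvg_comp _ _ sndc s0c).
    have cl := sclose 0%N t (leqnn 0) Kt.
    have H3 : \forall z \near filter_prod (nbhs (s t)) (within I (nbhs t)),
        `|c z.1 - c (s0 z.2)| < e.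
      exact: cvgr_lt (cvg_norm (cvgB H1 H2)) _ cl.
    have H4 : \forall z \near filter_prod (nbhs (s t)) (within I (nbhs t)),
        chart_dom c z.1.
      apply: cvg_fst; apply: open_nbhs_nbhs; split=> //.
      exact: chart_dom_open.
    by apply: filterS2 H3 H4.
  by apply: filterS => -[q r] Hq U UD; exact: (Hq U UD).
pose s' := CkCurve (is_Ck_curve_S sigC); exists s' => //.
apply: DO => U UD; have := Hf U UD.
have := fun t It => sigG t It U UD.
case: (f U) => [[[s0 c] K] e] HG [ac cK KI sK [e0 ->]].
split; first by move=> _ [t Kt <-]; have [] := HG t (KI t Kt) Kt.
by move=> j t; rewrite leqn0 => /eqP -> Kt; have [] := HG t (KI t Kt) Kt.
Qed.

Lemma polynomial_like_in_open k (nabla : connection M) (O : set (Ck_curve k M))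
    (s : Ck_curve k M) : open O -> O s -> is_Ck_curve (maxn k 1) s ->
  exists2 s' : Ck_curve k M, O s' & polynomial_like nabla s'.
Proof.
move=> oO Os; have [k1 mE] : exists k1, maxn k 1 = k1.+1.
  by exists (maxn k 1).-1; rewrite prednK // leq_max orbT.
rewrite mE => sC; have [sig [sol sigC]] := Ck_approximation nabla sC.
have kk : (k <= k1.+1)%N by rewrite -mE leq_maxl.
have sigCk : Ck_family limit_at0 0%N k (with_limit sig s).
  move=> t It; have [H1 H2] := sigC t It; split=> // c ac cs.
  exact: jointC_le kk (H2 c ac cs).
have [_ near_O] := open_near_family (@limit_at0P) sigCk erefl oO Os.
have [m [[reg poly] Om]] := filter_ex (filterI sol near_O).
by exists (CkCurve (reg k)) => //; exact: Om.
Qed.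

End CkTopology.

Theorem theorem3p3 (R : realType) (n : nat) (M : manifold R n)
    (g : riemannian_metric M) (nabla : connection M) (k : nat) :
  complete_metric g -> metric_compatible nabla g ->
  dense [set gamma : Ck_curve k M | polynomial_like nabla gamma].
Proof.
move=> _ _ O [s Os] oO.
suff [s' Os' s'P] : exists2 s' : Ck_curve k M, O s' & polynomial_like nabla s'.
  by exists s'.
case: k => [|k] in s O Os oO *.
  have [s1 Os1 s1C] := C1_dense_C0 nabla oO Os.
  exact: polynomial_like_in_open oO Os1 s1C.
apply: polynomial_like_in_open oO Os _.
by rewrite (maxn_idPl _) //; exact: curve_Ck.
Qed.
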